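(* Let $N\ge 1$, $Q=2N+2$, $0<s<1<p<Q$, $\delta\in(0,1)$, and let $\Omega\subset\mathbb{H}^N$ be a bounded smooth domain. Let $f\in L^1(\Omega)\setminus\{0\}$ be nonnegative. Then the following are equivalent: (i) there exists a constant $C>0$ such that for every $v\in HW_0^{s,p}(\Omega)$, $$C\left(\int_\Omega|v|^{1-\delta}f\,dx\right)^{\frac{p}{1-\delta}}\le\int_{\mathbb{H}^N}\int_{\mathbb{H}^N}|v(x)-v(y)|^p\,d\mu;$$ (ii) the singular fractional $p$-Laplace problem $$(-\Delta_{H,p})^su=f(x)u^{-\delta}\ \text{in }\Omega,\qquad u>0\ \text{in }\Omega,\qquad u=0\ \text{in }\mathbb{H}^N\setminus\Omega$$ admits a weak solution in $HW_0^{s,p}(\Omega)$.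
   Context: The Heisenberg group $\mathbb{H}^N$ is $\mathbb{R}^{2N+1}$ with the group law $\xi\circ\eta=\left(x_1+y_1,\dots,x_{2N}+y_{2N},\tau+\tau'+\frac12\sum_{i=1}^N(x_iy_{N+i}-x_{N+i}y_i)\right)$ for $\xi=(x_1,\dots,x_{2N},\tau)$, $\eta=(y_1,\dots,y_{2N},\tau')$. Norm: $|\xi|=\left(\left(\sum_{i=1}^{2N}x_i^2\right)^2+\tau^2\right)^{1/4}$. Integration is with respect to Lebesgue measure on $\mathbb{R}^{2N+1}$ (the Haar measure). $d\mu=\frac{dx\,dy}{|y^{-1}\circ x|^{Q+sp}}$. $J_p(t)=|t|^{p-2}t$. $HW^{s,p}(\mathbb{H}^N)=\{v\in L^p(\mathbb{H}^N):\int_{\mathbb{H}^N}\int_{\mathbb{H}^N}|v(x)-v(y)|^p\,d\mu<\infty\}$ and $HW_0^{s,p}(\Omega)=\{u\in HW^{s,p}(\mathbb{H}^N):u=0\text{ in }\mathbb{H}^N\setminus\Omega\}$. The integral $\int_\Omega|v|^{1-\delta}f\,dx$ takes values in $[0,\infty]$, so the inequality in (i) includes its finiteness. $(-\Delta_{H,p})^su(x)=\mathrm{P.V.}\int_{\mathbb{H}^N}\frac{J_p(u(x)-u(y))}{|y^{-1}\circ x|^{Q+sp}}\,dy$ is the fractional $p$-sub-Laplacian; the equation is understood in the following weak sense. $u\in HW_0^{s,p}(\Omega)$ is a weak solution of the problem in (ii) if for every $\omega\Subset\Omega$ there is $C=C(\omega)>0$ with $u\ge C$ a.e. in $\omega$,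 and for every $\varphi\in C_c^1(\Omega)$, $$\int_{\mathbb{H}^N}\int_{\mathbb{H}^N}J_p(u(x)-u(y))(\varphi(x)-\varphi(y))\,d\mu=\int_\Omega f u^{-\delta}\varphi\,dx.$$ *)

(* Defs.v *)
From HB Require Import structures.
From mathcomp Require Import all_boot all_order all_algebra.
From mathcomp Require Import all_classical all_reals all_analysis.

Set Implicit Arguments.
Unset Strict Implicit.
Unset Printing Implicit Defensive.

Import Order.TTheory GRing.Theory Num.Theory.
Import numFieldNormedType.Exports.

Local Open Scope classical_set_scope.
Local Open Scope ring_scope.

(* The sigma-algebra on R^n generated by the coordinates, i.e. the Borel
   sigma-algebra, defined as the library does for tuples. *)
Definition measure_rV_display : measure_display.
Proof. exact default_measure_display. Qed.

Section measurable_rV.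
Context (R : realType) (n : nat).

Definition coord_rV (i : 'I_n) (x : 'rV[R]_n) : R := x 0 i.

Let rV_set0 : g_sigma_preimage coord_rV set0.
Proof. exact: sigma_algebra0. Qed.

Let rV_setC A : g_sigma_preimage coord_rV A -> g_sigma_preimage coord_rV (~` A).
Proof. exact: sigma_algebraC. Qed.

Let rV_bigcup (F : (set 'rV[R]_n)^nat) :
  (forall i, g_sigma_preimage coord_rV (F i)) ->
  g_sigma_preimage coord_rV (\bigcup_i (F i)).
Proof. exact: sigma_algebra_bigcup. Qed.

HB.instance Definition _ := @isMeasurable.Build measure_rV_display
  'rV[R]_n (g_sigma_preimage coord_rV) rV_set0 rV_setC rV_bigcup.

End measurable_rV.

Lemma measurable_coord_rV (R : realType) n (i : 'I_n) :
  measurable_fun [set: 'rV[R]_n] (coord_rV i).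
Proof.
move=> _ Y mY; rewrite setTI; apply: sub_sigma_algebra => /=.
rewrite -bigcup_seq/=; exists i => /=; first by rewrite mem_index_enum.
by exists Y => //; rewrite setTI.
Qed.

Lemma measurable_fun_rVP d (T : measurableType d) (R : realType) n
    (f : T -> 'rV[R]_n) :
  measurable_fun [set: T] f <->
  forall i, measurable_fun [set: T] (coord_rV i \o f).
Proof.
split=> [mf i|mf]; first exact: measurableT_comp (measurable_coord_rV i) mf.
move=> _ A mA; rewrite setTI; move: A mA.
suff : g_sigma_preimage (@coord_rV R n) `<=`
    [set A | measurable (f @^-1` A)] by [].
apply: smallest_sub.
  split=> /=; first by rewrite preimage_set0.
  - by move=> A mA; rewrite setTD preimage_setC; exact: measurableC.
  - by move=> F mF; rewrite preimage_bigcup; exact: bigcup_measurable.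
move=> A; rewrite -bigcup_seq/= => -[i _ [B mB <-]].
by rewrite setTI/= -comp_preimage -[X in measurable X]setTI; exact: mf.
Qed.

Section lebesgue_rV.
Variable R : realType.

Definition cons_rV n (p : measurableTypeR R * 'rV[R]_n) : 'rV[R]_n.+1 :=
  row_mx p.1%:M p.2 : 'rV[R]_(1 + n).

Definition uncons_rV n (v : 'rV[R]_n.+1) : measurableTypeR R * 'rV[R]_n :=
  (v 0 0, rsubmx (v : 'rV[R]_(1 + n))).

Lemma cons_rV0 n p : @cons_rV n p 0 0 = p.1.
Proof.
have e : (0 : 'I_(1 + n)) = lshift n (0 : 'I_1) by exact: val_inj.
by have := row_mxEl (p.1%:M : 'M[R]_1) p.2 0 0; rewrite -e => ->; rewrite mxE.
Qed.

Lemma cons_rVS n p (i : 'I_n) : @cons_rV n p 0 (lift ord0 i) = p.2 0 i.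
Proof.
have e : (lift ord0 i : 'I_(1 + n)) = rshift 1 i by exact: val_inj.
by have := row_mxEr (p.1%:M : 'M[R]_1) p.2 0 i; rewrite -e.
Qed.

Lemma cons_rVK n : cancel (@cons_rV n) (@uncons_rV n).
Proof. by case=> a v; rewrite /uncons_rV cons_rV0/= /cons_rV row_mxKr. Qed.

Lemma measurable_cons_rV n : measurable_fun [set: _] (@cons_rV n).
Proof.
apply/measurable_fun_rVP => i.
case: (unliftP ord0 i) => [j ->|->].
  rewrite (_ : _ \o _ = coord_rV j \o snd); last first.
    by apply/funext => p /=; rewrite /coord_rV cons_rVS.
  exact: measurableT_comp (measurable_coord_rV j) measurable_snd.
rewrite (_ : _ \o _ = fst); last first.
  by apply/funext => p /=; rewrite /coord_rV cons_rV0.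
exact: measurable_fst.
Qed.

Lemma measurable_uncons_rV n : measurable_fun [set: _] (@uncons_rV n).
Proof.
apply/measurable_fun_pairP; split; first exact: measurable_coord_rV.
apply/measurable_fun_rVP => i.
rewrite (_ : _ \o _ = coord_rV (lift ord0 i)); last first.
  apply/funext => v /=; rewrite /coord_rV mxE; congr (v _ _); exact: val_inj.
exact: measurable_coord_rV.
Qed.

Section step.
Variables (n : nat) (m : {sigma_finite_measure set 'rV[R]_n -> \bar R}).

Definition lebesgue_rV_step : set 'rV[R]_n.+1 -> \bar R :=
  pushforward (lebesgue_measure \x m)%E (@cons_rV n).

HB.instance Definition _ := Measure.copy lebesgue_rV_step
  (measure_function_pushforward__canonical__measure_function_Measure (lebesgue_measure \x m)%E (@measurable_cons_rV n)).

Let lebesgue_rV_step_sigma_finite : sigma_finite setT lebesgue_rV_step.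
Proof.
have /sigma_finiteP[F [FT ndF Ffin]] := sigma_finiteT (@lebesgue_measure R).
have /sigma_finiteP[G [GT ndG Gfin]] := sigma_finiteT m.
exists (fun k => @uncons_rV n @^-1` (F k `*` G k)).
  apply/esym; rewrite -subTset => v _.
  have [k _ Fk] : (\bigcup_k F k) (uncons_rV v).1 by rewrite -FT.
  have [l _ Gl] : (\bigcup_k G k) (uncons_rV v).2 by rewrite -GT.
  exists (maxn k l) => //; split.
    by move: Fk; exact/subsetPset/ndF/leq_maxl.
  by move: Gl; exact/subsetPset/ndG/leq_maxr.
move=> k; have [mF Foo] := Ffin k; have [mG Goo] := Gfin k; split.
  rewrite -[X in measurable X]setTI; apply: measurable_uncons_rV => //.
  exact: measurableX.
rewrite /lebesgue_rV_step /pushforward -comp_preimage.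
rewrite (_ : _ \o _ = id) ?preimage_id; last first.
  by apply/funext; exact: cons_rVK.
by rewrite product_measure1E// lte_mul_pinfty// ge0_fin_numE.
Qed.

HB.instance Definition _ := Measure_isSigmaFinite.Build _ _ _
  lebesgue_rV_step lebesgue_rV_step_sigma_finite.

End step.

(* Lebesgue measure on R^n: the image of the product of the one-dimensional
   Lebesgue measure and of Lebesgue measure on R^(n-1). *)
Fixpoint lebesgue_rV n : {sigma_finite_measure set 'rV[R]_n -> \bar R} :=
  match n with
  | 0%N => \d_(0 : 'rV[R]_0)
  | n'.+1 => lebesgue_rV_step (lebesgue_rV n')
  end.

Lemma lebesgue_rV_box n (A : 'I_n -> set (measurableTypeR R)) :
  (forall i, measurable (A i)) ->
  lebesgue_rV n [set x | forall i, A i (x 0 i)] =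
  (\prod_(i < n) lebesgue_measure (A i))%E.
Proof.
elim: n A => [A _|n IH A mA] /=.
  by rewrite big_ord0 diracE mem_set//= => -[].
rewrite big_ord_recl /lebesgue_rV_step /pushforward.
rewrite (_ : _ @^-1` _ = A ord0 `*`
    [set x : 'rV[R]_n | forall i, A (lift ord0 i) (x 0 i)]).
  have mAn : measurable [set x : 'rV[R]_n | forall i, A (lift ord0 i) (x 0 i)].
    rewrite (_ : [set _ | _] = \bigcap_(i in [set: 'I_n])
        coord_rV i @^-1` A (lift ord0 i)).
      apply: fin_bigcap_measurable => // i _.
      rewrite -[X in measurable X]setTI.
      by apply: measurable_coord_rV => //; exact: mA.
    by apply/seteqP; split=> x /= h; [move=> i _; exact: h|move=> i; exact: h].
  rewrite product_measure1E//; congr (_ * _)%E.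
  by apply: (IH (fun i => A (lift ord0 i))) => i; exact: mA.
apply/seteqP; split=> p /=.
  by move=> h; split=> [|i]; [rewrite -cons_rV0|rewrite -cons_rVS]; exact: h.
move=> [h0 hS] i; case: (unliftP ord0 i) => [j ->|->].
  by rewrite cons_rVS.
by rewrite cons_rV0.
Qed.

End lebesgue_rV.

Section regularity.
Variables (R : realType) (n : nat).
Implicit Types (f : 'rV[R]_n -> R) (A : set 'rV[R]_n).

Definition partial (i : 'I_n) f : 'rV[R]_n -> R := 'D_(delta_mx 0 i) f.

Fixpoint Ck (k : nat) f : Prop :=
  match k with
  | 0%N => continuous f
  | k'.+1 => (forall x, differentiable f x) /\ forall i, Ck k' (partial i f)
  end.

Definition compactly_contained A B := compact (closure A) /\ closure A `<=` B.

(* C_c^1(A), its elements being extended by 0 outside A *)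
Definition C1c A f := Ck 1 f /\ compactly_contained [set x | f x != 0] A.

(* Near each of its boundary points, A is the sublevel set {r < 0} of a smooth
   function r with nonvanishing gradient; as A is open this forces r = 0 on the
   boundary. A local r may be taken smooth on the whole space by cutting off. *)
Definition smooth_boundary A :=
  forall x0, closure A x0 -> ~ A x0 ->
  exists r : 'rV[R]_n -> R,
    [/\ forall k, Ck k r, exists i, partial i r x0 != 0 &
      \forall x \near x0, A x <-> r x < 0].

Definition bounded_smooth_domain A :=
  [/\ open A, connected A, A !=set0, bounded_set A & smooth_boundary A].

End regularity.

Notation heis R N := 'rV[R]_(N + N).+1.

Section heisenberg.
Variables (R : realType) (N : nat).
Implicit Types x y : heis R N.

(* x = (x_1, ..., x_2N, tau), with hz x i = x_(i+1) and ht x = tau *)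
Definition hz x (i : 'I_(N + N)) : R := x 0 (widen_ord (leqnSn _) i).

Definition ht x : R := x 0 ord_max.

Definition hmul x y : heis R N :=
  \row_j (x 0 j + y 0 j +
    if j == ord_max then
      2^-1 * \sum_(i < N) (hz x (lshift N i) * hz y (rshift N i) -
                           hz x (rshift N i) * hz y (lshift N i))
    else 0).

(* the inverse is the opposite vector: see hmulVx *)
Definition hinv x : heis R N := - x.

(* the Heisenberg gauge; `|x| is the library's sup norm on R^(2N+1) *)
Definition hnorm x : R :=
  ((\sum_(i < N + N) hz x i ^+ 2) ^+ 2 + ht x ^+ 2) `^ 4^-1.

Lemma hmulVx x : hmul (hinv x) x = 0.
Proof.
apply/rowP => j; rewrite !mxE addNr add0r; case: ifP => // _.
rewrite big1 ?mulr0// => i _.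
by rewrite /hz !mxE !mulNr [X in - X]mulrC subrr.
Qed.

Definition hmu : {sigma_finite_measure set (heis R N) -> \bar R} :=
  lebesgue_rV R (N + N).+1.

(* homogeneous dimension *)
Definition hdim : nat := (N + N).+2.

End heisenberg.

Section fractional.
Variables (R : realType) (N : nat) (s p : R).
Implicit Types (u v phi : heis R N -> R) (Omega : set (heis R N)).

Definition Jp (t : R) : R := `|t| `^ (p - 2) * t.

(* The density of d mu with respect to dx dy. On the diagonal, a null set, it
   takes the junk value 0^-1 = 0. *)
Definition hkernel (z : heis R N * heis R N) : R :=
  (hnorm (hmul (hinv z.2) z.1) `^ ((hdim N)%:R + s * p))^-1.

Local Open Scope ereal_scope.

Definition gagliardo v : \bar R :=
  \int[hmu R N \x hmu R N]_z (`|v z.1 - v z.2| `^ p * hkernel z)%:E.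

(* Elements of L^p are represented by Borel functions, so that all pointwise
   conditions on them are required almost everywhere. *)
Definition HW v : Prop := v \in Lfun (hmu R N) p%:E /\ gagliardo v < +oo.

Definition HW0 Omega v : Prop :=
  HW v /\ {ae hmu R N, forall x, ~ Omega x -> v x = 0%R}.

Definition energy u phi : \bar R :=
  \int[hmu R N \x hmu R N]_z
    (Jp (u z.1 - u z.2) * (phi z.1 - phi z.2) * hkernel z)%:E.

Definition weak_solution (delta : R) Omega (f u : heis R N -> R) : Prop :=
  [/\ HW0 Omega u,
    forall omega, compactly_contained omega Omega ->
      exists2 C : R, (0 < C)%R &
        {ae hmu R N, forall x, omega x -> (C <= u x)%R} &
    forall phi, C1c Omega phi ->
      energy u phi =
      \int[hmu R N]_(x in Omega) (f x * u x `^ (- delta) * phi x)%:E].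

End fractional.

(* Main.v *)
Require Import Defs.
From HB Require Import structures.
From mathcomp Require Import all_boot all_order all_algebra.
From mathcomp Require Import all_classical all_reals all_analysis.
From mathcomp Require Import measurable_realfun.
From mathcomp Require Import ring lra.

(** Write m = 1 - delta, G(v) for the double integral of |v(x) - v(y)|^p d mu,
    and F(v) for the integral of |v|^m f.

    The inequality gives a solution.  A solution is found as a minimiser of
    I(v) = G(v) / p - F(v) / m over the nonnegative v that vanish off Omega.
    The inequality bounds F(v) by a power of G(v) smaller than 1, so I is
    bounded below ([coercive]).  Since |.|^p is uniformly convex and t^m is
    concave, almost minimisers are close to each other in the seminorm; with
    Poincare's inequality this yields a minimising sequence that converges
    almost everywhere, and Fatou's lemma shows that its limit is a minimiser
    ([minimizer]).

    The equation contains u^(-delta), so u has to be bounded away from 0 on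
    compact sets before I can be varied.  A minimiser satisfies
    G(u) <= G(u + phi) for phi >= 0, and phi is taken to be the truncation
    (k (eta - sg) - u)_+, where eta is the distance to the complement, cut
    off at 1.  The interaction of the zero set of u with a set where u is
    large shows first that u > 0 almost everywhere ([supersolution_pos]).
    So {u < k eta} has small measure for small k, and a De Giorgi iteration
    based on a Faber-Krahn inequality turns this into u >= k (eta - sg)
    ([lower_bound]).  In directions supported where u is bounded below,
    convexity of G and concavity of F give the equation
    ([variation_le], [minimizer_euler_lagrange]).

    A solution gives the inequality.  The point is to test the equation with
    an arbitrary nonnegative w of finite energy that vanishes off Omega: then
    Young's inequality gives a bound for the integral of f u^(-delta) w that
    is affine in G(w) ([weighted_bound]), the tangent inequality
    |v|^m <= m |v| u^(m-1) + (1 - m) u^m transfers it to F(v) ([Fi_bound]), and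
    scaling makes it homogeneous ([sobolev_of_solution]).  By Fatou's lemma it
    suffices that w is the almost everywhere limit of functions phi_n >= 0 in
    C_c^1(Omega) with G(phi_n) <= L G(w), where L depends on N only
    ([approximation]).  This is where the boundary of Omega matters.  Left
    translations preserve G.  At each boundary point some translation by
    t e_j or - t e_j is transversal to the boundary, because right-invariant
    fields span all directions; so the minimum of w and its translates by all
    t e_j and - t e_j has compact support in Omega ([shifts_inside]), and its
    energy is at most a fixed multiple of G(w).  Averaging this minimum over
    small left translations with a C^1 weight does not increase the energy, by
    Jensen's inequality, and produces a function of class C^1
    ([gagliardo_smoothing], [mollify_C1]).  Both modifications are small in L^p
    because left translations by small elements are continuous on the energy
    space ([translation_estimate]). *)

Set Implicit Arguments.
Unset Strict Implicit.
Unset Printing Implicit Defensive.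

Import Order.TTheory GRing.Theory Num.Theory.
Import numFieldNormedType.Exports.

Local Open Scope classical_set_scope.
Local Open Scope ring_scope.

(** * Convexity of powers *)

Section powers.
Variables (R : realType) (p : R).
Hypothesis p_gt1 : 1 < p.
Local Ltac plra := have := p_gt1; lra.
Implicit Types a b c d t x y : R.

(** Since t^p = t t^(p-1), this follows from two instances of 1 + y < exp y.
    Strictness away from t = 1 is what finally makes minimising sequences
    converge. *)
Lemma bernoulli_powR t : 0 <= t -> t != 1 -> 1 + p * (t - 1) < t `^ p.
Proof.
rewrite le_eqVlt => /predU1P[<- _|t0 t1].
  rewrite powR0; last by rewrite gt_eqF//; plra.
  by move: p_gt1; plra.
have y0 : ln t != 0 by rewrite ln_eq0.
have tE : expR (ln t) = t by rewrite lnK.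
rewrite /powR gt_eqF//.
set y := ln t in y0 tE *.
have h1 : 1 + (p - 1) * y < expR ((p - 1) * y).
  by rewrite expR_gt1Dx// mulf_neq0// gt_eqF//; plra.
have h2 : 1 - y < expR (- y) by rewrite expR_gt1Dx// oppr_eq0.
have e1 : expR (p * y) = t * expR ((p - 1) * y).
  by rewrite -tE -expRD; congr expR; ring.
have e2 : t * expR (- y) = 1 by rewrite -{1}tE -expRD subrr expR0.
rewrite e1.
have h1' : t * (1 + (p - 1) * y) < t * expR ((p - 1) * y) by rewrite ltr_pM2l.
have h2' : (p - 1) * (t * (1 - y)) < (p - 1) * 1.
  rewrite ltr_pM2l ?subr_gt0//.
  by rewrite -[X in _ < X]e2 ltr_pM2l.
apply: le_lt_trans h1'.
rewrite -subr_ge0; apply/ltW; move: h2'; rewrite -subr_gt0.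
by congr (_ < _); ring.
Qed.

Lemma bernoulli_powRW t : 0 <= t -> 1 + p * (t - 1) <= t `^ p.
Proof.
move=> t0; have [->|t1] := eqVneq t 1; last exact/ltW/bernoulli_powR.
by rewrite subrr mulr0 addr0 powR1.
Qed.

Definition pw t : R := `|t| `^ p.

Lemma pw0 : p != 0 -> pw 0 = 0. Proof. by move=> p0; rewrite /pw normr0 powR0. Qed.

Let p0 : p != 0. Proof. by rewrite gt_eqF//; plra. Qed.
Let pge0 : 0 <= p. Proof. by plra. Qed.

Lemma pw_ge0 t : 0 <= pw t. Proof. exact: powR_ge0. Qed.
Lemma pwN t : pw (- t) = pw t. Proof. by rewrite /pw normrN. Qed.
Lemma pwM a b : pw (a * b) = pw a * pw b.
Proof. by rewrite /pw normrM powRM. Qed.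
Lemma pw_ger0 a : 0 <= a -> pw a = a `^ p. Proof. by move=> a0; rewrite /pw ger0_norm. Qed.
Lemma ler_pw a b : `|a| <= `|b| -> pw a <= pw b.
Proof. by move=> ab; apply: ge0_ler_powR; rewrite ?nnegrE. Qed.
Lemma pw_gt0 a : a != 0 -> 0 < pw a.
Proof. by move=> a0; rewrite powR_gt0// normr_gt0. Qed.

Lemma Jp0 : Jp p 0 = 0. Proof. by rewrite /Jp mulr0. Qed.
Lemma Jpxx a : Jp p a * a = pw a.
Proof.
rewrite /Jp -mulrA -expr2 -real_normK ?num_real// /pw.
have [->|a0] := eqVneq a 0; first by rewrite normr0 expr0n/= mulr0 powR0.
rewrite -[X in _ * X]powR_mulrn// -powRD; last by rewrite normr_eq0 a0 implybT.
by congr (_ `^ _); ring.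
Qed.

Lemma norm_Jp a : `|Jp p a| = `|a| `^ (p - 1).
Proof.
rewrite /Jp normrM (ger0_norm (powR_ge0 _ _)).
have [->|a0] := eqVneq a 0.
  by rewrite normr0 mulr0 powR0// subr_eq0 gt_eqF.
rewrite -[X in _ * X]powRr1// -powRD; last by rewrite normr_eq0 a0 implybT.
by congr (_ `^ _); ring.
Qed.

(** By homogeneity this is Bernoulli's inequality for b / a. All convexity
    properties of the energy are drawn from it. *)
Lemma pw_tangent a b : pw a + p * Jp p a * (b - a) <= pw b.
Proof.
have [->|a0] := eqVneq a 0; first by rewrite pw0// Jp0 mulr0 mul0r addr0 pw_ge0.
pose t := b / a; have bE : b = a * t by rewrite /t mulrCA divff// mulr1.
rewrite bE pwM (_ : _ + _ = pw a * (1 + p * (t - 1))); last first.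
  by rewrite -Jpxx; ring.
apply: ler_wpM2l; first exact: pw_ge0.
have [t0|t0] := leP 0 t; first by rewrite pw_ger0// bernoulli_powRW.
apply: le_trans (pw_ge0 _).
rewrite (_ : _ + _ = - ((p - 1) + p * (- t))); last by ring.
by rewrite oppr_le0 addr_ge0// ?mulr_ge0//; plra.
Qed.

Lemma pw_mid a b : pw ((a + b) / 2) <= (pw a + pw b) / 2.
Proof.
have h1 := pw_tangent ((a + b) / 2) a; have h2 := pw_tangent ((a + b) / 2) b.
by move: h1 h2; set J := p * _; set X := pw _; nra.
Qed.

Lemma pwD a b : pw (a + b) <= 2 `^ p * (pw a + pw b).
Proof.
have h2 : 1 <= 2 `^ p :> R by apply: le_trans (le1r_powR _ _); plra.
have -> : a + b = 2 * ((a + b) / 2) by plra.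
rewrite pwM; have -> : pw 2 = 2 `^ p by rewrite pw_ger0.
rewrite ler_pM2l; last by plra.
apply: le_trans (pw_mid a b) _; have := pw_ge0 a; have := pw_ge0 b; plra.
Qed.

Lemma pwB a b : pw (a - b) <= 2 `^ p * (pw a + pw b).
Proof. by rewrite -(pwN b) pwD. Qed.

(** The larger of |a| and |b| dominates both factors, so the product is at most
    its p-th power. *)
Lemma Jp_young a b : `|Jp p a * b| <= pw a + pw b.
Proof.
rewrite normrM norm_Jp.
have [ab|ba] := leP `|b| `|a|.
  apply: (@le_trans _ _ (pw a)); last by rewrite lerDl pw_ge0.
  rewrite /pw -(@mulr_powRB1 _ `|a| p)//; last by plra.
  by rewrite mulrC ler_wpM2r// powR_ge0.
apply: (@le_trans _ _ (pw b)); last by rewrite lerDr pw_ge0.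
rewrite /pw -(@mulr_powRB1 _ `|b| p)//; last by plra.
rewrite mulrC ler_wpM2l// ge0_ler_powR ?nnegrE//; [plra|exact: ltW].
Qed.

(** Convexity: b + d and c are convex combinations of b and c + d with
    complementary weights. *)
Lemma pw_incr_homo b c d : 0 <= d -> b <= c -> pw (b + d) - pw b <= pw (c + d) - pw c.
Proof.
move=> d0 bc; have [->|d1] := eqVneq d 0; first by rewrite !addr0 !subrr.
have [->//|bc1] := eqVneq b c.
pose l := c - b + d; have l0 : 0 < l.
  rewrite /l; have : b < c by rewrite lt_neqAle bc1.
  plra.
have conv x y t : 0 <= t <= 1 -> pw (t * x + (1 - t) * y) <= t * pw x + (1 - t) * pw y.
  move=> /andP[t0 t1].
  have h1 := pw_tangent (t * x + (1 - t) * y) x.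
  have h2 := pw_tangent (t * x + (1 - t) * y) y.
  set z := t * x + _ in h1 h2 *.
  have := lerD (ler_wpM2l t0 h1) (ler_wpM2l (_ : 0 <= 1 - t) h2).
  rewrite subr_ge0 => /(_ t1); apply: le_trans.
  by rewrite le_eqVlt; apply/orP; left; apply/eqP; rewrite /z; ring.
pose t := d / l.
have t01 : 0 <= t <= 1.
  rewrite divr_ge0//= ?(ltW l0)// ler_pdivrMr// mul1r /l; plra.
have lt : l * t = d by rewrite /t mulrCA divff ?mulr1// gt_eqF.
have h1 := conv (c + d) b _ t01; have h2 := conv b (c + d) _ t01.
have e1 : t * (c + d) + (1 - t) * b = b + d by rewrite -[in RHS]lt /l; ring.
have e2 : t * b + (1 - t) * (c + d) = c.
  by transitivity (c + d - l * t); [rewrite /l; ring|rewrite lt; ring].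
rewrite e1 in h1; rewrite e2 in h2; move: h1 h2.
set A := pw (c + d); set B := pw b; plra.
Qed.

End powers.

Section powers2.
Variables (R : realType).
Implicit Types a b c d t x y p r : R.

Lemma continuous_pw r : 0 < r -> continuous (pw r).
Proof.
move=> r0 x; have [->|x0] := eqVneq x 0.
  rewrite /continuous_at pw0 ?gt_eqF//; apply/cvgrPdist_lt => e e0.
  have e1 : 0 < e `^ r^-1 by rewrite powR_gt0.
  have : \forall t \near (0 : R), `|0 - t| < e `^ r^-1 by exact: (@cvgr_dist_lt _ _ _ (nbhs (0 : R)) _ id _ cvg_id _ e1).
  apply: filterS => t; rewrite !sub0r !normrN => te.
  rewrite ger0_norm ?powR_ge0// /pw.
  have -> : e = (e `^ r^-1) `^ r by rewrite -powRrM mulVf ?gt_eqF// powRr1// ltW.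
  by rewrite gt0_ltr_powR// ?nnegrE// ltW.
rewrite /continuous_at {2}/pw /powR normr_eq0 (negbTE x0).
have : expR (r * ln `|t|) @[t --> x] --> expR (r * ln `|x|).
  apply: (@continuous_comp _ _ _ (fun t => r * ln `|t|) expR); last exact: continuous_expR.
  apply: cvgMr; apply: (@continuous_comp _ _ _ (fun t : R => `|t|) (@ln R)).
    exact: norm_continuous.
  by apply: continuous_ln; rewrite normr_gt0.
apply: cvg_trans; apply: near_eq_cvg.
near=> t; rewrite /pw /powR normr_eq0 ifF//; apply/negbTE.
by near: t; exact: open_neq.
Unshelve. all: by end_near. Qed.

Lemma continuous_Jp p : 1 < p -> continuous (Jp p : R -> R).
Proof.
move=> p1 x; have [->|x0] := eqVneq x 0.
  rewrite /continuous_at Jp0; apply/norm_cvg0P.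
  have := @continuous_pw (p - 1) _ 0; rewrite subr_gt0 => /(_ p1).
  rewrite /continuous_at pw0 ?subr_eq0 ?gt_eqF//; apply: cvg_trans.
  by apply: near_eq_cvg; near=> t; rewrite norm_Jp.
rewrite /continuous_at /Jp; apply: cvgM; last exact: cvg_id.
rewrite /powR normr_eq0 (negbTE x0).
have : expR ((p - 2) * ln `|t|) @[t --> x] --> expR ((p - 2) * ln `|x|).
  apply: (@continuous_comp _ _ _ (fun t => (p - 2) * ln `|t|) expR); last exact: continuous_expR.
  apply: cvgMr; apply: (@continuous_comp _ _ _ (fun t : R => `|t|) (@ln R)).
    exact: norm_continuous.
  by apply: continuous_ln; rewrite normr_gt0.
apply: cvg_trans; apply: near_eq_cvg.
near=> t; rewrite normr_eq0 ifF//; apply/negbTE.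
by near: t; exact: open_neq.
Unshelve. all: by end_near. Qed.

(** Strict convexity between t and 1, the qualitative input of the compactness
    argument for uniform convexity. *)
Lemma pw_mid_lt p t : 1 < p -> -1 <= t -> t < 1 -> pw p ((1 + t) / 2) < (1 + pw p t) / 2.
Proof.
move=> p1 tN1 t1.
have p0 : p != 0 by rewrite gt_eqF//; lra.
have := tN1; rewrite le_eqVlt => /predU1P[<-|t2].
  by rewrite addrN mul0r pw0// pwN /pw normr1 powR1; lra.
pose c := (1 + t) / 2; have c0 : 0 < c by rewrite /c; lra.
have h1 : 1 + p * (c^-1 - 1) < pw p c^-1.
  rewrite pw_ger0 ?invr_ge0 1?ltW//; apply: bernoulli_powR => //.
    by rewrite invr_ge0 ltW.
  by rewrite invr_eq1 /c; apply/negP => /eqP ?; lra.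
have h2 : 1 + p * (t / c - 1) <= pw p (t / c).
  have := @pw_tangent _ p p1 1 (t / c).
  by rewrite /Jp !normr1 powR1 /pw normr1 powR1 !mulr1.
have e : c^-1 + t / c = 2 by rewrite -{1}[c^-1]mul1r -mulrDl /c; field; rewrite -/c; apply/eqP => ?; lra.
have : pw p c * 2 < pw p c * (pw p c^-1 + pw p (t / c)).
  rewrite ltr_pM2l; last by apply: pw_gt0; rewrite gt_eqF.
  have -> : 2 = 1 + p * (c^-1 - 1) + (1 + p * (t / c - 1)).
    have -> : t / c = 2 - c^-1 by rewrite -e; ring.
    by ring.
  exact: ltr_leD.
rewrite [X in _ < X -> _]mulrDr -!pwM divff ?gt_eqF// [c * (t / c)]mulrCA divff ?gt_eqF// mulr1.
have -> : pw p 1 = 1 by rewrite /pw normr1 powR1.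
lra.
Qed.

(** A form of uniform convexity that treats p < 2 and p >= 2 alike: away from
    the diagonal the convexity gap is bounded below by compactness, and close to
    the diagonal the difference is absorbed by the term with the factor e. *)
Lemma pw_uniform_convex p e : 1 < p -> 0 < e -> exists2 K, 0 < K & forall a b,
  pw p (a - b) <= e * (pw p a + pw p b) +
                  K * ((pw p a + pw p b) / 2 - pw p ((a + b) / 2)).
Proof.
move=> p1 e0.
have p0 : p != 0 by rewrite gt_eqF//; lra.
have pp : 0 < p by lra.
(* By homogeneity it is enough to treat a = 1 and |b| <= 1. *)
suff [K K0 HK] : exists2 K, 0 < K & forall t, -1 <= t <= 1 ->
   pw p (1 - t) <= e * (1 + pw p t) + K * ((1 + pw p t) / 2 - pw p ((1 + t) / 2)).
  exists K => // a b.
  have red x y : `|y| <= `|x| -> pw p (x - y) <= e * (pw p x + pw p y) +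
                  K * ((pw p x + pw p y) / 2 - pw p ((x + y) / 2)).
    have [-> |x0 yx] := eqVneq x 0.
      by rewrite normr0 normr_le0 => /eqP ->; rewrite subr0 addr0 mul0r pw0//; lra.
    pose t := y / x.
    have ye : y = x * t by rewrite /t mulrCA divff// mulr1.
    have -> : x - y = x * (1 - t) by rewrite ye; ring.
    have -> : (x + y) / 2 = x * ((1 + t) / 2) by rewrite ye; lra.
    rewrite [in leRHS]ye (pwM _ _ (1 - t)) (pwM _ _ t) (pwM _ _ ((1 + t) / 2)).
    have : -1 <= t <= 1.
      by rewrite -ler_norml /t normrM normfV ler_pdivrMr ?mul1r// normr_gt0.
    move=> /HK /(ler_wpM2l (pw_ge0 p x)); move=> /le_trans; apply.
    by rewrite le_eqVlt; apply/orP; left; apply/eqP; lra.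
  have [ba|/ltW ab] := leP `|b| `|a|; first exact: red.
  by have := red _ _ ab; rewrite -pwN opprB [pw p b + _]addrC [b + a]addrC.
(* For |1 - t| <= tau the term with e suffices; on the rest of the interval the
   convexity gap h has a positive minimum. *)
pose tau := Num.min (1/2) (e `^ p^-1).
have tau0 : 0 < tau by rewrite /tau lt_min powR_gt0// andbT.
have tau1 : tau <= 1/2 by rewrite /tau ge_min lexx.
have taue : pw p tau <= e.
  rewrite pw_ger0; last exact: ltW.
  rewrite [leRHS](_ : e = (e `^ p^-1) `^ p); last by rewrite -powRrM mulVf// powRr1// ltW.
  apply: ge0_ler_powR; rewrite ?nnegrE ?powR_ge0 ?(ltW pp) ?(ltW tau0)//.
  by rewrite /tau ge_min lexx orbT.
pose h (t : R) := (1 + pw p t) / 2 - pw p ((1 + t) / 2).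
have hc : continuous h.
  move=> t; apply: cvgB.
    apply: cvgMl; apply: cvgD; first exact: cvg_cst.
    exact: continuous_pw.
  apply: (@continuous_comp _ _ _ (fun t => (1 + t) / 2) (pw p)); last exact: continuous_pw.
  by apply: cvgMl; apply: cvgD; [exact: cvg_cst|exact: cvg_id].
have [c cin hmin] : exists2 c, c \in `[-1, 1 - tau] & forall t, t \in `[-1, 1 - tau] -> h c <= h t.
  by apply: EVT_min; [lra|exact: continuous_subspaceT].
have hc0 : 0 < h c.
  move: cin; rewrite in_itv/= => /andP[c1 c2].
  rewrite /h subr_gt0 pw_mid_lt//; lra.
exists (2 `^ p / h c); first by rewrite divr_gt0// powR_gt0.
move=> t /andP[t1 t2]; have [tt|tt] := leP t (1 - tau).
  apply: (@le_trans _ _ (2 `^ p / h c * h t)).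
    rewrite -mulrA mulrC -ler_pdivrMr ?powR_gt0//; last first.
    apply: (@le_trans _ _ 1); last by rewrite mulrC ler_pdivlMr// mul1r hmin// in_itv/= t1 tt.
    rewrite ler_pdivrMr ?powR_gt0// mul1r -[leRHS]pw_ger0//.
    by apply: ler_pw; [lra|rewrite ger0_norm ?ger0_norm//; lra].
  by rewrite lerDr mulr_ge0 ?(ltW e0)// addr_ge0// pw_ge0.
apply: (@le_trans _ _ (e * (1 + pw p t))); last first.
  rewrite lerDl mulr_ge0// ?divr_ge0 ?powR_ge0 ?(ltW hc0)// subr_ge0.
  by have := pw_mid p1 1 t; have -> : pw p 1 = 1 by rewrite /pw normr1 powR1.
apply: (@le_trans _ _ e); last by rewrite ler_peMr ?(ltW e0)// lerDl pw_ge0.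
apply: le_trans taue; apply: ler_pw; first lra.
by rewrite !ger0_norm ?(ltW tau0)//; lra.
Qed.

End powers2.

(** * Truncations and concave powers *)

Section powers3.
Variables (R : realType) (p : R).
Hypothesis p_gt1 : 1 < p.
Implicit Types a b d : R.

(** In the application b is a difference u(x) - u(y), d the difference of a
    truncation and a that of the barrier. As increments of |.|^p are monotone,
    adding d to b costs at most |a|^p - |a - d|^p, while |a - d|^p and |a|^p
    together control |d|^p. *)
Lemma pw_caccioppoli a b d :
  (0 <= d /\ b + d <= a) \/ (d <= 0 /\ a <= b + d) ->
  pw p (b + d) + pw p d / 2 `^ p <= pw p b + 2 * pw p a.
Proof.
have c0 : 0 < 2 `^ p :> R by rewrite powR_gt0.
have half x y : pw p y / 2 `^ p <= pw p (x - y) + pw p x.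
  rewrite ler_pdivrMr// mulrC -[X in pw p X <= _](subKr x) addrC opprB -(pwN p (x - y)) opprB.
  apply: le_trans (_ : _ <= pw p ((x - (x - y)))) _.
    by rewrite le_eqVlt; apply/orP; left; apply/eqP; congr (pw p _); ring.
  by have := pwB p_gt1 x (x - y); rewrite [pw p x + _]addrC -(pwN p (x - y)) opprB.
move=> [[d0 le]|[d0 le]].
  have := pw_incr_homo p_gt1 d0 (_ : b <= a - d); rewrite lerBrDr => /(_ le).
  rewrite subrK; have := half a d; lra.
have := @pw_incr_homo _ _ p_gt1 (- b) (- a + d) (- d); rewrite oppr_ge0 => /(_ d0).
rewrite -opprD !pwN addrK pwN -lerBlDr -opprD lerN2 => /(_ le).
have := half a d; rewrite -(pwN _ (- a + d)) opprD opprK; lra.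
Qed.

(** Adding the truncation f = (e - u)_+ to u increases the energy density only
    at pairs that meet the set {u < e}; moreover the energy density of f is
    gained there. The four cases are the positions of x and y with respect to
    that set, and each is an instance of [pw_caccioppoli]. *)
Lemma pw_truncation ux uy ex ey fx fy :
  fx = Num.max 0 (ex - ux) -> fy = Num.max 0 (ey - uy) ->
  pw p ((ux + fx) - (uy + fy)) + pw p (fx - fy) / 2 `^ p <=
  pw p (ux - uy) + 2 * pw p (ex - ey) * ((ux < ex)%R%:R + (uy < ey)%R%:R).
Proof.
move=> fxD fyD; rewrite (_ : (ux + fx) - _ = (ux - uy) + (fx - fy)); last by ring.
have [x1|x1] := ltP ux ex; have [y1|y1] := ltP uy ey.
- have -> : fx = ex - ux by rewrite fxD max_r// subr_ge0 ltW.
  have -> : fy = ey - uy by rewrite fyD max_r// subr_ge0 ltW.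
  apply: le_trans (pw_caccioppoli (a := ex - ey) _) _.
    by have [?|?] := leP 0 (ex - ux - (ey - uy)); [left|right]; lra.
  rewrite /=; have := pw_ge0 p (ex - ey); lra.
- have -> : fx = ex - ux by rewrite fxD max_r// subr_ge0 ltW.
  have -> : fy = 0 by rewrite fyD max_l// subr_le0.
  apply: le_trans (pw_caccioppoli (a := ex - ey) _) _; first by left; lra.
  by rewrite /=; lra.
- have -> : fx = 0 by rewrite fxD max_l// subr_le0.
  have -> : fy = ey - uy by rewrite fyD max_r// subr_ge0 ltW.
  apply: le_trans (pw_caccioppoli (a := ex - ey) _) _; first by right; lra.
  by rewrite /=; lra.
- have -> : fx = 0 by rewrite fxD max_l// subr_le0.
  have -> : fy = 0 by rewrite fyD max_l// subr_le0.
  rewrite subrr pw0; last by rewrite gt_eqF//; have := p_gt1; lra.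
  by rewrite /= mul0r !addr0 mulr0 addr0.
Qed.

(** At a pair with u(y) >= M far above the barrier, raising u(x) by fx brings
    the two values closer, and the derivative of |.|^p is at least p (M/2)^(p-1)
    in between. This gain, linear in fx, is the nonlocal mechanism behind
    positivity. *)
Lemma pw_truncation_source M ux uy ex ey fx fy : 0 < M -> ex <= M / 2 -> ey <= M / 2 ->
  fx = Num.max 0 (ex - ux) -> fy = Num.max 0 (ey - uy) ->
  pw p ((ux + fx) - (uy + fy)) + p * (M / 2) `^ (p - 1) * (fx * (M <= uy)%R%:R) <=
  pw p (ux - uy) + 2 * pw p (ex - ey) * ((ux < ex)%R%:R + (uy < ey)%R%:R).
Proof.
move=> M0 exM eyM fxD fyD.
have base : pw p ((ux + fx) - (uy + fy)) <=
  pw p (ux - uy) + 2 * pw p (ex - ey) * ((ux < ex)%R%:R + (uy < ey)%R%:R).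
  apply: le_trans (pw_truncation fxD fyD).
  by rewrite lerDl divr_ge0 ?pw_ge0// powR_ge0.
have [yA|yA] := boolP (M <= uy); last by rewrite !mulr0 addr0.
have [x1|x1] := ltP ux ex; last first.
  have fx0 : fx = 0 by rewrite fxD max_l// subr_le0.
  move: base; rewrite [_ < _]ltNge x1/= fx0 mul0r mulr0 !addr0.
  by [].
have fxE : fx = ex - ux by rewrite fxD max_r// subr_ge0 ltW.
have -> : fy = 0 by rewrite fyD max_l// subr_le0; lra.
rewrite addr0 mulr1.
apply: (@le_trans _ _ (pw p (ux - uy))); last first.
  by rewrite lerDl mulr_ge0 ?addr_ge0// mulr_ge0 ?pw_ge0.
have -> : ux + fx - uy = ex - uy by rewrite fxE; ring.
apply: le_trans (pw_tangent p_gt1 (ex - uy) (ux - uy)); rewrite lerD2l.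
have -> : ux - uy - (ex - uy) = - fx by rewrite fxE; ring.
have fx0 : 0 <= fx by rewrite fxE subr_ge0 ltW.
rewrite -mulrA -[X in _ <= X]mulrA ler_wpM2l//; first by have := p_gt1; lra.
rewrite mulrN -mulNr ler_wpM2r//.
have t0 : ex - uy <= - (M / 2) by lra.
have J0 : Jp p (ex - uy) <= 0 by rewrite /Jp mulr_ge0_le0 ?powR_ge0//; lra.
rewrite -(ler0_norm J0) norm_Jp// ge0_ler_powR ?nnegrE//; [|by have := p_gt1; lra..|].
  by have := p_gt1; lra.
by rewrite ler0_norm; lra.
Qed.

End powers3.

Section concave_powers.
Variables (R : realType) (m : R).
Hypotheses (m_gt0 : 0 < m) (m_lt1 : m < 1).
Implicit Types x y : R.

(** The tangent of t^m at y lies above the graph; it is Bernoulli's inequality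
    with the exponent 1/m at the point (x/y)^m. *)
Lemma powR_concave_tangent x y : 0 <= x -> 0 < y ->
  x `^ m <= m * (x * y `^ (m - 1)) + (1 - m) * y `^ m.
Proof.
move=> x0 y0; have m1 : 1 < m^-1 by rewrite invf_gt1.
have t0 : 0 <= x / y by rewrite divr_ge0// ltW.
have := bernoulli_powRW m1 (powR_ge0 (x / y) m).
rewrite -powRrM mulfV ?gt_eqF// powRr1// => h.
have {}h : (x / y) `^ m <= 1 + m * (x / y - 1).
  have mm : m * m^-1 = 1 by rewrite mulfV ?gt_eqF.
  have := ler_wpM2l (ltW m_gt0) h.
  rewrite mulrDr mulrA mm; lra.
have ym0 : 0 < y `^ m by rewrite powR_gt0.
have := ler_wpM2r (ltW ym0) h.
rewrite -powRM ?(ltW y0)// mulfVK ?gt_eqF// => /le_trans; apply.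
have -> : y `^ (m - 1) = y `^ m / y.
  by rewrite powRB ?powRr1// ?ltW// (gt_eqF y0) implybT.
by rewrite le_eqVlt; apply/orP; left; apply/eqP; field; rewrite gt_eqF.
Qed.

Lemma powR_concave_mid x y : 0 <= x -> 0 <= y ->
  (x `^ m + y `^ m) / 2 <= ((x + y) / 2) `^ m.
Proof.
move=> x0 y0; have [c0|c0] := leP ((x + y) / 2) 0.
  have -> : x = 0 by lra.
  have -> : y = 0 by lra.
  by rewrite addr0 mul0r powR0 ?gt_eqF// addr0 mul0r.
have h1 := powR_concave_tangent x0 c0; have h2 := powR_concave_tangent y0 c0.
set c := (x + y) / 2 in c0 h1 h2 *.
have e : c `^ m = c * c `^ (m - 1).
  by rewrite -{2}[c]powRr1 ?(ltW c0)// -powRD ?(gt_eqF c0) ?implybT//; congr (_ `^ _); ring.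
have e2 : x + y = 2 * c by rewrite /c; lra.
have h3 : x * c `^ (m - 1) + y * c `^ (m - 1) = 2 * c `^ m.
  by rewrite -mulrDl e2 e; ring.
nra.
Qed.

Lemma powR_subadd x y : 0 <= x -> 0 <= y -> (x + y) `^ m <= x `^ m + y `^ m.
Proof.
move=> x0 y0; have [c0|c0] := leP (x + y) 0.
  have -> : x + y = 0 by lra.
  by rewrite powR0 ?gt_eqF// addr_ge0// powR_ge0.
have sub z : 0 <= z -> z <= x + y -> z / (x + y) * (x + y) `^ m <= z `^ m.
  move=> z0 zc; have [->|zz] := eqVneq z 0; first by rewrite !mul0r powR_ge0.
  have t0 : 0 < z / (x + y) by rewrite divr_gt0// lt_neqAle eq_sym zz.
  rewrite -{2}(divfK (lt0r_neq0 c0) z) powRM ?(ltW t0) ?(ltW c0)//.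
  rewrite ler_wpM2r ?powR_ge0// ger1_powR// ?(ltW m_lt1)// t0/=.
  by rewrite ler_pdivrMr// mul1r.
apply: le_trans (lerD (sub x x0 _) (sub y y0 _)); rewrite ?lerDl ?lerDr//.
by rewrite -mulrDl -mulrDl divff ?mul1r// gt_eqF.
Qed.

(** Young's inequality for 1 against X, the exponent 1/m being larger than 1; it
    yields coercivity. *)
Lemma powR_le_affine th : 0 < th -> exists2 A : R, 0 < A & forall X : R, 0 <= X ->
  X <= A + th * X `^ m^-1.
Proof.
move=> th0; have m1 : 1 < m^-1 by rewrite invf_gt1.
have e0 : m^-1 - 1 != 0 by rewrite gt_eqF// subr_gt0.
pose A := th^-1 `^ (m^-1 - 1)^-1.
have A0 : 0 < A by rewrite powR_gt0// invr_gt0.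
exists A => // X X0; have [XA|AX] := leP X A.
  by rewrite (le_trans XA)// lerDl mulr_ge0 ?(ltW th0)// powR_ge0.
have Xp : 0 < X by exact: lt_trans AX.
apply: (@le_trans _ _ (th * X `^ m^-1)); last by rewrite lerDr ltW.
rewrite -mulr_powRB1 ?(ltW Xp)//; last by rewrite invr_gt0.
rewrite mulrCA ler_peMr// -ler_pdivrMl// mulr1.
have -> : th^-1 = A `^ (m^-1 - 1) by rewrite /A -powRrM mulVf// powRr1// invr_ge0 ltW.
by rewrite ge0_ler_powR ?nnegrE ?(ltW A0) ?(ltW AX)// subr_ge0 ltW.
Qed.

End concave_powers.

(** * Borel sets and affine invariance of Lebesgue measure *)

Section measurable_rV_topology.
Variables (R : realType) (n : nat).

(** A countable basis of the topology whose members are products of intervals. *)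
Definition rat_ball (c : 'rV[rat]_n * nat) : set 'rV[R]_n :=
  [set x | forall i, `|x 0 i - ratr (c.1 0 i)| < c.2.+1%:R^-1].

Lemma measurable_coordwise (A : 'I_n -> set R) : (forall i, measurable (A i)) ->
  measurable [set x : 'rV[R]_n | forall i, A i (x 0 i)].
Proof.
move=> mA; rewrite (_ : [set x : 'rV[R]_n | _] = \bigcap_(i in [set: 'I_n]) (coord_rV i @^-1` A i)).
  apply: fin_bigcap_measurable => // i _.
  rewrite -[X in measurable X]setTI.
  by apply: measurable_coord_rV => //; exact: mA.
by apply/seteqP; split=> x /= h; [move=> i _; exact: h|move=> i; exact: h].
Qed.

Lemma measurable_rat_ball c : measurable (rat_ball c).
Proof.
apply: (@measurable_coordwise (fun i => [set t | `|t - ratr (c.1 0 i)| < c.2.+1%:R^-1])) => i.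
rewrite (_ : [set t | _] = ball (ratr (c.1 0 i) : R) c.2.+1%:R^-1).
  by rewrite ball_itv; exact: measurable_itv.
by apply/seteqP; split => t /=; rewrite /ball/= distrC.
Qed.

Lemma mx_norm_lt (x : 'rV[R]_n) e : 0 < e -> (`|x| < e) = [forall i, `|x 0 i| < e].
Proof.
move=> e0; apply/idP/forallP => [xe i|h].
  by apply: le_lt_trans xe; rewrite [leRHS]/Num.norm/= mx_normrE; exact: (@Order.TotalTheory.le_bigmax _ _ _ 0 (fun i => `|x i.1 i.2|) (0, i)).
rewrite [ltLHS]/Num.norm/= mx_normrE; apply: bigmax_lt => // -[i j] _ /=.
by rewrite ord1.
Qed.

Lemma mx_norm_coord (x : 'rV[R]_n) i : `|x 0 i| <= `|x|.
Proof.
by rewrite [leRHS]/Num.norm/= mx_normrE; exact: (@Order.TotalTheory.le_bigmax _ _ _ 0 (fun i => `|x i.1 i.2|) (0, i)).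
Qed.

Lemma mx_norm_le (x : 'rV[R]_n) e : 0 <= e -> (forall i, `|x 0 i| <= e) -> `|x| <= e.
Proof.
move=> e0 h; rewrite [leLHS]/Num.norm/= mx_normrE; apply: bigmax_le => // -[i j] _ /=.
by rewrite ord1.
Qed.

(** The sigma-algebra of R^n is generated by the coordinates and its topology by
    the sup norm. Both have the cubes of rational centre and radius in common,
    and countably many of them fill an open set. *)
Lemma open_measurable_rV (U : set 'rV[R]_n) : open U -> measurable U.
Proof.
move=> oU.
pose D := [set c : 'rV[rat]_n * nat | rat_ball c `<=` U].
pose E k := if unpickle k is Some c then if `[< D c >] then rat_ball c else set0 else set0.
suff -> : U = \bigcup_k E k.
  apply: bigcup_measurable => k _; rewrite /E; case: (unpickle k) => // c.
  by case: asboolP => // _; exact: measurable_rat_ball.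
apply/seteqP; split => [x Ux|x [k _]]; last first.
  by rewrite /E; case: (unpickle k) => // c; case: asboolP => // Dc; exact: Dc.
suff [c Dc xc] : exists2 c, D c & rat_ball c x.
  by exists (pickle c) => //; rewrite /E pickleK asboolT.
have /nbhs_ballP[e/= e0 xeU] := open_nbhs_nbhs (conj oU Ux).
have [k ke] : exists k, k.+1%:R^-1 < e / 2.
  have e20 : 0 < e / 2 by rewrite divr_gt0.
  by have [k hk] := ltr_add_invr e20; exists k; rewrite add0r in hk.
have /boolp.choice[q qP] : forall i, exists q : rat, `|x 0 i - ratr q| < k.+1%:R^-1.
  move=> i.
  have xk : x 0 i - k.+1%:R^-1 < x 0 i by rewrite ltrBlDr ltrDl invr_gt0.
  have [q] := rat_in_itvoo xk.
  rewrite in_itv/= => /andP[h1 h2]; exists q; rewrite ltr_distlC h1/= (lt_trans h2)//.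
  by rewrite ltrDl invr_gt0.
exists (\row_i q i, k) => [y|] /=; last by move=> i; rewrite mxE.
move=> hy; apply: xeU; rewrite -ball_normE /ball_/= mx_norm_lt//; apply/forallP => i.
have := hy i; have := qP i; rewrite !mxE/= => h1 h2.
rewrite -(subrKA (ratr (q i))) (le_lt_trans (ler_normD _ _))//.
by rewrite [X in _ + X]distrC [ltRHS]splitr ltrD// (lt_trans _ ke).
Qed.

Lemma continuous_measurable_rV (f : 'rV[R]_n -> R) : continuous f -> measurable_fun [set: _] f.
Proof.
move=> cf; apply: (measurability _ (RGenOpens.measurableE R)).
move=> _ [_ [a [b ->] <-]]; rewrite setTI.
by apply: open_measurable_rV; move/continuousP: cf; apply; exact: interval_open.
Qed.

End measurable_rV_topology.

Section affine.
Variable R : realType.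
Local Notation leb := (@lebesgue_measure R).

Lemma lebesgue_measureD (a : R) (A : set (measurableTypeR R)) : measurable A ->
  pushforward leb (fun x : measurableTypeR R => x + a : measurableTypeR R) A = leb A.
Proof.
move=> mA; apply/esym/lebesgue_measure_unique => //=.
  exact: measurable_funD.
move=> _ _ [[b c] _ <-].
rewrite /pushforward (_ : _ @^-1` _ = `](b - a), (c - a)]%classic).
  rewrite !lebesgue_measure_itv/= !lte_fin ltrD2r.
  by rewrite -!EFinD; congr (if _ then _%:E else _); ring.
by apply/seteqP; split => x /=; rewrite !in_itv/= => /andP[? ?]; apply/andP; split; lra.
Qed.

Lemma lebesgue_translation (a : R) (F : measurableTypeR R -> \bar R) :
  measurable_fun [set: measurableTypeR R] F -> (forall x, 0 <= F x)%E ->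
  (\int[leb]_x F (x + a)%R = \int[leb]_x F x)%E.
Proof.
move=> mF F0.
have mphi : measurable_fun [set: measurableTypeR R] (fun x : measurableTypeR R => x + a : measurableTypeR R).
  exact: measurable_funD.
rewrite -[LHS](ge0_integral_pushforward mphi leb measurableT mF)//.
by apply: eq_measure_integral => A mA _ /=; exact: lebesgue_measureD.
Qed.

Lemma lebesgue_opp (F : measurableTypeR R -> \bar R) :
  measurable_fun [set: measurableTypeR R] F -> (forall x, 0 <= F x)%E ->
  (\int[leb]_x F (- x)%R = \int[leb]_x F x)%E.
Proof.
move=> mF F0.
have mphi : measurable_fun [set: measurableTypeR R] (fun x : measurableTypeR R => - x : measurableTypeR R).
  exact: measurableT_comp.
rewrite -[LHS](ge0_integral_pushforward mphi leb measurableT mF)//.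
by apply: eq_measure_integral => A mA _ /=; exact: lebesgue_measureN.
Qed.

Lemma integral_cons_rV n (F : 'rV[R]_n.+1 -> \bar R) :
  measurable_fun [set: _] F -> (forall x, 0 <= F x)%E ->
  (\int[lebesgue_rV R n.+1]_x F x =
   \int[leb]_x \int[lebesgue_rV R n]_r F (cons_rV (x, r)))%E.
Proof.
move=> mF F0.
rewrite [LHS](ge0_integral_pushforward (@measurable_cons_rV R n) (leb \x lebesgue_rV R n)%E measurableT mF)//.
rewrite preimage_setT fubini_tonelli1//; last by move=> x; exact: F0.
exact: measurableT_comp (@measurable_cons_rV R n).
Qed.

Definition affine_rV n (e : R) (a : 'rV[R]_n) (U : 'M[R]_n) (x : 'rV[R]_n) : 'rV[R]_n :=
  e *: x + a + x *m U.

Lemma affine_rVE n e a U x j : @affine_rV n e a U x 0 j =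
  e * x 0 j + a 0 j + \sum_i x 0 i * U i j.
Proof. by rewrite /affine_rV !mxE. Qed.

Lemma measurable_affine_rV n e a U : measurable_fun [set: _] (@affine_rV n e a U).
Proof.
apply/measurable_fun_rVP => i.
rewrite (_ : _ \o _ = fun x => e * coord_rV i x + a 0 i + \sum_j coord_rV j x * U j i).
  apply: measurable_funD; last first.
    by apply: measurable_sum => j; apply: measurable_funM => //; exact: measurable_coord_rV.
  by apply: measurable_funD => //; apply: measurable_funM => //; exact: measurable_coord_rV.
by apply/funext => x; rewrite /coord_rV /affine_rV/= !mxE.
Qed.

Lemma affine_rV_cons n (e a0 x0 : R) (a : 'rV[R]_n) (U : 'M[R]_n.+1) r :
  (forall i j : 'I__, (j <= i)%N -> U i j = 0) ->
  let U1 : 'M[R]_(1 + n) := U in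
  affine_rV e (cons_rV (a0, a)) U (cons_rV (x0, r)) =
  cons_rV (e * x0 + a0, affine_rV e (a + x0 *: ursubmx U1) (drsubmx U1) r).
Proof.
move=> Ut U1; apply/rowP => j; rewrite [LHS]affine_rVE big_ord_recl.
case: (unliftP ord0 j) => [k ->|->].
  rewrite !cons_rVS !cons_rV0 affine_rVE !mxE /=.
  have -> : U ord0 (lift ord0 k) = U1 (lshift n 0) (rshift 1 k).
    by congr (U _ _); exact: val_inj.
  have -> : \sum_(i < n) cons_rV (x0, r) 0 (lift ord0 i) * U (lift ord0 i) (lift ord0 k) =
      \sum_(i < n) r 0 i * drsubmx U1 i k.
    apply: eq_bigr => i _; rewrite cons_rVS/= !mxE; congr (_ * U _ _); exact: val_inj.
  by ring.
rewrite !cons_rV0/= Ut// mulr0 add0r big1 ?addr0// => i _.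
by rewrite Ut ?mulr0.
Qed.

Lemma cons_rV_eta n (a : 'rV[R]_n.+1) : a = cons_rV (uncons_rV a).
Proof.
apply/rowP => j; case: (unliftP ord0 j) => [k ->|->].
  by rewrite cons_rVS mxE; congr (a _ _); exact: val_inj.
by rewrite cons_rV0.
Qed.

(** The first coordinate undergoes a translation, after a reflection if e = -1;
    when it is fixed, the remaining ones undergo a map of the same kind in one
    dimension less, because U is strictly upper triangular. Tonelli's theorem
    and induction on n conclude. *)
Lemma lebesgue_rV_affine n (e : R) (a : 'rV[R]_n) (U : 'M[R]_n) (F : 'rV[R]_n -> \bar R) :
  e = 1 \/ e = -1 -> (forall i j : 'I__, (j <= i)%N -> U i j = 0) ->
  measurable_fun [set: 'rV[R]_n] F -> (forall x, 0 <= F x)%E ->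
  (\int[lebesgue_rV R n]_x F (affine_rV e a U x) = \int[lebesgue_rV R n]_x F x)%E.
Proof.
move=> e1; elim: n a U F => [a U F Ut mF F0|n IH a U F Ut mF F0].
  by apply: eq_integral => x _; congr F; apply/rowP => -[].
rewrite !integral_cons_rV//; last exact: measurableT_comp (measurable_affine_rV e a U).
rewrite (cons_rV_eta a); set a0 := (uncons_rV a).1; set a' := (uncons_rV a).2.
pose G (x0 : measurableTypeR R) := (\int[lebesgue_rV R n]_r F (cons_rV (x0, r)))%E.
have mG : measurable_fun [set: measurableTypeR R] G.
  apply: (measurable_fun_fubini_tonelli_F (m2 := lebesgue_rV R n) (F \o @cons_rV R n)) => [|x].
    exact: measurableT_comp (@measurable_cons_rV R n).
  exact: F0.
have G0 x : (0 <= G x)%E by apply: integral_ge0 => r _; exact: F0.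
transitivity (\int[leb]_x G (e * x + a0)%R)%E.
  apply: eq_integral => x _.
  under eq_integral do rewrite (_ : uncons_rV a = (a0, a'))// affine_rV_cons//.
  rewrite (IH _ _ (fun r => F (cons_rV (e * x + a0, r))))//.
  - by move=> i j ij; rewrite !mxE; apply: Ut.
  - apply: (measurableT_comp mF); apply: (measurableT_comp (@measurable_cons_rV R n)).
    exact: measurable_pair1.
have step : (\int[leb]_x G (x + a0)%R = \int[leb]_x G x)%E by exact: lebesgue_translation.
case: e1 => ->; first by under eq_integral do rewrite mul1r.
rewrite -[RHS]step -(lebesgue_opp (F := fun x => G (x + a0))).
- by apply: eq_integral => x _; rewrite mulN1r.
- by apply: measurableT_comp => //; exact: measurable_funD.
- by move=> x; exact: G0.
Qed.

End affine.

(** * The Heisenberg group law and its action on the measure *)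

Section heis_group.
Variables (R : realType) (N : nat).
Implicit Types (x y z g h a : heis R N) (r t e c : R).

(** The symplectic form that twists the last coordinate of the group law. *)
Definition hform x y : R :=
  2^-1 * \sum_(i < N) (hz x (lshift N i) * hz y (rshift N i) -
                       hz x (rshift N i) * hz y (lshift N i)).

Lemma hmulE x y j : hmul x y 0 j = x 0 j + y 0 j + if j == ord_max then hform x y else 0.
Proof. by rewrite mxE. Qed.

Lemma widen_neq_max (i : 'I_(N + N)) : (widen_ord (leqnSn _) i == ord_max :> 'I_(N + N).+1) = false.
Proof. by apply/negbTE; rewrite -val_eqE/= neq_ltn ltn_ord. Qed.

Lemma hz_hmul x y i : hz (hmul x y) i = hz x i + hz y i.
Proof. by rewrite /hz hmulE widen_neq_max addr0. Qed.
Lemma ht_hmul x y : ht (hmul x y) = ht x + ht y + hform x y.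
Proof. by rewrite /ht hmulE eqxx. Qed.
Lemma hzN x i : hz (- x) i = - hz x i. Proof. by rewrite /hz mxE. Qed.
Lemma htN x : ht (- x) = - ht x. Proof. by rewrite /ht mxE. Qed.

Lemma heisP x y : (forall i, hz x i = hz y i) -> ht x = ht y -> x = y.
Proof.
move=> h1 h2; apply/rowP => j; have [->|jm] := eqVneq j ord_max; first exact: h2.
have jN : (j < N + N)%N.
  by rewrite ltn_neqAle -ltnS ltn_ord andbT; apply: contra_neq jm => jm; exact: val_inj.
by have := h1 (Ordinal jN); rewrite /hz; congr (x _ _ = y _ _); exact: val_inj.
Qed.

Lemma hformC x y : hform y x = - hform x y.
Proof.
rewrite /hform -mulrN -sumrN; congr (_ * _); apply: eq_bigr => i _; ring.
Qed.
Lemma hformDl x y z : hform (hmul x y) z = hform x z + hform y z.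
Proof.
rewrite /hform -mulrDr -big_split/=; congr (_ * _); apply: eq_bigr => i _.
rewrite !hz_hmul; ring.
Qed.
Lemma hformDr x y z : hform z (hmul x y) = hform z x + hform z y.
Proof. by rewrite (hformC (hmul x y) z) hformDl opprD (hformC x z) (hformC y z). Qed.
Lemma hformNl x y : hform (- x) y = - hform x y.
Proof.
rewrite /hform -mulrN -sumrN; congr (_ * _); apply: eq_bigr => i _; rewrite !hzN; ring.
Qed.
Lemma hformNr x y : hform x (- y) = - hform x y.
Proof. by rewrite hformC hformNl hformC opprK. Qed.
Lemma hformxx x : hform x x = 0.
Proof. by have := hformC x x; lra. Qed.
Lemma hform0l x : hform 0 x = 0.
Proof. by rewrite /hform big1 ?mulr0// => i _; rewrite /hz !mxE !mul0r subrr. Qed.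
Lemma hform0r x : hform x 0 = 0. Proof. by rewrite hformC hform0l oppr0. Qed.

Lemma hmulA x y z : hmul x (hmul y z) = hmul (hmul x y) z.
Proof.
apply: heisP => [i|]; first by rewrite !hz_hmul addrA.
by rewrite !ht_hmul hformDl hformDr; ring.
Qed.
Lemma hmul0x x : hmul 0 x = x.
Proof. by apply/rowP => j; rewrite hmulE mxE add0r hform0l if_same addr0. Qed.
Lemma hmulx0 x : hmul x 0 = x.
Proof. by apply/rowP => j; rewrite hmulE mxE addr0 hform0r if_same addr0. Qed.
Lemma hmulxV x : hmul x (- x) = 0.
Proof. by apply/rowP => j; rewrite hmulE !mxE subrr add0r hformNr hformxx oppr0 if_same. Qed.
Lemma hmulNx x : hmul (- x) x = 0. Proof. exact: hmulVx. Qed.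
Lemma hmulKx g x : hmul (- g) (hmul g x) = x.
Proof. by rewrite hmulA hmulNx hmul0x. Qed.
Lemma hmulNKx g x : hmul g (hmul (- g) x) = x.
Proof. by rewrite hmulA hmulxV hmul0x. Qed.
Lemma hmulN x y : - hmul x y = hmul (- y) (- x).
Proof.
apply: heisP => [i|]; first by rewrite hzN !hz_hmul !hzN; ring.
by rewrite htN !ht_hmul !htN hformNl hformNr hformC; ring.
Qed.

Lemma hnormN x : hnorm (- x) = hnorm x.
Proof.
rewrite /hnorm htN sqrrN; congr ((_ ^+ 2 + _) `^ _); apply: eq_bigr => i _.
by rewrite hzN sqrrN.
Qed.

Lemma hnorm_ge0 x : 0 <= hnorm x. Proof. exact: powR_ge0. Qed.

Let S x := (\sum_(i < N + N) hz x i ^+ 2) ^+ 2 + ht x ^+ 2.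
Let S_ge0 x : 0 <= S x.
Proof. by rewrite addr_ge0// sqr_ge0. Qed.

Lemma hnorm4 x : hnorm x ^+ 4 = (\sum_(i < N + N) hz x i ^+ 2) ^+ 2 + ht x ^+ 2.
Proof.
by rewrite -powR_mulrn ?hnorm_ge0// /hnorm -powRrM mulVf ?powRr1// S_ge0.
Qed.

Lemma hz_le_hnorm x i : `|hz x i| <= hnorm x.
Proof.
rewrite -(@ler_pXn2r _ 4) ?nnegrE ?hnorm_ge0// hnorm4.
rewrite -[4%N]/(2 * 2)%N exprM real_normK ?num_real//.
apply: le_trans (_ : (\sum_(i < N + N) hz x i ^+ 2) ^+ 2 <= _); last by rewrite lerDl sqr_ge0.
rewrite ler_sqr ?nnegrE ?sqr_ge0 ?sumr_ge0//; last by move=> *; exact: sqr_ge0.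
by rewrite (bigD1 i)//= lerDl sumr_ge0// => *; exact: sqr_ge0.
Qed.

Lemma ht_le_hnorm x : `|ht x| <= hnorm x ^+ 2.
Proof.
rewrite -ler_sqr ?nnegrE ?sqr_ge0// -exprM real_normK ?num_real// hnorm4.
by rewrite lerDr sqr_ge0.
Qed.

Lemma hnorm_le x r : 0 <= r -> (forall i, `|hz x i| <= r) -> `|ht x| <= r ^+ 2 ->
  hnorm x <= (N + N).+1%:R * r.
Proof.
move=> r0 h1 h2; rewrite -(@ler_pXn2r _ 4) ?nnegrE ?hnorm_ge0 ?mulr_ge0// hnorm4.
have hs : \sum_(i < N + N) hz x i ^+ 2 <= (N + N)%:R * r ^+ 2.
  apply: le_trans (ler_sum _ (_ : forall i, true -> _ <= r ^+ 2)) _.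
    by move=> i _; rewrite -real_normK ?num_real// ler_sqr ?nnegrE.
  by rewrite sumr_const card_ord mulr_natl.
have hs0 : 0 <= \sum_(i < N + N) hz x i ^+ 2 by rewrite sumr_ge0// => *; exact: sqr_ge0.
apply: le_trans (_ : ((N + N)%:R * r ^+ 2) ^+ 2 + (r ^+ 2) ^+ 2 <= _).
  apply: lerD; first by rewrite ler_sqr ?nnegrE// mulr_ge0// sqr_ge0.
  by rewrite -(real_normK (num_real (ht x))) ler_sqr ?nnegrE// sqr_ge0.
rewrite exprMn -exprM -[X in _ + X]mul1r -mulrDl exprMn ler_wpM2r ?exprn_ge0//.
rewrite -natrX -[X in _ + X]/(1%:R) -natrD -natrX ler_nat.
set m := (N + N)%N; rewrite (_ : 4 = 2 * 2)%N// expnM.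
have : (m ^ 2 + 1 <= m.+1 ^ 2)%N by rewrite -[m.+1]addn1 sqrnD exp1n leq_addr.
by move=> /leq_trans; apply; rewrite -[X in (X <= _)%N]expn1 leq_pexp2l// expn_gt0.
Qed.

Lemma hnorm_gt0 x : x != 0 -> 0 < hnorm x.
Proof.
move=> x0; rewrite lt_neqAle hnorm_ge0 andbT; apply: contra x0 => /eqP h.
have hz0 i : hz x i = 0 by apply/eqP; rewrite -normr_le0 h hz_le_hnorm.
have ht0 : ht x = 0 by apply/eqP; rewrite -normr_le0; have := ht_le_hnorm x; rewrite -h expr0n.
by apply/eqP; apply: heisP => [i|]; rewrite ?hz0 ?ht0 /hz /ht mxE.
Qed.

Lemma hform_le x y r t : 0 <= r -> (forall i, `|hz x i| <= r) ->
  0 <= t -> (forall i, `|hz y i| <= t) -> `|hform x y| <= N%:R * (r * t).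
Proof.
move=> r0 xr t0 yt; rewrite /hform normrM ger0_norm ?invr_ge0// ler_pdivrMl//.
apply: le_trans (ler_norm_sum _ _ _) _.
apply: le_trans (ler_sum _ (_ : forall i, true -> _ <= 2 * (r * t))) _.
  move=> i _; apply: le_trans (ler_normB _ _) _; rewrite !normrM.
  by rewrite [leRHS]mulr_natl mulr2n lerD// ler_pM.
by rewrite sumr_const card_ord [N%:R * _]mulr_natl mulrnAr.
Qed.

(** The common shape of the left translation by g and of the map sending y to x
    y^-1. *)
Definition hshear (e : R) (a : heis R N) (c : R) (g x : heis R N) : heis R N :=
  \row_j (e * x 0 j + a 0 j + if j == ord_max then c * hform g x else 0).

(** The term hform g x enters the last coordinate only and does not depend on
    it, so the linear part is e times the identity plus a strictly upper
    triangular matrix. *)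
Lemma integral_hshear e a c g (F : heis R N -> \bar R) :
  e = 1 \/ e = -1 -> measurable_fun [set: heis R N] F -> (forall x, 0 <= F x)%E ->
  (\int[hmu R N]_x F (hshear e a c g x) = \int[hmu R N]_x F x)%E.
Proof.
move=> e1 mF F0.
pose U : 'M[R]_((N + N).+1) := \matrix_(i, j) if j == ord_max then
  c * (2^-1 * \sum_(k < N) (hz g (lshift N k) * (i == widen_ord (leqnSn _) (rshift N k))%:R -
                       hz g (rshift N k) * (i == widen_ord (leqnSn _) (lshift N k))%:R)) else 0.
have UE x : hshear e a c g x = affine_rV e a U x.
  apply/rowP => j; rewrite affine_rVE mxE; congr (_ + _).
  have [->|jm] := eqVneq j ord_max; last first.
    by rewrite big1// => i _; rewrite mxE (negbTE jm) mulr0.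
  have xE (k : 'I_(N + N)) : hz x k = \sum_i x 0 i * (i == widen_ord (leqnSn _) k)%:R.
    rewrite (bigD1 (widen_ord (leqnSn _) k))//= eqxx mulr1 big1 ?addr0// => i /negbTE ->.
    by rewrite mulr0.
  under [RHS]eq_bigr do rewrite mxE eqxx.
  rewrite /hform !mulr_sumr.
  under [LHS]eq_bigr => k _ do rewrite !xE !mulr_sumr -sumrB !mulr_sumr.
  rewrite exchange_big/=; apply: eq_bigr => i _.
  by rewrite !mulr_sumr; apply: eq_bigr => k _; ring.
under eq_integral do rewrite UE.
apply: lebesgue_rV_affine => // i j ij; rewrite mxE; case: eqP => // jm.
have im : i = ord_max.
  by apply/val_inj/eqP; rewrite eqn_leq -ltnS ltn_ord/= -[X in (X <= _)%N]/(val (@ord_max (N + N))) -jm.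
rewrite big1 ?mulr0// => k _.
by rewrite im ![ord_max == _]eq_sym !widen_neq_max !mulr0 subrr.
Qed.

Section changes.
Variable F : heis R N -> \bar R.
Hypotheses (mF : measurable_fun [set: heis R N] F) (F0 : (forall x, 0 <= F x)%E).

Lemma integral_hmull g : (\int[hmu R N]_x F (hmul g x) = \int[hmu R N]_x F x)%E.
Proof.
rewrite -[RHS](integral_hshear g 1 g (or_introl (erefl 1)) mF F0).
apply: eq_integral => x _; congr F; apply/rowP => j; rewrite hmulE mxE mul1r.
by rewrite mul1r [x 0 j + _]addrC.
Qed.

Lemma integral_hmulNr x : (\int[hmu R N]_y F (hmul x (- y)) = \int[hmu R N]_x F x)%E.
Proof.
rewrite -[RHS](integral_hshear x (-1) x (or_intror (erefl (-1))) mF F0).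
apply: eq_integral => y _; congr F; apply/rowP => j; rewrite hmulE !mxE mulN1r.
by rewrite mulN1r [- y 0 j + _]addrC hformNr.
Qed.

End changes.

End heis_group.

(** * The kernel and boxes adapted to the dilations *)

Section heis_kernel.
Variables (R : realType) (N : nat) (s p : R).
Implicit Types (x y z g h a : heis R N) (r e c : R).
Local Notation Q := (hdim N).
Local Notation q := (Q%:R + s * p).

Lemma measurable_fun_hform d (T : measurableType d) (f g : T -> heis R N) :
  measurable_fun [set: T] f -> measurable_fun [set: T] g ->
  measurable_fun [set: T] (fun t => hform (f t) (g t)).
Proof.
move=> /measurable_fun_rVP mf /measurable_fun_rVP mg.
apply: measurable_funM => //; apply: measurable_sum => i.
by apply: measurable_funB; apply: measurable_funM; [exact: mf|exact: mg|exact: mf|exact: mg].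
Qed.

Lemma measurable_fun_hmul d (T : measurableType d) (f g : T -> heis R N) :
  measurable_fun [set: T] f -> measurable_fun [set: T] g ->
  measurable_fun [set: T] (fun t => hmul (f t) (g t)).
Proof.
move=> mf mg; apply/measurable_fun_rVP => i.
rewrite (_ : _ \o _ = fun t => f t 0 i + g t 0 i + if i == ord_max then hform (f t) (g t) else 0); last first.
  by apply/funext => t; rewrite /coord_rV/= hmulE.
apply: measurable_funD; last by case: (i == ord_max); [exact: measurable_fun_hform|exact: measurable_cst].
by apply: measurable_funD; [move/measurable_fun_rVP : mf|move/measurable_fun_rVP : mg]; exact.
Qed.

Lemma measurable_fun_hopp d (T : measurableType d) (f : T -> heis R N) :
  measurable_fun [set: T] f -> measurable_fun [set: T] (fun t => - f t).
Proof.
move=> mf; apply/measurable_fun_rVP => i.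
rewrite (_ : _ \o _ = fun t => - f t 0 i); last first.
  by apply/funext => t; rewrite /coord_rV/= mxE.
by apply: measurableT_comp => //; move/measurable_fun_rVP : mf; exact.
Qed.

Lemma measurable_hnorm : measurable_fun [set: heis R N] (@hnorm R N).
Proof.
apply: (measurableT_comp (measurable_powR 4^-1)).
apply: measurable_funD; apply: measurable_funX; last exact: measurable_coord_rV.
by apply: measurable_sum => i; apply: measurable_funX; exact: measurable_coord_rV.
Qed.

Definition kap z : R := (hnorm z `^ q)^-1.

Lemma kap_ge0 z : 0 <= kap z. Proof. by rewrite invr_ge0 powR_ge0. Qed.
Lemma kapN z : kap (- z) = kap z. Proof. by rewrite /kap hnormN. Qed.
Lemma measurable_kap : measurable_fun [set: heis R N] kap.
Proof.
rewrite (_ : kap = fun z => hnorm z `^ (- q)); last by apply/funext => z; rewrite powRN.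
exact: measurableT_comp (measurable_powR _) measurable_hnorm.
Qed.

Lemma hkernelE x y : hkernel s p (x, y) = kap (hmul (- y) x).
Proof. by []. Qed.
Lemma hkernel_ge0 (z : heis R N * heis R N) : 0 <= hkernel s p z.
Proof. by rewrite invr_ge0 powR_ge0. Qed.
Lemma hkernel_hmul x z : hkernel s p (x, hmul x z) = kap z.
Proof. by rewrite hkernelE hmulN -hmulA hmulNx hmulx0 kapN. Qed.
Lemma hkernelC x y : hkernel s p (x, y) = hkernel s p (y, x).
Proof. by rewrite !hkernelE -kapN hmulN opprK. Qed.
Lemma hkernel_hmull g x y : hkernel s p (hmul g x, hmul g y) = hkernel s p (x, y).
Proof. by rewrite !hkernelE hmulN -hmulA hmulKx. Qed.
Lemma measurable_hkernel : measurable_fun [set: heis R N * heis R N] (@hkernel R N s p).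
Proof.
rewrite (_ : @hkernel R N s p = kap \o (fun z : heis R N * heis R N => hmul (- z.2) z.1)); last by apply/funext => -[x y].
apply: (measurableT_comp measurable_kap).
by apply: measurable_fun_hmul; [apply: measurable_fun_hopp|].
Qed.

(** Sides r in the horizontal directions and r^2 in the last one follow the
    dilations of the group, which gives the measure r^Q. The half-open sides
    keep the origin, where the kernel takes the value 0, out of the box. *)
Definition hbox r : set (heis R N) :=
  [set z | forall i, z 0 i \in `]0, (if i == ord_max then r ^+ 2 else r)]].
Definition hcube r : set (heis R N) :=
  [set z | forall i, z 0 i \in let e := (if i == ord_max then r ^+ 2 else r) in `[- e, e]].

Lemma measurable_hbox r : measurable (hbox r).
Proof.
apply: (measurable_coordwise (A := fun i : 'I_(N + N).+1 =>
 [set` `]0, (if i == ord_max then r ^+ 2 else r)]])) => i; exact: measurable_itv.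
Qed.
Lemma measurable_hcube r : measurable (hcube r).
Proof.
apply: (measurable_coordwise (A := fun i : 'I_(N + N).+1 =>
 let e := (if i == ord_max then r ^+ 2 else r) in [set` `[- e, e]])) => i; exact: measurable_itv.
Qed.

Lemma hmu_hbox r : 0 < r -> hmu R N (hbox r) = (r ^+ Q)%:E.
Proof.
move=> r0; rewrite /hmu (lebesgue_rV_box (A := fun i : 'I_(N + N).+1 =>
 [set` `]0, (if i == ord_max then r ^+ 2 else r)]])); last by move=> i; exact: measurable_itv.
rewrite (eq_bigr (fun i : 'I_(N + N).+1 => (if i == ord_max then r ^+ 2 else r)%:E)); last first.
  move=> i _; set e := (if _ then _ else _).
  have e0 : 0 < e by rewrite /e; case: ifP; rewrite ?exprn_gt0.
  by rewrite lebesgue_measure_itv/= lte_fin e0 oppr0 adde0.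
rewrite big_ord_recr/= eqxx.
under eq_bigr => i _ do rewrite widen_neq_max.
rewrite prodEFin prodr_const card_ord -EFinM -exprD.
by rewrite /hdim addn2.
Qed.

Lemma hmu_hcube r : 0 < r -> hmu R N (hcube r) = (2 ^+ (N + N).+1 * r ^+ Q)%:E.
Proof.
move=> r0; rewrite /hmu (lebesgue_rV_box (A := fun i : 'I_(N + N).+1 =>
 let e := (if i == ord_max then r ^+ 2 else r) in [set` `[- e, e]])); last by move=> i; exact: measurable_itv.
have E (e : R) : 0 < e -> @lebesgue_measure R [set` `[- e, e]] = (2 * e)%:E.
  move=> e0; rewrite lebesgue_measure_itv/= lte_fin ifT; last by lra.
  by rewrite -EFinD; congr _%:E; ring.
rewrite (eq_bigr (fun i : 'I_(N + N).+1 => (2 * (if i == ord_max then r ^+ 2 else r))%:E)); last first.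
  by move=> i _; rewrite E//; case: ifP; rewrite ?exprn_gt0.
rewrite big_ord_recr/= eqxx.
under eq_bigr => i _ do rewrite widen_neq_max.
rewrite prodEFin prodr_const card_ord -EFinM; congr _%:E.
by rewrite exprMn mulrACA -exprSr -exprD /hdim addn2.
Qed.

Lemma hbox_hnorm r z : 0 < r -> hbox r z -> 0 < hnorm z <= (N + N).+1%:R * r.
Proof.
move=> r0 bz; apply/andP; split.
  apply: hnorm_gt0; apply/eqP => z0; have := bz ord_max.
  by rewrite z0 mxE in_itv/= ltxx.
apply: hnorm_le; [exact: ltW| |].
  move=> i; have := bz (widen_ord (leqnSn _) i); rewrite widen_neq_max in_itv/= /hz => /andP[z0 zr].
  by rewrite ger0_norm// ltW.
by have := bz ord_max; rewrite eqxx in_itv/= /ht => /andP[z0 zr]; rewrite ger0_norm// ltW.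
Qed.

Lemma hnorm_hcube r z : hnorm z <= r -> hcube r z.
Proof.
move=> zr i /=; rewrite in_itv/= -ler_norml; case: eqP => [->|/eqP im].
  apply: le_trans (ht_le_hnorm z) _.
  by rewrite ler_sqr ?nnegrE ?hnorm_ge0// (le_trans _ zr)// hnorm_ge0.
have iN : (i < N + N)%N.
  by rewrite ltn_neqAle -ltnS ltn_ord andbT; apply: contra_neq im => im; exact: val_inj.
apply: le_trans zr; have := hz_le_hnorm z (Ordinal iN); rewrite /hz.
by congr (`|z _ _| <= _); exact: val_inj.
Qed.

Lemma hbox_kap r z : 0 < q -> 0 < r -> hbox r z -> (((N + N).+1%:R * r) `^ q)^-1 <= kap z.
Proof.
move=> q0 r0 /(hbox_hnorm r0)/andP[z0 zr].
have h1 : 0 < hnorm z `^ q by exact: powR_gt0.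
have h2 : 0 < ((N + N).+1%:R * r) `^ q by rewrite powR_gt0// mulr_gt0.
rewrite /kap lef_pV2 ?posrE//.
by rewrite ge0_ler_powR ?nnegrE ?(ltW q0) ?(ltW z0)// mulr_ge0// ltW.
Qed.

End heis_kernel.

(** * Integrals of nonnegative functions *)

Section rint.
Context d (T : measurableType d) (R : realType) (mu : {measure set T -> \bar R}).
Implicit Types (f g h : T -> R) (c : R).
Local Open Scope ereal_scope.

Lemma rint_ge0 f : (forall x, 0 <= f x)%R -> 0 <= \int[mu]_x (f x)%:E.
Proof. by move=> f0; apply: integral_ge0 => x _; rewrite lee_fin. Qed.

Lemma rint_le f g : measurable_fun [set: T] f -> measurable_fun [set: T] g ->
  (forall x, 0 <= f x)%R -> (forall x, f x <= g x)%R ->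
  \int[mu]_x (f x)%:E <= \int[mu]_x (g x)%:E.
Proof.
move=> mf mg f0 fg; apply: ge0_le_integral => //.
- by move=> x _; rewrite lee_fin.
- exact/measurable_EFinP.
- exact/measurable_EFinP.
- by move=> x _; rewrite lee_fin.
Qed.

Lemma rint_ae_eq f g : measurable_fun [set: T] f -> measurable_fun [set: T] g ->
  {ae mu, forall x, f x = g x} ->
  \int[mu]_x (f x)%:E = \int[mu]_x (g x)%:E.
Proof.
move=> mf mg fg; apply: ae_eq_integral => //; [exact/measurable_EFinP..|].
by apply: filterS fg => x fgx _; rewrite fgx.
Qed.

Lemma rint_le_ae f g : measurable_fun [set: T] f -> measurable_fun [set: T] g ->
  (forall x, 0 <= f x)%R -> (forall x, 0 <= g x)%R -> {ae mu, forall x, f x <= g x}%R ->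
  \int[mu]_x (f x)%:E <= \int[mu]_x (g x)%:E.
Proof.
move=> mf mg f0 g0 fg; apply: ae_ge0_le_integral => //.
- by move=> x _; rewrite lee_fin.
- exact/measurable_EFinP.
- by move=> x _; rewrite lee_fin.
- exact/measurable_EFinP.
- by apply: filterS fg => x fgx _; rewrite lee_fin.
Qed.

Lemma rintD f g : measurable_fun [set: T] f -> measurable_fun [set: T] g ->
  (forall x, 0 <= f x)%R -> (forall x, 0 <= g x)%R ->
  \int[mu]_x (f x + g x)%:E = \int[mu]_x (f x)%:E + \int[mu]_x (g x)%:E.
Proof.
move=> mf mg f0 g0; under eq_integral do rewrite EFinD.
apply: ge0_integralD => //; try exact/measurable_EFinP.
- by move=> x _; rewrite lee_fin.
- by move=> x _; rewrite lee_fin.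
Qed.

Lemma rintZ c f : measurable_fun [set: T] f -> (0 <= c)%R ->
  (forall x, 0 <= f x)%R ->
  \int[mu]_x (c * f x)%:E = c%:E * \int[mu]_x (f x)%:E.
Proof.
move=> mf c0 f0; under eq_integral do rewrite EFinM.
apply: ge0_integralZl_EFin => //; try exact/measurable_EFinP.
by move=> x _; rewrite lee_fin.
Qed.

Lemma rint_indic A : measurable A -> \int[mu]_x (\1_A x : R)%:E = mu A.
Proof. by move=> mA; rewrite integral_indic// setIT. Qed.

Lemma rint_eq0 f : measurable_fun [set: T] f -> (forall x, 0 <= f x)%R ->
  \int[mu]_x (f x)%:E <= 0 -> {ae mu, forall x, f x = 0}%R.
Proof.
move=> mf f0 If.
have mEf : measurable_fun [set: T] (EFin \o f) by exact/measurable_EFinP.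
have := (ae_eq_integral_abs mu measurableT mEf).1; case.
  apply/eqP; rewrite eq_le; apply/andP; split.
    by rewrite (le_trans _ If)//; under eq_integral do rewrite gee0_abs ?lee_fin//.
  by apply: integral_ge0 => x _; rewrite abse_ge0.
by move=> A [mA A0 hA]; exists A; split => // x /= fx; apply: hA => /= hx; apply: fx; have := hx I; case.
Qed.

(** Lower semicontinuity of energies and of weighted integrals rests on this
    form of Fatou's lemma. *)
Lemma rint_fatou (F : nat -> T -> R) f (c : \bar R) :
  (forall n, measurable_fun [set: T] (F n)) -> measurable_fun [set: T] f ->
  (forall n x, 0 <= F n x)%R -> (forall x, 0 <= f x)%R ->
  {ae mu, forall x, F ^~ x @ \oo --> f x} ->
  (forall n, \int[mu]_x (F n x)%:E <= c) -> \int[mu]_x (f x)%:E <= c.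
Proof.
move=> mF mf F0 f0 Ff Fc.
apply: (@le_trans _ _ (\int[mu]_x limn_einf (fun n => (F n x)%:E))).
  apply: ae_ge0_le_integral => //.
  - by move=> x _; rewrite lee_fin.
  - exact/measurable_EFinP.
  - move=> x _; rewrite limn_einf_lim; apply: lime_ge; first exact: is_cvg_einfs.
    apply: nearW => n; apply: le_ereal_inf_tmp => _ [k _ <-].
    by rewrite lee_fin.
  - rewrite (_ : (fun x => _) = (fun x => - limn_esup (fun n => - (F n x)%:E))).
      apply: measurableT_comp => //; apply: measurable_fun_limn_esup => n.
      by apply: measurableT_comp => //; exact/measurable_EFinP.
    apply/funext => x; rewrite -[in RHS]limn_einfN; congr limn_einf.
    by apply/funext => n; rewrite /comp oppeK.
  - apply: filterS Ff => x Fx _.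
    have : EFin \o F ^~ x @ \oo --> (f x)%:E by apply: cvg_EFin => //; exact: nearW.
    by move=> /cvg_limn_einf_sup[-> _].
apply: le_trans (fatou mu measurableT _ _) _.
- by move=> n; exact/measurable_EFinP.
- by move=> n x _; rewrite lee_fin.
rewrite limn_einf_lim; apply: lime_le; first exact: is_cvg_einfs.
apply: nearW => n; apply: le_trans (Fc n); apply: ereal_inf_lbound.
by exists n => /=.
Qed.

(** The sum of the F n has a finite integral, hence is finite almost everywhere.
    Thus geometric decay of integrals becomes a pointwise rate along the whole
    sequence. *)
Lemma rint_ae_bounded (F : nat -> T -> R) :
  (forall n, measurable_fun [set: T] (F n)) ->
  (forall n x, 0 <= F n x)%R ->
  (forall n, \int[mu]_x (F n x)%:E <= (2^-1 ^+ n)%:E) ->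
  {ae mu, forall x, exists C : R, forall n, F n x <= C}%R.
Proof.
move=> mF F0 IF.
have mEF n : measurable_fun [set: T] (EFin \o F n) by exact/measurable_EFinP.
have EF0 n x : [set: T] x -> 0 <= (EFin \o F n) x by rewrite lee_fin.
have Is : \int[mu]_x (\sum_(n <oo) (F n x)%:E) <= 2%:E.
  rewrite integral_nneseries//; apply: lime_le.
    by apply: is_cvg_nneseries => n _ _; exact: rint_ge0.
  apply: nearW => n; apply: le_trans (lee_sum _ (fun i _ => IF i)) _.
  rewrite sumEFin lee_fin.
  have := @geometric_le_lim R n 1 2^-1 ler01 _ _.
  rewrite /series/=; under eq_bigr do rewrite mul1r.
  have h2 : (0 < 2^-1 :> R)%R by rewrite invr_gt0.
  move=> h; apply: le_trans (h h2 _) _; first by rewrite gtr0_norm//; lra.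
  by rewrite mul1r -[X in (_ <= X)%R]invrK lef_pV2 ?posrE//; lra.
have ms : measurable_fun [set: T] (fun x => \sum_(n <oo) (F n x)%:E).
  by apply: (ge0_emeasurable_sum (h := fun n x => (F n x)%:E) (P := xpredT)) => [n x _ _|n _]; [exact: EF0|exact: mEF].
have s0 x : 0 <= \sum_(n <oo) (F n x)%:E by apply: nneseries_ge0 => n _ _; exact: EF0.
have : mu.-integrable [set: T] (fun x => \sum_(n <oo) (F n x)%:E).
  apply/integrableP; split => //; under eq_integral do rewrite gee0_abs//.
  by rewrite (le_lt_trans Is)// ltry.
move=> /(integrable_ae measurableT); apply: filterS => x /(_ I) fx.
exists (fine (\sum_(n <oo) (F n x)%:E)) => n.
rewrite -lee_fin fineK//; apply: le_trans (nneseries_lim_ge n.+1 _); last by move=> k _ _; exact: EF0.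
by rewrite big_nat_recr//= leeDr// sume_ge0// => k _; exact: EF0.
Qed.

(** The contributions of the shells E k add up to a geometric series. *)
Lemma dyadic_integral (F : T -> R) (c : nat -> R) (E : nat -> set T) (C a : R) :
  measurable_fun [set: T] F -> (forall x, 0 <= F x)%R -> (forall k, 0 <= c k)%R ->
  (forall k, measurable (E k)) ->
  (forall x, exists k, F x <= c k * \1_(E k) x)%R -> (0 <= C)%R -> (0 < a < 1)%R ->
  (forall k, (c k)%:E * mu (E k) = (C * a ^+ k)%:E) ->
  \int[mu]_x (F x)%:E <= (C / (1 - a))%:E.
Proof.
move=> mF F0 c0 mE Fc C0 /andP[a0 a1] cE.
have t0 k x : (0 <= c k * \1_(E k) x)%R by rewrite mulr_ge0.
have mt k : measurable_fun [set: T] (fun x => (c k * \1_(E k) x)%:E).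
  by apply/measurable_EFinP; apply: measurable_funM => //; exact: measurable_indic.
apply: (@le_trans _ _ (\int[mu]_x (\sum_(k <oo) (c k * \1_(E k) x)%:E))).
  apply: ge0_le_integral => //.
  - by move=> x _; rewrite lee_fin.
  - exact/measurable_EFinP.
  - by apply: (ge0_emeasurable_sum (h := fun k x => (c k * \1_(E k) x)%:E) (P := xpredT)) => [k x _ _|k _]; [rewrite lee_fin|exact: mt].
  - move=> x _; have [k kx] := Fc x.
    apply: (@le_trans _ _ (c k * \1_(E k) x)%:E); first by rewrite lee_fin.
    apply: le_trans (nneseries_lim_ge k.+1 _); last by move=> i _ _; rewrite lee_fin.
    by rewrite big_nat_recr//= leeDr// sume_ge0// => i _; rewrite lee_fin.
rewrite integral_nneseries//; last by move=> n x _; rewrite lee_fin.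
apply: lime_le.
  by apply: is_cvg_nneseries => n _ _; exact: rint_ge0.
apply: nearW => n; rewrite (eq_bigr (fun k => (C * a ^+ k)%:E)); last first.
  by move=> k _; rewrite rintZ// ?rint_indic//; exact: measurable_indic.
rewrite sumEFin lee_fin; apply: geometric_le_lim => //; by rewrite ger0_norm// ltW.
Qed.

End rint.

(** * The moment of the kernel *)

Section moment.
Variables (R : realType) (N : nat) (s p : R).
Hypotheses (s_gt0 : 0 < s) (s_lt1 : s < 1) (p_gt1 : 1 < p).
Local Notation Q := (hdim N).
Local Notation q := (Q%:R + s * p).
Local Notation mu := (hmu R N).

Lemma hexp_gt0 : 0 < q.
Proof. by rewrite ltr_pwDl// mulr_ge0 ?ltW//; have := p_gt1; lra. Qed.

Let sp0 : 0 < s * p. Proof. by rewrite mulr_gt0//; have := p_gt1; lra. Qed.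
Let p0 : 0 < p. Proof. by have := p_gt1; lra. Qed.

(** min (1, |z|^p) is the size of |eta x - eta (x z)|^p for a bounded Lipschitz
    function eta. *)
Definition kmoment (z : heis R N) : R := Num.min 1 (hnorm z `^ p) * kap s p z.

Lemma kmoment_ge0 z : 0 <= kmoment z.
Proof. by rewrite mulr_ge0 ?kap_ge0// le_min ler01 powR_ge0. Qed.

Lemma measurable_kmoment : measurable_fun [set: heis R N] kmoment.
Proof.
apply: measurable_funM; last exact: measurable_kap.
apply: measurable_minr => //.
exact: (measurableT_comp (measurable_powR _) (@measurable_hnorm R N)).
Qed.

Lemma powR_expn (x r : R) k : 0 <= x -> (x ^+ k) `^ r = (x `^ r) ^+ k.
Proof.
by move=> x0; rewrite -powR_mulrn// -powRrM mulrC powRrM powR_mulrn// powR_ge0.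
Qed.

Lemma powR_lt1 (x r : R) : 0 < x < 1 -> 0 < r -> 0 < x `^ r < 1.
Proof.
move=> /andP[x0 x1] r0; rewrite powR_gt0//=.
have -> : 1 = 1 `^ r :> R by rewrite powR1.
by rewrite gt0_ltr_powR// ?nnegrE ?ltW.
Qed.

Lemma half_pow_lt (e : R) : 0 < e -> exists k, 2^-1 ^+ k < e.
Proof.
move=> e0; have /cvgrPdist_lt : geometric 1 (2^-1 : R) @ \oo --> 0.
  by apply: cvg_geometric; rewrite gtr0_norm ?invr_gt0// invf_lt1// ltr1n.
move=> /(_ _ e0)[k _ /(_ k (leqnn _))]; rewrite sub0r normrN /= mul1r ger0_norm ?exprn_ge0 ?invr_ge0//.
by exists k.
Qed.

Let near0 (z : heis R N) : R := if hnorm z <= 1 then kmoment z else 0.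
Let far (z : heis R N) : R := if hnorm z <= 1 then 0 else kmoment z.

Let mbool : measurable_fun [set: heis R N] (fun z : heis R N => hnorm z <= 1).
Proof. by apply: measurable_fun_ler => //; exact: measurable_hnorm. Qed.

(** The shell |z| ~ 2^-k inside the unit ball contributes 2^(-k (p - s p)), the
    shell |z| ~ 2^k outside it 2^(-k s p); both series converge because 0 < s <
    1. *)
Lemma kmoment_fin : (\int[mu]_z (kmoment z)%:E < +oo)%E.
Proof.
have mn : measurable_fun [set: heis R N] near0.
  by apply: measurable_fun_ifT => //; exact: measurable_kmoment.
have mf : measurable_fun [set: heis R N] far.
  by apply: measurable_fun_ifT => //; exact: measurable_kmoment.
have n0 z : 0 <= near0 z by rewrite /near0; case: ifP => // _; exact: kmoment_ge0.
have f0 z : 0 <= far z by rewrite /far; case: ifP => // _; exact: kmoment_ge0.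
rewrite (_ : (\int[mu]_z (kmoment z)%:E = \int[mu]_z (near0 z + far z)%:E)%E); last first.
  by apply: eq_integral => z _; rewrite /near0 /far; case: ifP => _; rewrite ?addr0 ?add0r.
rewrite rintD//.
have q0 := hexp_gt0.
have h0 : 0 < 2^-1 :> R by rewrite invr_gt0.
have h1 : 2^-1 < 1 :> R by rewrite invf_lt1// ltr1n.
apply: lte_add_pinfty.
  pose r k : R := 2^-1 ^+ k; have r0 k : 0 < r k by rewrite exprn_gt0.
  suff : (\int[mu]_z (near0 z)%:E <= (2 ^+ (N + N).+1 * 2 `^ q / (1 - 2^-1 `^ (p - s * p)))%:E)%E.
    by move=> /le_lt_trans; apply; exact: ltry.
  apply: (dyadic_integral (c := fun k => r k `^ p * (r k / 2) `^ (- q))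
      (E := fun k => @hcube R N (r k))).
  - exact: mn.
  - exact: n0.
  - by move=> k; rewrite mulr_ge0// powR_ge0.
  - by move=> k; exact: measurable_hcube.
  - move=> z; rewrite /near0; case: ifP => z1; last by exists 0%N; rewrite mulr_ge0// mulr_ge0// powR_ge0.
    have [->|zn0] := eqVneq z 0.
      exists 0%N; rewrite /kmoment /kap (_ : hnorm 0 = 0).
        by rewrite (powR0 (x := q)) ?gt_eqF// invr0 mulr0 mulr_ge0// mulr_ge0// powR_ge0.
      by apply/eqP; rewrite eq_le hnorm_ge0 andbT (le_trans (hnorm_le (r := 0) _ _ _))// ?mulr0// => *; rewrite /hz /ht mxE ?normr0 ?expr0n.
    have z0 := hnorm_gt0 zn0.
    have [k0 hk0] := half_pow_lt z0.
    have ex : exists k, r k.+1 < hnorm z.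
      by exists k0; rewrite /r exprS (le_lt_trans _ hk0)// ler_piMl ?exprn_ge0 ?(ltW h0) ?(ltW h1).
    case: (ex_minnP ex) => k hk kmin.
    have zk : hnorm z <= r k.
      case: k hk kmin => [|k] hk kmin; first by rewrite /r expr0.
      by rewrite leNgt; apply/negP => /kmin; rewrite ltnn.
    exists k; rewrite indicE mem_set ?mulr1; last exact: hnorm_hcube.
    rewrite /kmoment; apply: ler_pM; rewrite ?le_min ?ler01 ?powR_ge0 ?kap_ge0//.
      by rewrite ge_min ge0_ler_powR ?nnegrE ?(ltW p0) ?hnorm_ge0 ?(ltW (r0 k)) ?orbT.
    have rk : 0 < r k / 2 by rewrite divr_gt0.
    have h2 : 0 < (r k / 2) `^ q by exact: powR_gt0.
    have h3 : 0 < hnorm z `^ q by exact: powR_gt0.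
    rewrite powRN /kap lef_pV2 ?posrE//.
    rewrite ge0_ler_powR ?nnegrE ?(ltW q0) ?(ltW z0) ?(ltW rk)//.
    by rewrite ltW// mulrC; move: hk; rewrite /r exprS.
  - by rewrite mulr_ge0// powR_ge0.
  - by apply: powR_lt1; rewrite ?h0 ?h1//; have := s_lt1; have := p0; nra.
  - move=> k; rewrite [X in (_ * X)%E](hmu_hcube N (r0 k)) -EFinM; congr _%:E.
    have e1 : (r k / 2) `^ (- q) = 2 `^ q * r k `^ (- q).
      rewrite powRM ?(ltW (r0 k)) ?(ltW h0)// mulrC; congr (_ * _).
      by rewrite -powR_inv1// -powRrM mulN1r opprK.
    rewrite e1 -(powR_mulrn Q (ltW (r0 k))).
    rewrite -powR_expn ?(ltW h0)// -/(r k).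
    rewrite (_ : p - s * p = p + (- q + Q%:R)); last by ring.
    rewrite (@powRD _ (r k) p) ?(gt_eqF (r0 k)) ?implybT//.
    rewrite (@powRD _ (r k) (- q)) ?(gt_eqF (r0 k)) ?implybT//; ring.
pose r k : R := 2 ^+ k; have r0 k : 0 < r k by rewrite exprn_gt0.
suff : (\int[mu]_z (far z)%:E <= (2 ^+ (N + N).+1 * 2 ^+ Q / (1 - 2 `^ (- (s * p))))%:E)%E.
  by move=> /le_lt_trans; apply; exact: ltry.
apply: (dyadic_integral (c := fun k => r k `^ (- q)) (E := fun k => @hcube R N (r k.+1))).
- exact: mf.
- exact: f0.
- by move=> k; rewrite powR_ge0.
- by move=> k; exact: measurable_hcube.
- move=> z; rewrite /far; case: ifP => z1; first by exists 0%N; rewrite mulr_ge0// powR_ge0.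
  have {}z1 : 1 < hnorm z by rewrite ltNge z1.
  have ex : exists k, hnorm z <= r k.+1.
    have zi : 0 < (hnorm z)^-1 by rewrite invr_gt0 (lt_trans _ z1).
    have [k hk] := half_pow_lt zi.
    exists k; rewrite /r exprS (@le_trans _ _ (2 ^+ k))//; last by rewrite ler_peMl ?exprn_ge0// ler1n.
    by rewrite ltW// -ltf_pV2 ?posrE ?exprn_gt0 ?(lt_trans _ z1)// -exprVn.
  case: (ex_minnP ex) => k hk kmin.
  have zk : r k < hnorm z.
    case: k hk kmin => [|k] hk kmin; first by rewrite /r expr0.
    by rewrite ltNge; apply/negP => /kmin; rewrite ltnn.
  exists k; rewrite indicE mem_set ?mulr1; last exact: hnorm_hcube.
  rewrite /kmoment -[leRHS]mul1r; apply: ler_pM; rewrite ?le_min ?ler01 ?powR_ge0 ?kap_ge0//.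
  have h2 : 0 < r k `^ q by exact: powR_gt0.
  have h3 : 0 < hnorm z `^ q by rewrite powR_gt0// (lt_trans _ zk).
  rewrite powRN /kap lef_pV2 ?posrE//.
  by rewrite ge0_ler_powR ?nnegrE ?(ltW q0) ?hnorm_ge0 ?(ltW (r0 k)) ?(ltW zk).
- by rewrite mulr_ge0.
- by rewrite powRN -powR_inv1 ?powR_ge0// -powRrM mulrC powRrM powR_inv1//; apply: powR_lt1; rewrite ?h0 ?h1.
- move=> k; rewrite [X in (_ * X)%E](hmu_hcube N (r0 k.+1)) -EFinM; congr _%:E.
  have -> : r k.+1 = 2 * r k by rewrite /r exprS.
  rewrite exprMn -(powR_mulrn Q (ltW (r0 k))).
  rewrite -powR_expn// -/(r k).
  rewrite (_ : - (s * p) = - q + Q%:R); last by ring.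
  rewrite (@powRD _ (r k) (- q)) ?(gt_eqF (r0 k)) ?implybT//; ring.
Qed.

End moment.

(** * The fractional energy *)

Lemma measurable_pw (R : realType) (p : R) : measurable_fun [set: R] (pw p).
Proof. by apply: (measurableT_comp (measurable_powR _)); exact: normr_measurable. Qed.

Section ae_prod.
Context d1 d2 (T1 : measurableType d1) (T2 : measurableType d2) (R : realType).
Variables (m1 : {sigma_finite_measure set T1 -> \bar R})
          (m2 : {sigma_finite_measure set T2 -> \bar R}).

Lemma ae_prod1 (P : T1 -> Prop) : {ae m1, forall x, P x} ->
  {ae (m1 \x m2)%E, forall z, P z.1}.
Proof.
move=> [A [mA A0 PA]]; exists (A `*` setT); split; first exact: measurableX.
  by rewrite product_measure1E// [X in (X * _)%E]A0 mul0e.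
by move=> z /= nP; split => //; exact: PA.
Qed.

Lemma ae_prod2 (P : T2 -> Prop) : {ae m2, forall x, P x} ->
  {ae (m1 \x m2)%E, forall z, P z.2}.
Proof.
move=> [A [mA A0 PA]]; exists (setT `*` A); split; first exact: measurableX.
  by rewrite product_measure1E// [X in (_ * X)%E]A0 mule0.
by move=> z /= nP; split => //; exact: PA.
Qed.
End ae_prod.

Section gagliardo.
Variables (R : realType) (N : nat) (s p : R).
Hypotheses (s_gt0 : 0 < s) (s_lt1 : s < 1) (p_gt1 : 1 < p).
Local Notation Q := (hdim N).
Local Notation q := (Q%:R + s * p).
Local Notation mu := (hmu R N).
Local Notation H := (heis R N).
Implicit Types (u v w : H -> R) (F : H * H -> R).

Definition dK F : \bar R := (\int[mu \x mu]_z (F z * hkernel s p z)%:E)%E.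

Lemma gagliardoE v : gagliardo s p v = dK (fun z => pw p (v z.1 - v z.2)).
Proof. by []. Qed.

Let mk := @measurable_hkernel R N s p.
Let mFk F : measurable_fun [set: H * H] F ->
  measurable_fun [set: H * H] (fun z => F z * hkernel s p z).
Proof. by move=> mF; exact: measurable_funM. Qed.
Let Fk0 F : (forall z, 0 <= F z) -> forall z, 0 <= F z * hkernel s p z.
Proof. by move=> F0 z; rewrite mulr_ge0// hkernel_ge0. Qed.

Lemma dK_ge0 F : (forall z, 0 <= F z) -> (0 <= dK F)%E.
Proof. by move=> F0; apply: rint_ge0; exact: Fk0. Qed.

Lemma dK_le F1 F2 : measurable_fun [set: H * H] F1 -> measurable_fun [set: H * H] F2 ->
  (forall z, 0 <= F1 z) -> (forall z, F1 z <= F2 z) -> (dK F1 <= dK F2)%E.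
Proof.
move=> m1 m2 F0 F12; apply: rint_le; [exact: mFk|exact: mFk|exact: Fk0|].
by move=> z; rewrite ler_wpM2r// hkernel_ge0.
Qed.

Lemma dKD F1 F2 : measurable_fun [set: H * H] F1 -> measurable_fun [set: H * H] F2 ->
  (forall z, 0 <= F1 z) -> (forall z, 0 <= F2 z) ->
  dK (fun z => F1 z + F2 z) = (dK F1 + dK F2)%E.
Proof.
move=> m1 m2 F10 F20; rewrite /dK; under eq_integral do rewrite mulrDl.
by apply: rintD; [exact: mFk|exact: mFk|exact: Fk0|exact: Fk0].
Qed.

Lemma dKZ c F : measurable_fun [set: H * H] F -> 0 <= c ->
  (forall z, 0 <= F z) -> dK (fun z => c * F z) = (c%:E * dK F)%E.
Proof.
move=> m1 c0 F0; rewrite /dK; under eq_integral do rewrite -mulrA.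
by apply: rintZ => //; [exact: mFk|exact: Fk0].
Qed.

Lemma measurable_pwdiff v : measurable_fun [set: H] v ->
  measurable_fun [set: H * H] (fun z => pw p (v z.1 - v z.2)).
Proof.
move=> mv; apply: (measurableT_comp (@measurable_pw R p)); apply: measurable_funB.
  exact: (measurableT_comp mv measurable_fst).
exact: (measurableT_comp mv measurable_snd).
Qed.

Lemma gagliardo_ge0 v : (0 <= gagliardo s p v)%E.
Proof. by apply: dK_ge0 => z; exact: pw_ge0. Qed.

Lemma gagliardo_ae_eq v w : measurable_fun [set: H] v -> measurable_fun [set: H] w ->
  {ae mu, forall x, v x = w x} -> gagliardo s p v = gagliardo s p w.
Proof.
move=> mv mw vw; apply: rint_ae_eq; [by apply: mFk; exact: measurable_pwdiff..|].
apply: filterS2 (ae_prod1 mu vw) (ae_prod2 mu vw) => z h1 h2.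
by rewrite h1 h2.
Qed.

Lemma gagliardo_le2 c v w1 w2 : measurable_fun [set: H] v ->
  measurable_fun [set: H] w1 -> measurable_fun [set: H] w2 -> 0 <= c ->
  (forall x y, pw p (v x - v y) <= c * (pw p (w1 x - w1 y) + pw p (w2 x - w2 y))) ->
  (gagliardo s p v <= c%:E * (gagliardo s p w1 + gagliardo s p w2))%E.
Proof.
move=> mv m1 m2 c0 h.
have M1 := measurable_pwdiff m1; have M2 := measurable_pwdiff m2.
have P1 z : 0 <= pw p (w1 z.1 - w1 z.2) by exact: pw_ge0.
have P2 z : 0 <= pw p (w2 z.1 - w2 z.2) by exact: pw_ge0.
have M12 := measurable_funD M1 M2.
have P12 z : 0 <= pw p (w1 z.1 - w1 z.2) + pw p (w2 z.1 - w2 z.2) by rewrite addr_ge0.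
rewrite -(dKD M1 M2 P1 P2) -(dKZ M12 c0 P12).
apply: dK_le; [exact: measurable_pwdiff| |by move=> z; exact: pw_ge0|].
  by apply: measurable_funM.
by move=> z; exact: h.
Qed.

Lemma gagliardo_le v w : measurable_fun [set: H] v -> measurable_fun [set: H] w ->
  (forall x y, pw p (v x - v y) <= pw p (w x - w y)) ->
  (gagliardo s p v <= gagliardo s p w)%E.
Proof.
move=> mv mw h; apply: dK_le; [exact: measurable_pwdiff|exact: measurable_pwdiff|by move=> z; exact: pw_ge0|].
by move=> z; exact: h.
Qed.

Lemma gagliardoD v w : measurable_fun [set: H] v -> measurable_fun [set: H] w ->
  (gagliardo s p (fun x => v x + w x)%R <= (2 `^ p)%:E * (gagliardo s p v + gagliardo s p w))%E.
Proof.
move=> mv mw; apply: gagliardo_le2 => // [|x y]; first exact: measurable_funD.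
 rewrite (_ : v x + w x - (v y + w y) = (v x - v y) + (w x - w y)).
  exact: pwD.
by ring.
Qed.

Lemma gagliardoZ c v : measurable_fun [set: H] v ->
  gagliardo s p (fun x => c * v x)%R = ((pw p c)%:E * gagliardo s p v)%E.
Proof.
move=> mv; rewrite gagliardoE -(dKZ (measurable_pwdiff mv) (pw_ge0 p c)); last by move=> z; exact: pw_ge0.
by congr dK; apply/funext => z; rewrite -mulrBr pwM.
Qed.

Lemma dK_tonelli1 F : measurable_fun [set: H * H] F -> (forall z, 0 <= F z) ->
  dK F = (\int[mu]_x \int[mu]_y (F (x, y) * hkernel s p (x, y))%:E)%E.
Proof.
move=> mF F0; rewrite /dK fubini_tonelli1//; last by move=> z; rewrite lee_fin Fk0.
by apply/measurable_EFinP; exact: mFk.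
Qed.

Lemma dK_tonelli2 F : measurable_fun [set: H * H] F -> (forall z, 0 <= F z) ->
  dK F = (\int[mu]_y \int[mu]_x (F (x, y) * hkernel s p (x, y))%:E)%E.
Proof.
move=> mF F0; rewrite /dK fubini_tonelli2//; last by move=> z; rewrite lee_fin Fk0.
by apply/measurable_EFinP; exact: mFk.
Qed.

Lemma measurable_hmull (g : H) : measurable_fun [set: H] (fun x : H => hmul g x).
Proof. by apply: measurable_fun_hmul. Qed.

(** The kernel depends on y^-1 x only, which left translations leave unchanged,
    and they preserve Lebesgue measure. *)
Lemma gagliardo_hmull g v : measurable_fun [set: H] v ->
  gagliardo s p (fun x => v (hmul g x)) = gagliardo s p v.
Proof.
move=> mv.
have mvg : measurable_fun [set: H] (fun x => v (hmul g x)).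
  exact: measurableT_comp mv (measurable_hmull g).
rewrite [LHS](dK_tonelli1 (measurable_pwdiff mvg) (fun z => pw_ge0 p _)).
rewrite [RHS](dK_tonelli1 (measurable_pwdiff mv) (fun z => pw_ge0 p _)).
pose I x := (\int[mu]_y (pw p (v x - v y) * hkernel s p (x, y))%:E)%E.
have mFz : measurable_fun [set: H * H] (fun z => (pw p (v z.1 - v z.2) * hkernel s p z)%:E).
  by apply/measurable_EFinP; apply: mFk; exact: measurable_pwdiff.
have F0 z : (0 <= (pw p (v z.1 - v z.2) * hkernel s p z)%:E)%E.
  by rewrite lee_fin mulr_ge0 ?pw_ge0 ?hkernel_ge0.
have mI : measurable_fun [set: H] I.
  exact: (measurable_fun_fubini_tonelli_F (m2 := mu) _ mFz F0).
have I0 x : (0 <= I x)%E by apply: integral_ge0 => y _; exact: (F0 (x, y)).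
rewrite -[RHS](integral_hmull mI I0 g); apply: eq_integral => x _.
have M1 := measurableT_comp mFz (measurable_pair1 (hmul g x)).
have M2 y := F0 (hmul g x, y).
rewrite -[RHS](integral_hmull M1 M2 g).
by apply: eq_integral => y _; rewrite -(hkernel_hmull s p g x y).
Qed.

Lemma measurable_hkernel1 x : measurable_fun [set: H] (fun y => hkernel s p (x, y)).
Proof. exact: measurableT_comp mk (measurable_pair1 x). Qed.

End gagliardo.

(** * Faber-Krahn and Lipschitz estimates *)

Section estimates.
Variables (R : realType) (N : nat) (s p : R).
Hypotheses (s_gt0 : 0 < s) (s_lt1 : s < 1) (p_gt1 : 1 < p).
Local Notation Q := (hdim N).
Local Notation q := (Q%:R + s * p).
Local Notation mu := (hmu R N).
Local Notation H := (heis R N).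
Implicit Types (u v w : H -> R) (F : H * H -> R) (L M Rr r c : R).

Let q_gt0 : 0 < q. Proof. exact: (hexp_gt0 N s_gt0 p_gt1). Qed.

Definition xbox (x : H) (r : R) : set H := [set y | hbox r (hmul (- x) y)].

Lemma measurable_xbox x r : measurable (xbox x r).
Proof.
have := measurable_hmull (- x) measurableT (measurable_hbox (N := N) r).
by rewrite setTI.
Qed.

Lemma hmu_xbox x r : 0 < r -> mu (xbox x r) = (r ^+ Q)%:E.
Proof.
move=> r0; rewrite -(rint_indic _ (measurable_xbox x r)) -(hmu_hbox N r0).
rewrite -(rint_indic _ (measurable_hbox (N := N) r)).
have m1 : measurable_fun [set: H] (fun z : H => (\1_(hbox r) z : R)%:E).
  by apply/measurable_EFinP; apply: measurable_indic; exact: measurable_hbox.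
rewrite -[RHS](integral_hmull m1 _ (- x)); last by move=> z; rewrite lee_fin.
by apply: eq_integral => y _; rewrite !indicE.
Qed.

Definition box_const : R := ((N + N).+1%:R) `^ q.

Lemma box_const_gt0 : 0 < box_const. Proof. by rewrite powR_gt0. Qed.

Lemma hkernel_xbox x y r : 0 < r -> xbox x r y ->
  (((N + N).+1%:R * r) `^ q)^-1 <= hkernel s p (x, y).
Proof.
move=> r0 xy; rewrite -(hmulNKx x y) hkernel_hmul; exact: hbox_kap.
Qed.

(** A translated box of size r is filled by S up to one half at most, and w
    vanishes on the rest. There the kernel is at least of order r^(-Q - s p), so
    the inner integral at x is at least of order r^(-s p) |w x|^p. With a large
    r this is Poincare's inequality; with r tied to the measure of S it drives
    the De Giorgi iteration. *)
Lemma faber_krahn (S : set H) r w : measurable S -> measurable_fun [set: H] w ->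
  (forall x, ~ S x -> w x = 0) -> 0 < r -> (mu S <= (r ^+ Q / 2)%:E)%E ->
  (\int[mu]_x (pw p (w x))%:E <= (2 * box_const * r `^ (s * p))%:E * gagliardo s p w)%E.
Proof.
move=> mS mw wS r0 muS.
pose k0 := (((N + N).+1%:R * r) `^ q)^-1.
have k00 : 0 < k0 by rewrite invr_gt0 powR_gt0// mulr_gt0.
have rQ0 : 0 < r ^+ Q by rewrite exprn_gt0.
pose c := r ^+ Q / 2 * k0.
have c0 : 0 < c by rewrite mulr_gt0// divr_gt0.
have inner x : ((c * pw p (w x))%:E <=
    \int[mu]_y (pw p (w x - w y) * hkernel s p (x, y))%:E)%E.
  pose D := xbox x r `\` S.
  have mD : measurable D by apply: measurableD => //; exact: measurable_xbox.
  have muD : ((r ^+ Q / 2)%:E <= mu D)%E.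
    have e := measureDI mu (measurable_xbox x r) mS.
    rewrite [LHS](hmu_xbox x r0) in e.
    have : ((r ^+ Q)%:E <= mu D + (r ^+ Q / 2)%:E)%E.
      rewrite e leeD2l//; apply: le_trans muS.
      by apply: le_measure; rewrite ?inE//; exact: measurableI (measurable_xbox x r) mS.
    by rewrite -leeBlDr// -EFinB; apply: le_trans; rewrite lee_fin; lra.
  have mpwx : measurable_fun [set: H] (fun y => pw p (w x - w y)).
    by apply: (measurableT_comp (@measurable_pw R p)); exact: measurable_funB.
  have cc : 0 <= k0 * pw p (w x) by rewrite mulr_ge0 ?pw_ge0 ?ltW.
  have i0 y : 0 <= \1_D y :> R by [].
  apply: (@le_trans _ _ (\int[mu]_y (k0 * pw p (w x) * \1_D y)%:E)%E).
    rewrite (rintZ mu (measurable_indic mD) cc i0) (rint_indic mu mD).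
    rewrite (_ : c * _ = k0 * pw p (w x) * (r ^+ Q / 2)); last by rewrite /c; ring.
    by rewrite EFinM lee_wpmul2l.
  apply: rint_le.
  - exact: measurable_funM (measurable_cst _) (measurable_indic mD).
  - exact: measurable_funM mpwx (@measurable_hkernel1 R N s p x).
  - by move=> y; rewrite mulr_ge0.
  - move=> y; rewrite indicE; have [|yD] := boolP (y \in D); last first.
      by rewrite mulr0 mulr_ge0 ?pw_ge0 ?hkernel_ge0.
    rewrite inE => -[yx yS]; rewrite mulr1 (wS _ yS) subr0 mulrC.
    by rewrite ler_wpM2l ?pw_ge0//; exact: hkernel_xbox.
have mpw : measurable_fun [set: H] (fun x => pw p (w x)) by exact: (measurableT_comp (@measurable_pw R p)).
have : (c%:E * \int[mu]_x (pw p (w x))%:E <= gagliardo s p w)%E.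
  rewrite -(rintZ mu mpw (ltW c0) (fun x => pw_ge0 p _)).
  rewrite [leRHS](dK_tonelli1 s p (measurable_pwdiff p mw) (fun z => pw_ge0 p _)).
  apply: ge0_le_integral => //.
  - by move=> x _; rewrite lee_fin mulr_ge0 ?pw_ge0 ?ltW.
  - by apply/measurable_EFinP; exact: measurable_funM.
  - apply: (measurable_fun_fubini_tonelli_F (m2 := mu) (fun z => (pw p (w z.1 - w z.2) * hkernel s p z)%:E)).
      apply/measurable_EFinP; apply: measurable_funM; last exact: measurable_hkernel.
      exact: measurable_pwdiff.
    by move=> z; rewrite lee_fin mulr_ge0 ?pw_ge0 ?hkernel_ge0.
rewrite -(lee_pdivlMl _ _ c0); suff -> : c^-1 = 2 * box_const * r `^ (s * p) by [].
rewrite /c /k0 /box_const invrM ?unitfE ?(gt_eqF k00)// ?(gt_eqF (divr_gt0 rQ0 _))//.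
rewrite invrK powRM// ?(ltW r0)// (@powRD _ r) ?(gt_eqF r0) ?implybT// (powR_mulrn Q (ltW r0)).
field; by rewrite gt_eqF.
Qed.

Lemma hdisp_le (x z : H) Rr : 0 <= Rr -> (forall i, `|hz x i| <= Rr) -> hnorm z <= 1 ->
  `|x - hmul x z| <= (2 + N%:R * Rr) * hnorm z.
Proof.
move=> R0 xR z1; have Rr0 : 0 <= N%:R * Rr by rewrite mulr_ge0.
have z0 := hnorm_ge0 z.
have zz : hnorm z ^+ 2 <= hnorm z by rewrite expr2 ler_piMr.
apply: mx_norm_le; first by rewrite mulr_ge0// addr_ge0.
move=> j; rewrite !mxE -/(hform x z); case: eqP => [->|/eqP jm].
  have h1 := ht_le_hnorm z.
  have h2 : `|hform x z| <= N%:R * Rr * hnorm z.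
    by rewrite -mulrA; apply: hform_le => // i; exact: hz_le_hnorm.
  have -> : x 0 ord_max - (x 0 ord_max + z 0 ord_max + hform x z) = - (ht z + hform x z).
    by rewrite /ht; ring.
  rewrite normrN; apply: le_trans (ler_normD _ _) _; nra.
have jN : (j < N + N)%N.
  by rewrite ltn_neqAle -ltnS ltn_ord andbT; apply: contra_neq jm => jm; exact: val_inj.
have -> : x 0 j - (x 0 j + z 0 j + 0) = - hz z (Ordinal jN).
  by rewrite /hz (_ : widen_ord _ _ = j); [ring|exact: val_inj].
rewrite normrN; apply: le_trans (hz_le_hnorm _ _) _; nra.
Qed.

(** Substitute y = x z: the difference of values is at most min (2 M, C |z|), so
    the moment of the kernel bounds the integral. *)
Lemma lipschitz_kernel L M Rr : 0 <= L -> 0 <= M -> 0 <= Rr -> exists2 C : R, 0 < C & forall eta : H -> R,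
  measurable_fun [set: H] eta ->
  (forall x, `|eta x| <= M) -> (forall x y, `|eta x - eta y| <= L * `|x - y|) ->
  forall x, (forall i, `|hz x i| <= Rr) ->
  (\int[mu]_y (pw p (eta x - eta y) * hkernel s p (x, y))%:E <= C%:E)%E.
Proof.
move=> L0 M0 Rr0.
pose A := (2 * M) `^ p + (L * (2 + N%:R * Rr)) `^ p.
have A0 : 0 <= A by rewrite addr_ge0// powR_ge0.
have km := kmoment_fin N s_gt0 s_lt1 p_gt1.
have km0 : (0 <= \int[mu]_z (kmoment s p z)%:E)%E.
  by apply: rint_ge0 => z; exact: kmoment_ge0.
pose K := fine (\int[mu]_z (kmoment s p z)%:E)%E.
have K0 : 0 <= K by exact: fine_ge0.
exists (1 + A * K) => [|eta meta etaM etaL x xR]; first by rewrite ltr_pwDl// mulr_ge0.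
have m1 : measurable_fun [set: H] (fun y => pw p (eta x - eta y) * hkernel s p (x, y)).
  apply: measurable_funM; last exact: measurable_hkernel1.
  by apply: (measurableT_comp (@measurable_pw R p)); exact: measurable_funB.
have m2 : measurable_fun [set: H] (fun y => (pw p (eta x - eta y) * hkernel s p (x, y))%:E).
  exact/measurable_EFinP.
rewrite -(integral_hmull m2 _ x); last by move=> y; rewrite lee_fin mulr_ge0 ?pw_ge0 ?hkernel_ge0.
apply: (@le_trans _ _ (\int[mu]_z (A * kmoment s p z)%:E)%E); last first.
  rewrite (rintZ mu (@measurable_kmoment R N s p) A0 (kmoment_ge0 s p)).
  by rewrite -[X in (_ * X)%E]fineK ?ge0_fin_numE// -EFinM lee_fin lerDr.
apply: rint_le.
- exact: (measurableT_comp m1 (measurable_hmull x)).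
- exact: measurable_funM (measurable_cst _) (@measurable_kmoment R N s p).
- by move=> z; rewrite mulr_ge0 ?pw_ge0 ?hkernel_ge0.
- move=> z; rewrite hkernel_hmul /kmoment mulrA ler_wpM2r ?kap_ge0//.
  have pp : 0 <= p by have := p_gt1; lra.
  have [z1|z1] := leP 1 (hnorm z `^ p).
    rewrite mulr1; apply: (@le_trans _ _ ((2 * M) `^ p)); last by rewrite lerDl powR_ge0.
    rewrite ge0_ler_powR ?nnegrE ?mulr_ge0//; apply: le_trans (ler_normB _ _) _.
    by rewrite mulr_natl mulr2n lerD.
  have zn : hnorm z <= 1.
    rewrite leNgt; apply/negP => h; move: z1; rewrite ltNge => /negP; apply.
    have -> : 1 = 1 `^ p :> R by rewrite powR1.
    by rewrite ge0_ler_powR ?nnegrE ?hnorm_ge0// ltW.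
  apply: (@le_trans _ _ ((L * (2 + N%:R * Rr)) `^ p * hnorm z `^ p)); last first.
    by rewrite ler_wpM2r ?powR_ge0// lerDr powR_ge0.
  rewrite -powRM ?hnorm_ge0// ?mulr_ge0 ?addr_ge0 ?mulr_ge0//.
  rewrite ge0_ler_powR ?nnegrE ?mulr_ge0 ?addr_ge0 ?mulr_ge0 ?hnorm_ge0//.
  apply: le_trans (etaL _ _) _; rewrite -mulrA ler_wpM2l//; exact: hdisp_le.
Qed.

(** One of the two variables runs over S, and [lipschitz_kernel] bounds the
    integral over the other. This is the error term in the energy estimates for
    truncations. *)
Lemma lipschitz_dK L M Rr : 0 <= L -> 0 <= M -> 0 <= Rr -> exists2 C : R, 0 < C & forall eta : H -> R,
  measurable_fun [set: H] eta ->
  (forall x, `|eta x| <= M) -> (forall x y, `|eta x - eta y| <= L * `|x - y|) ->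
  forall S : set H, measurable S -> (forall x, S x -> forall i, `|hz x i| <= Rr) ->
  (dK s p (fun z : H * H => pw p (eta z.1 - eta z.2) * (\1_S z.1 + \1_S z.2))%R <= C%:E * mu S)%E.
Proof.
move=> L0 M0 Rr0; have [C C0 HC] := lipschitz_kernel L0 M0 Rr0.
exists (2 * C) => [|eta meta etaM etaL S mS SR]; first by rewrite mulr_gt0.
have mi1 : measurable_fun [set: H * H] (fun z : H * H => \1_S z.1 : R).
  by apply: (measurableT_comp _ measurable_fst); exact: measurable_indic.
have mi2 : measurable_fun [set: H * H] (fun z : H * H => \1_S z.2 : R).
  by apply: (measurableT_comp _ measurable_snd); exact: measurable_indic.
have mp := measurable_pwdiff p meta.
have m1 : measurable_fun [set: H * H] (fun z : H * H => pw p (eta z.1 - eta z.2) * \1_S z.1) := measurable_funM mp mi1.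
have m2 : measurable_fun [set: H * H] (fun z : H * H => pw p (eta z.1 - eta z.2) * \1_S z.2) := measurable_funM mp mi2.
have p1 (z : H * H) : 0 <= pw p (eta z.1 - eta z.2) * \1_S z.1 by rewrite mulr_ge0 ?pw_ge0.
have p2 (z : H * H) : 0 <= pw p (eta z.1 - eta z.2) * \1_S z.2 by rewrite mulr_ge0 ?pw_ge0.
rewrite (_ : (fun z => _) = (fun z : H * H => pw p (eta z.1 - eta z.2) * \1_S z.1 +
    pw p (eta z.1 - eta z.2) * \1_S z.2)); last by apply/funext => z; rewrite mulrDr.
rewrite (dKD s p m1 m2 p1 p2) mulr2n mulrDl mul1r EFinD ge0_muleDl ?lee_fin ?(ltW C0)//.
have bnd (I : H -> \bar R) : measurable_fun [set: H] I -> (forall x, 0 <= I x)%E ->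
    (forall x, I x <= (C * \1_S x)%:E)%E -> (\int[mu]_x I x <= C%:E * mu S)%E.
  have i0 y : 0 <= \1_S y :> R by [].
  move=> mI I0 IC; rewrite -(rint_indic mu mS) -(rintZ mu (measurable_indic mS) (ltW C0) i0).
  apply: ge0_le_integral => //; apply/measurable_EFinP.
  exact: measurable_funM (measurable_cst _) (measurable_indic mS).
have mk := @measurable_hkernel R N s p.
apply: leeD.
  rewrite (dK_tonelli1 s p m1 p1); apply: bnd.
  - apply: (measurable_fun_fubini_tonelli_F (m2 := mu) (fun z => (pw p (eta z.1 - eta z.2) * \1_S z.1 * hkernel s p z)%:E)).
      by apply/measurable_EFinP; exact: measurable_funM.
    by move=> z; rewrite lee_fin mulr_ge0 ?hkernel_ge0.
  - by move=> x; apply: rint_ge0 => y; rewrite mulr_ge0 ?hkernel_ge0// (p1 (x, y)).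
  - move=> x; rewrite indicE; have [|xS] := boolP (x \in S).
      rewrite inE mulr1 => xS; apply: le_trans (HC _ meta etaM etaL x (SR _ xS)).
      by rewrite le_eqVlt; apply/orP; left; apply/eqP; apply: eq_integral => y _ /=; rewrite mulr1.
    by under eq_integral => y _ do rewrite /= mulr0 mul0r; rewrite integral0 mulr0.
rewrite (dK_tonelli2 s p m2 p2); apply: bnd.
- apply: (measurable_fun_fubini_tonelli_G (m1 := mu) (fun z => (pw p (eta z.1 - eta z.2) * \1_S z.2 * hkernel s p z)%:E)).
    by apply/measurable_EFinP; exact: measurable_funM.
  by move=> z; rewrite lee_fin mulr_ge0 ?hkernel_ge0.
- by move=> y; apply: rint_ge0 => x; rewrite mulr_ge0 ?hkernel_ge0// (p2 (x, y)).
- move=> y; rewrite indicE; have [|yS] := boolP (y \in S).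
    rewrite inE mulr1 => yS; apply: le_trans (HC _ meta etaM etaL y (SR _ yS)).
    rewrite le_eqVlt; apply/orP; left; apply/eqP; apply: eq_integral => x _ /=; rewrite mulr1 hkernelC.
    by rewrite -(pwN _ (eta x - eta y)) opprB.
  by under eq_integral => x _ do rewrite /= mulr0 mul0r; rewrite integral0 mulr0.
Qed.

End estimates.

(** * Continuity of left translations *)

Section translation.
Variables (R : realType) (N : nat) (s p : R).
Hypotheses (s_gt0 : 0 < s) (s_lt1 : s < 1) (p_gt1 : 1 < p).
Local Notation Q := (hdim N).
Local Notation q := (Q%:R + s * p).
Local Notation mu := (hmu R N).
Local Notation H := (heis R N).
Implicit Types (u v w : H -> R) (F : H * H -> R) (L M Rr r c : R).

Let q_gt0 : 0 < q. Proof. exact: (hexp_gt0 N s_gt0 p_gt1). Qed.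

Lemma hnorm0 : hnorm (0 : H) = 0.
Proof.
apply/eqP; rewrite eq_le hnorm_ge0 andbT -[leRHS](mulr0 (N + N).+1%:R).
by apply: hnorm_le => // [i|]; rewrite /hz /ht mxE normr0 ?expr0n.
Qed.

(** The displacement from g x to x z. Passing g across x alters the last
    coordinate by an amount of order |g|, which has to be at most r^2 for the
    gauge to be of order r; this is why shifts are measured by r^2. *)
Lemma conj_norm_le (g x z : H) r Rr : 0 < r <= 1 -> 0 <= Rr ->
  (forall j, `|g 0 j| <= r ^+ 2) -> (forall i, `|hz x i| <= Rr) -> hbox r z ->
  hnorm (hmul (- hmul g x) (hmul x z)) <= (N + N).+1%:R * ((2 + 2 * N%:R * Rr + N%:R) * r).
Proof.
move=> /andP[r0 r1] Rr0 gr xR bz.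
set D := 2 + _ + _; have NR : 0 <= N%:R * Rr by rewrite mulr_ge0.
have N0 : 0 <= N%:R :> R by [].
have D2 : 2 <= D by rewrite /D -addrA lerDl addr_ge0// -mulrA mulr_ge0.
have rr : r ^+ 2 <= r by rewrite expr2 ler_piMr// ltW.
have zr i : `|hz z i| <= r.
  have := bz (widen_ord (leqnSn _) i); rewrite widen_neq_max in_itv/= /hz => /andP[z0 zr].
  by rewrite ger0_norm// ltW.
have ztr : `|ht z| <= r ^+ 2.
  by have := bz ord_max; rewrite eqxx in_itv/= /ht => /andP[z0 zt]; rewrite ger0_norm// ltW.
have gi i : `|hz g i| <= r ^+ 2 by exact: gr.
apply: hnorm_le; first by rewrite mulr_ge0 ?(ltW r0)//; lra.
  move=> i; rewrite hz_hmul hzN !hz_hmul.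
  have -> : - (hz g i + hz x i) + (hz x i + hz z i) = hz z i - hz g i by ring.
  apply: le_trans (ler_normB _ _) _; have := zr i; have := gi i; nra.
rewrite ht_hmul htN !ht_hmul hformNl !hformDl !hformDr hformxx.
have -> : - (ht g + ht x + hform g x) + (ht x + ht z + hform x z) -
    (hform g x + hform g z + (0 + hform x z)) = ht z - ht g - 2 * hform g x - hform g z by ring.
have f1 : `|hform g x| <= N%:R * (r ^+ 2 * Rr) by apply: hform_le => //; exact: exprn_ge0 (ltW r0).
have f2 : `|hform g z| <= N%:R * (r ^+ 2 * r).
  by apply: hform_le => //; [exact: exprn_ge0 (ltW r0)|exact: ltW].
have g2 : `|ht g| <= r ^+ 2 by exact: gr.
have r20 : 0 <= r ^+ 2 by exact: exprn_ge0 (ltW r0).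
have f2' : `|hform g z| <= N%:R * r ^+ 2.
  by apply: le_trans f2 _; rewrite ler_wpM2l// ler_piMr.
apply: (@le_trans _ _ (D * r ^+ 2)).
  apply: le_trans (ler_normB _ _) _; apply: le_trans (lerD (ler_normB _ _) (lexx _)) _.
  apply: le_trans (lerD (lerD (ler_normB _ _) (lexx _)) (lexx _)) _.
  have -> : `|2 * hform g x| = 2 * `|hform g x| by rewrite normrM ger0_norm.
  rewrite /D; move: f1 f2' g2 ztr; set a := `|hform g x|; set b := `|hform g z|.
  set e := r ^+ 2; set k := `|ht g|; set l := `|ht z| => h1 h2 h3 h4.
  have -> : (2 + 2 * N%:R * Rr + N%:R) * e = e + e + 2 * (N%:R * (e * Rr)) + N%:R * e by ring.
  lra.
rewrite exprMn ler_wpM2r// expr2 ler_peMl//; lra.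
Qed.

(** Compare w (g x) and w x with the values w y in the box of size r translated
    to x, and average over y: the box has measure r^Q and the kernels of both
    pairs are at least of order r^(-Q - s p) there. *)
Lemma translation_estimate Rr : 0 <= Rr -> exists2 C : R, 0 < C & forall w (g : H) r,
  measurable_fun [set: H] w -> 0 < r <= 1 -> (forall j, `|g 0 j| <= r ^+ 2) ->
  (forall x, w x != 0 \/ w (hmul g x) != 0 -> forall i, `|hz x i| <= Rr) ->
  (\int[mu]_x (pw p (w (hmul g x) - w x))%:E <= (C * r `^ (s * p))%:E * gagliardo s p w)%E.
Proof.
move=> Rr0; pose D : R := 2 + 2 * N%:R * Rr + N%:R.
have NR : 0 <= N%:R * Rr by rewrite mulr_ge0.
have D2 : 2 <= D by rewrite /D -addrA lerDl addr_ge0// -mulrA mulr_ge0.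
have D0 : 0 < D by lra.
have c0D : 0 < (N + N).+1%:R * D by rewrite mulr_gt0.
exists (2 * 2 `^ p * ((N + N).+1%:R * D) `^ q) => [|w g r mw /andP[r0 r1] gr wR].
  by rewrite !mulr_gt0// ?powR_gt0.
pose k1 := (((N + N).+1%:R * (D * r)) `^ q)^-1.
have cr : 0 < (N + N).+1%:R * (D * r) by rewrite !mulr_gt0.
have k10 : 0 < k1 by rewrite invr_gt0 powR_gt0.
have kap_k1 (z : H) : z != 0 -> hnorm z <= (N + N).+1%:R * (D * r) -> k1 <= kap s p z.
  move=> z0 zr; have h1 : 0 < hnorm z `^ q by exact: powR_gt0 (hnorm_gt0 z0).
  have h2 : 0 < ((N + N).+1%:R * (D * r)) `^ q by exact: powR_gt0.
  rewrite /k1 /kap lef_pV2 ?posrE//.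
  by rewrite ge0_ler_powR ?nnegrE ?hnorm_ge0 ?(ltW q_gt0) ?(ltW cr).
pose F1 (z : H * H) := pw p (w z.1 - w z.2) * hkernel s p z.
have mF1 : measurable_fun [set: H * H] F1.
  exact: measurable_funM (measurable_pwdiff p mw) (@measurable_hkernel R N s p).
have F10 z : 0 <= F1 z by rewrite mulr_ge0 ?pw_ge0 ?hkernel_ge0.
have mF1x x : measurable_fun [set: H] (fun y => F1 (x, y)).
  exact: measurableT_comp mF1 (measurable_pair1 x).
pose I x := (\int[mu]_y (F1 (x, y))%:E)%E.
have mI : measurable_fun [set: H] I.
  apply: (measurable_fun_fubini_tonelli_F (m2 := mu) (fun z => (F1 z)%:E)).
    exact/measurable_EFinP.
  by move=> z; rewrite lee_fin.
have I0 x : (0 <= I x)%E by apply: rint_ge0.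
have IG : (\int[mu]_x I x = gagliardo s p w)%E.
  by rewrite [RHS](dK_tonelli1 s p (measurable_pwdiff p mw) (fun z => pw_ge0 p _)).
have mwg : measurable_fun [set: H] (fun x => w (hmul g x)).
  exact: measurableT_comp mw (measurable_hmull g).
have mpw : measurable_fun [set: H] (fun x => pw p (w (hmul g x) - w x)).
  exact: (measurableT_comp (@measurable_pw R p) (measurable_funB mwg mw)).
have rQ0 : 0 < r ^+ Q by rewrite exprn_gt0.
pose c := r ^+ Q * k1; have c0 : 0 < c by rewrite mulr_gt0.
have inner x : ((c * pw p (w (hmul g x) - w x))%:E <= (2 `^ p)%:E * (I (hmul g x) + I x))%E.
  have [xR|xR] := pselect (forall i, `|hz x i| <= Rr); last first.
    have w0 : w x = 0 by apply/eqP/negP => /negP h; apply: xR; apply: wR; left.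
    have wg0 : w (hmul g x) = 0 by apply/eqP/negP => /negP h; apply: xR; apply: wR; right.
    rewrite w0 wg0 subrr pw0 ?mulr0 ?gt_eqF//; last by have := p_gt1; lra.
    by rewrite mule_ge0 ?lee_fin ?powR_ge0// adde_ge0.
  rewrite -(rintD mu (mF1x _) (mF1x _) (fun y => F10 _) (fun y => F10 _)).
  have m2 : measurable_fun [set: H] (fun y : H => F1 (hmul g x, y) + F1 (x, y)) :=
    measurable_funD (mF1x (hmul g x)) (mF1x x).
  have p2 y : 0 <= F1 (hmul g x, y) + F1 (x, y) by rewrite addr_ge0.
  rewrite -(rintZ mu m2 (powR_ge0 2 p) p2).
  have mB := measurable_xbox x r.
  have cc : 0 <= k1 * pw p (w (hmul g x) - w x) by rewrite mulr_ge0 ?pw_ge0 ?ltW.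
  have i0 y : 0 <= \1_(xbox x r) y :> R by [].
  apply: (@le_trans _ _ (\int[mu]_y (k1 * pw p (w (hmul g x) - w x) * \1_(xbox x r) y)%:E)%E).
    rewrite (rintZ mu (measurable_indic mB) cc i0) (rint_indic mu mB) [X in (_ * X)%E](hmu_xbox x r0) -EFinM.
    by rewrite /c lee_fin le_eqVlt; apply/orP; left; apply/eqP; ring.
  apply: rint_le.
  - exact: measurable_funM (measurable_cst _) (measurable_indic mB).
  - exact: measurable_funM (measurable_cst _) m2.
  - by move=> y; rewrite mulr_ge0.
  - move=> y; rewrite indicE; have [|yB] := boolP (y \in xbox x r); last first.
      by rewrite mulr0 mulr_ge0 ?powR_ge0.
    rewrite inE => yB; rewrite mulr1.
    have yE := hmulNKx x y; set z := hmul (- x) y in yE.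
    have t1 : k1 * pw p (w x - w y) <= F1 (x, y).
      rewrite /F1/= mulrC ler_wpM2l ?pw_ge0// -yE hkernel_hmul.
      have /andP[z0 zr] := hbox_hnorm r0 yB.
      apply: kap_k1; first by apply/eqP => zz; move: z0; rewrite -/z zz hnorm0 ltxx.
      by rewrite -/z in zr; apply: le_trans zr _; rewrite ler_wpM2l// ler_peMl// ?(ltW r0)//; lra.
    have t2 : k1 * pw p (w (hmul g x) - w y) <= F1 (hmul g x, y).
      rewrite /F1/=; have [->|yg] := eqVneq y (hmul g x).
        by rewrite subrr pw0 ?mulr0 ?mul0r// gt_eqF//; have := p_gt1; lra.
      rewrite mulrC ler_wpM2l ?pw_ge0// hkernelC hkernelE.
      apply: kap_k1; last by rewrite -yE; apply: conj_norm_le => //; rewrite r0.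
      apply: contra_neq yg => e0; rewrite -(hmulNKx (hmul g x) y) e0 hmulx0 //.
    apply: (@le_trans _ _ (2 `^ p * (k1 * pw p (w (hmul g x) - w y) + k1 * pw p (w x - w y)))).
      rewrite -mulrDr mulrCA ler_wpM2l ?(ltW k10)//.
      rewrite (_ : w (hmul g x) - w x = (w (hmul g x) - w y) - (w x - w y)); last by ring.
      exact: pwB.
    exact: (ler_wpM2l (powR_ge0 2 p) (lerD t2 t1)).
have mIg : measurable_fun [set: H] (fun x => I (hmul g x)).
  exact: measurableT_comp mI (measurable_hmull g).
have : (c%:E * \int[mu]_x (pw p (w (hmul g x) - w x))%:E <= (2 * 2 `^ p)%:E * gagliardo s p w)%E.
  rewrite -(rintZ mu mpw (ltW c0) (fun x => pw_ge0 p _)).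
  apply: (@le_trans _ _ (\int[mu]_x ((2 `^ p)%:E * (I (hmul g x) + I x)))%E).
    apply: ge0_le_integral => //.
    - by move=> x _; rewrite lee_fin mulr_ge0 ?pw_ge0 ?ltW.
    - by apply/measurable_EFinP; exact: measurable_funM (measurable_cst _) mpw.
    - exact: measurable_funeM (emeasurable_funD mIg mI).
  have D0' x : [set: H] x -> (0 <= I (hmul g x) + I x)%E by rewrite adde_ge0.
  rewrite (ge0_integralZl_EFin mu measurableT D0' (emeasurable_funD mIg mI) (powR_ge0 2 p)).
  rewrite (ge0_integralD mu measurableT (fun x _ => I0 (hmul g x)) mIg (fun x _ => I0 x) mI).
  rewrite [X in (_ * (X + _))%E](etrans (integral_hmull mI I0 g) IG) [X in (_ * (_ + X))%E]IG.
  move: (gagliardo s p w) => G.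
  by rewrite mulrC EFinM -muleA mule_natl mule2n.
rewrite -(lee_pdivlMl _ _ c0) muleA -EFinM.
suff -> : c^-1 * (2 * 2 `^ p) = 2 * 2 `^ p * ((N + N).+1%:R * D) `^ q * r `^ (s * p) by [].
rewrite /c /k1 invrM ?unitfE ?(gt_eqF k10) ?(gt_eqF rQ0)// invrK mulrA.
rewrite (powRM _ (ltW c0D) (ltW r0)) (@powRD _ r) ?(gt_eqF r0) ?implybT// (powR_mulrn Q (ltW r0)).
by field; rewrite gt_eqF.
Qed.

End translation.

Local Opaque hmu.

(** * The distance cut-off and functions vanishing off the domain *)

Section distance.
Variables (R : realType) (n : nat) (Omega : set 'rV[R]_n).
Hypothesis Ocompl : exists y, ~ Omega y.
Local Notation V := 'rV[R]_n.
Implicit Types (x y : V) (L e : R).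

Definition cdist x : R := inf [set r | exists2 y, ~ Omega y & r = `|x - y|].

Let has x : has_inf [set r | exists2 y, ~ Omega y & r = `|x - y|].
Proof.
have [y Oy] := Ocompl; split; first by exists `|x - y|, y.
by exists 0 => _ [z _ ->].
Qed.

Lemma cdist_ge0 x : 0 <= cdist x.
Proof. by apply: lb_le_inf; [exact: (has x).1|move=> _ [z _ ->]]. Qed.

Lemma cdist_le x y : ~ Omega y -> cdist x <= `|x - y|.
Proof. by move=> Oy; apply: ge_inf; [exact: (has x).2|exists y]. Qed.

Lemma cdist_out x : ~ Omega x -> cdist x = 0.
Proof.
move=> Ox; apply/eqP; rewrite eq_le cdist_ge0 andbT.
by have := cdist_le x Ox; rewrite subrr normr0.
Qed.

Lemma cdist_lip1 x y : cdist x <= `|x - y| + cdist y.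
Proof.
rewrite -lerBlDl; apply: lb_le_inf; first exact: (has y).1.
move=> _ [z Oz ->]; rewrite lerBlDl; apply: le_trans (cdist_le x Oz) _.
by rewrite -(subrKA y) ler_normD.
Qed.

Lemma cdist_lip x y : `|cdist x - cdist y| <= `|x - y|.
Proof.
rewrite ler_norml; have := cdist_lip1 x y; have := cdist_lip1 y x.
rewrite [`|y - x|]distrC => h1 h2; apply/andP; split; lra.
Qed.

Lemma cdist_gt0 x : open Omega -> Omega x -> 0 < cdist x.
Proof.
move=> oO Ox; have /nbhs_ballP[e/= e0 xe] := open_nbhs_nbhs (conj oO Ox).
apply: lt_le_trans e0 _; apply: lb_le_inf; first exact: (has x).1.
move=> _ [z Oz ->]; rewrite leNgt; apply/negP => xz; apply: Oz; apply: xe.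
by rewrite -ball_normE.
Qed.

(** Bounded, Lipschitz and positive exactly in the domain: the barrier from
    below. *)
Definition cutd x : R := Num.min 1 (cdist x).

Lemma cutd_ge0 x : 0 <= cutd x. Proof. by rewrite le_min ler01 cdist_ge0. Qed.
Lemma cutd_le1 x : `|cutd x| <= 1.
Proof. by rewrite ger0_norm ?cutd_ge0// ge_min lexx. Qed.
Lemma cutd_out x : ~ Omega x -> cutd x = 0.
Proof. by move=> Ox; rewrite /cutd cdist_out// min_r. Qed.
Lemma cutd_gt0 x : open Omega -> Omega x -> 0 < cutd x.
Proof. by move=> oO Ox; rewrite lt_min ltr01 cdist_gt0. Qed.
Lemma cutd_lip x y : `|cutd x - cutd y| <= 1 * `|x - y|.
Proof.
rewrite mul1r; apply: le_trans (cdist_lip x y); rewrite /cutd.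
have [h1|h1] := leP 1 (cdist x); have [h2|h2] := leP 1 (cdist y).
- by rewrite subrr normr0.
- rewrite !ger0_norm; lra.
- rewrite !ler0_norm; lra.
- by [].
Qed.

Lemma lip_continuous (f : V -> R) L : (forall x y, `|f x - f y| <= L * `|x - y|) -> continuous f.
Proof.
move=> fL x; apply/(@cvgrPdist_lt _ _ _ (nbhs x) (@nbhs_filter _ x) f (f x)) => e e0.
have L1 : 0 < `|L| + 1 by rewrite ltr_wpDl.
near=> y; apply: le_lt_trans (fL x y) _.
apply: (@le_lt_trans _ _ ((`|L| + 1) * `|x - y|)).
  by rewrite ler_wpM2r// (le_trans (ler_norm _))// lerDl.
rewrite -ltr_pdivlMl//; near: y; apply/nbhs_ballP.
exists ((`|L| + 1)^-1 * e) => /=; first by rewrite mulr_gt0// invr_gt0.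
by move=> z; rewrite -ball_normE.
Unshelve. all: by end_near. Qed.

Lemma continuous_cutd : continuous cutd. Proof. exact: lip_continuous cutd_lip. Qed.
Lemma measurable_cutd : measurable_fun [set: V] cutd.
Proof. by apply: continuous_measurable_rV; exact: continuous_cutd. Qed.

Lemma cutd_compact (K : set V) : open Omega -> compact K -> K `<=` Omega ->
  exists2 e : R, 0 < e & forall x, K x -> e <= cutd x.
Proof.
move=> oO cK KO; have [->|/set0P K0] := eqVneq K set0; first by exists 1.
have [|c cK' cmin] := @EVT_min_rV R n cutd K K0 cK.
  by apply: continuous_subspaceT; exact: continuous_cutd.
rewrite inE in cK'; exists (cutd c); first by apply: cutd_gt0 => //; exact: KO.
by move=> x Kx; apply: cmin; rewrite inE.
Qed.

End distance.

Section domain.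
Variables (R : realType) (N : nat) (s p : R).
Local Notation mu := (hmu R N).
Local Notation H := (heis R N).
Variable Omega : set H.
Hypotheses (s_gt0 : 0 < s) (s_lt1 : s < 1) (p_gt1 : 1 < p).
Hypotheses (Oopen : open Omega) (Obnd : bounded_set Omega).
Implicit Types (u v w eta : H -> R) (L M C Rr c e : R).

Lemma bounded_radius : exists2 Rr : R, 1 <= Rr & forall x, Omega x -> `|x| <= Rr.
Proof.
have [M [Mr MO]] := Obnd; exists (Num.max 1 (M + 1)); first by rewrite le_max lexx.
move=> x Ox; apply: (MO (Num.max 1 (M + 1))) => //.
by rewrite lt_max ltrDl ltr01 orbT.
Qed.

Lemma compl_nonempty : exists y, ~ Omega y.
Proof.
have [Rr R1 OR] := bounded_radius.
exists (const_mx (Rr + 1)) => /OR; apply/negP; rewrite -ltNge.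
apply: lt_le_trans (mx_norm_coord _ ord_max); rewrite mxE ger0_norm; lra.
Qed.

Lemma measurable_domain : measurable Omega. Proof. exact: open_measurable_rV. Qed.

Lemma hz_domain Rr x : (forall x, Omega x -> `|x| <= Rr) -> Omega x -> forall i, `|hz x i| <= Rr.
Proof. by move=> OR Ox i; apply: le_trans (OR _ Ox); exact: mx_norm_coord. Qed.

Lemma hmu_bounded (A : set H) Rr : measurable A -> (forall x, A x -> `|x| <= Rr) -> (mu A < +oo)%E.
Proof.
move=> mA AR; pose r := Num.max 1 Rr.
have r1 : 1 <= r by rewrite le_max lexx.
have r0 : 0 < r by lra.
apply: (@le_lt_trans _ _ (mu (hcube r))); last by rewrite (hmu_hcube N r0) ltry.
apply: le_measure; rewrite ?inE//; first exact: measurable_hcube.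
move=> x Ax i; rewrite in_itv/= -ler_norml; apply: le_trans (mx_norm_coord _ _) _.
apply: le_trans (AR _ Ax) _; apply: (@le_trans _ _ r); first by rewrite le_max lexx orbT.
by case: ifP => // _; rewrite expr2 ler_peMl// ltW.
Qed.

Lemma hmu_domain : (mu Omega < +oo)%E.
Proof.
by have [Rr _ OR] := bounded_radius; exact: hmu_bounded measurable_domain OR.
Qed.

(** Representatives that vanish at every point off the domain, which spares many
    null sets. By [HW0_rep] every class has one, and membership in L^p is
    automatic by Poincare's inequality. *)
Definition Wsp v := [/\ measurable_fun [set: H] v, forall x, ~ Omega x -> v x = 0 &
  (gagliardo s p v < +oo)%E].

(** [faber_krahn] with a box at least twice as large in measure as the domain. *)
Lemma poincare : exists2 C : R, 0 < C & forall v, measurable_fun [set: H] v ->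
  (forall x, ~ Omega x -> v x = 0) ->
  (\int[mu]_x (pw p (v x))%:E <= C%:E * gagliardo s p v)%E.
Proof.
pose m := fine (mu Omega); have m0 : 0 <= m by exact: fine_ge0.
have mE : mu Omega = m%:E by rewrite /m fineK// ge0_fin_numE// hmu_domain.
(* Any r with r >= 1 and r >= 2 m satisfies 2 m <= r^Q. *)
pose r : R := 1 + 2 * m; have r1 : 1 <= r by rewrite lerDl mulr_ge0.
have r0 : 0 < r by lra.
exists (2 * box_const N s p * r `^ (s * p)).
  by rewrite !mulr_gt0 ?box_const_gt0 ?powR_gt0.
move=> v mv vO; apply: (faber_krahn s_gt0 p_gt1 measurable_domain mv vO r0).
rewrite [leLHS]mE lee_fin ler_pdivlMr// mulrC.
apply: (@le_trans _ _ r); first by rewrite /r lerDr.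
have rn : 1 <= r ^+ (N + N).+1 by exact: exprn_ege1.
by rewrite /hdim exprS ler_peMr// ltW.
Qed.

Lemma Wsp_HW0 v : Wsp v -> HW0 s p Omega v.
Proof.
move=> [mv vO Gv]; split; last by apply: aeW => x; exact: vO.
split => //; rewrite inE/=; apply/andP; split; first by rewrite inE.
rewrite inE/= /finite_norm unlock /Lnorm.
have [C C0 /(_ v mv vO) HC] := poincare.
have : (\int[mu]_x (pw p (v x))%:E < +oo)%E.
  apply: le_lt_trans HC _; rewrite lte_mul_pinfty ?lee_fin ?(ltW C0)//.
by move=> h; apply: poweR_lty; apply: le_lt_trans h.
Qed.

Lemma HW0_rep v : HW0 s p Omega v -> let v' := fun x => v x * \1_Omega x in
  Wsp v' /\ {ae mu, forall x, v x = v' x}.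
Proof.
move=> [[vL Gv] vO] v'.
have mv : measurable_fun [set: H] v by have := sub_Lfun_mfun vL; rewrite inE.
have mv' : measurable_fun [set: H] v'.
  exact: measurable_funM mv (measurable_indic measurable_domain).
have vv' : {ae mu, forall x, v x = v' x}.
  apply: filterS vO => x hx; rewrite /v' indicE.
  by have [xO|xO] := boolP (x \in Omega); [rewrite mulr1|rewrite mulr0 hx// => /mem_set; exact/negP].
split; last exact: vv'.
split; [exact: mv'| |].
  by move=> x xO; rewrite /v' indicE memNset// mulr0.
by rewrite -(gagliardo_ae_eq s p mv mv' vv').
Qed.

Lemma gagliardo_fin w : (gagliardo s p w < +oo)%E -> gagliardo s p w = (fine (gagliardo s p w))%:E.
Proof. by move=> h; rewrite fineK// ge0_fin_numE// gagliardo_ge0. Qed.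

Lemma WspD v w : Wsp v -> Wsp w -> Wsp (fun x => v x + w x).
Proof.
move=> [mv vO Gv] [mw wO Gw]; split; first exact: measurable_funD mv mw.
  by move=> x xO; rewrite vO// wO// addr0.
apply: le_lt_trans (gagliardoD s p_gt1 mv mw) _.
by rewrite (gagliardo_fin Gv) (gagliardo_fin Gw) -EFinD -EFinM ltry.
Qed.

Lemma gagliardo0 : gagliardo s p (fun _ : H => 0 : R) = 0%E.
Proof.
have p0 : p != 0 by rewrite gt_eqF//; have := p_gt1; lra.
rewrite /gagliardo (eq_integral (cst 0%E)) ?integral0// => z _.
by rewrite subrr normr0 powR0// mul0r.
Qed.

Lemma Wsp0 : Wsp (fun=> 0).
Proof.
split; [exact: measurable_cst|by []|].
by rewrite [X in (X < _)%E]gagliardo0 ltry.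
Qed.

Lemma WspZ c v : Wsp v -> Wsp (fun x => c * v x).
Proof.
move=> [mv vO Gv]; split; first exact: measurable_funM (measurable_cst _) mv.
  by move=> x xO; rewrite vO// mulr0.
by rewrite gagliardoZ// (gagliardo_fin Gv) -EFinM ltry.
Qed.

Lemma WspB v w : Wsp v -> Wsp w -> Wsp (fun x => v x - w x).
Proof.
move=> Wv /(WspZ (-1)) Ww; have := WspD Wv Ww.
by congr Wsp; apply/funext => x; rewrite mulN1r.
Qed.

Lemma gagliardo_contraction v w : measurable_fun [set: H] v -> measurable_fun [set: H] w ->
  (forall x y, `|v x - v y| <= `|w x - w y|) -> (gagliardo s p v <= gagliardo s p w)%E.
Proof.
move=> mv mw h; apply: gagliardo_le => // x y; apply: ler_pw; last exact: h.
by have := p_gt1; lra.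
Qed.

Lemma Wsp_contraction (phi : R -> R) v : measurable_fun [set: R] phi -> phi 0 = 0 ->
  (forall a b, `|phi a - phi b| <= `|a - b|) -> Wsp v -> Wsp (fun x => phi (v x)).
Proof.
move=> mphi phi0 phiL [mv vO Gv].
have mpv : measurable_fun [set: H] (fun x => phi (v x)) by exact: measurableT_comp mphi mv.
split; [exact: mpv|by move=> x xO; rewrite vO|].
by apply: le_lt_trans Gv; apply: gagliardo_contraction.
Qed.

Lemma Wsp_lipschitz eta L M : 0 <= L -> 0 <= M ->
  measurable_fun [set: H] eta -> (forall x, `|eta x| <= M) ->
  (forall x y, `|eta x - eta y| <= L * `|x - y|) -> (forall x, ~ Omega x -> eta x = 0) ->
  Wsp eta.
Proof.
move=> L0 M0 meta etaM etaL etaO; split; [exact: meta|exact: etaO|].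
have [Rr R1 OR] := bounded_radius; have R0 : 0 <= Rr by lra.
have [C C0 HC] := lipschitz_dK N s_gt0 s_lt1 p_gt1 L0 M0 R0.
have := HC eta meta etaM etaL Omega measurable_domain (fun x Ox => hz_domain OR Ox).
have mO : (C%:E * mu Omega < +oo)%E.
  by rewrite lte_mul_pinfty ?lee_fin ?(ltW C0)//; exact: hmu_domain.
move=> /le_lt_trans /(_ mO); apply: le_lt_trans.
have mp := measurable_pwdiff p meta.
have mi1 : measurable_fun [set: H * H] (fun z : H * H => \1_Omega z.1 : R).
  exact: (measurableT_comp (measurable_indic measurable_domain) measurable_fst).
have mi2 : measurable_fun [set: H * H] (fun z : H * H => \1_Omega z.2 : R).
  exact: (measurableT_comp (measurable_indic measurable_domain) measurable_snd).
apply: dK_le; [exact: mp|exact: measurable_funM mp (measurable_funD mi1 mi2)| |].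
- by move=> z; exact: pw_ge0.
- move=> [x y] /=; rewrite !indicE.
  have [xO|xO] := boolP (x \in Omega).
    by rewrite ler_peMr ?pw_ge0// lerDl.
  have [yO|yO] := boolP (y \in Omega); first by rewrite /= add0r mulr1.
  rewrite !etaO; [|by move=> /mem_set; exact/negP..].
  have p0 : p != 0 by rewrite gt_eqF//; have := p_gt1; lra.
  by rewrite !subrr normr0 powR0// pw0// mul0r.
Qed.

Lemma Wsp_cutd : Wsp (cutd Omega).
Proof.
have c := compl_nonempty.
apply: (@Wsp_lipschitz _ 1 1) => //.
- exact: measurable_cutd.
- exact: cutd_le1.
- exact: cutd_lip.
- by move=> x; exact: cutd_out.
Qed.

End domain.

(** * Completeness *)

Lemma cvg_fast_cauchy (R : realType) (a : nat -> R) (C : R) :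
  (forall n, `|a n - a n.+1| <= C * 2^-1 ^+ n) -> cvgn a.
Proof.
move=> aC.
have C0 : 0 <= C by have := aC 0%N; rewrite expr0 mulr1; apply: le_trans.
have -> : a = (fun n => a 0%N + series (fun k => a k.+1 - a k) n).
  by apply/funext => n; rewrite /series/= telescope_sumr// addrC subrK.
apply: is_cvgD; first exact: is_cvg_cst.
apply: normed_cvg; apply: (@series_le_cvg _ _ (geometric C 2^-1)) => //.
- by move=> n; exact: normr_ge0.
- by move=> n; rewrite /= mulr_ge0// exprn_ge0// invr_ge0.
- by move=> n /=; rewrite distrC.
- by apply: is_cvg_geometric_series; rewrite gtr0_norm ?invr_gt0// invf_lt1// ltr1n.
Qed.

Section completeness.
Variables (R : realType) (N : nat) (s p : R).
Local Notation mu := (hmu R N).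
Local Notation H := (heis R N).
Variable Omega : set H.
Hypotheses (s_gt0 : 0 < s) (s_lt1 : s < 1) (p_gt1 : 1 < p).
Hypotheses (Oopen : open Omega) (Obnd : bounded_set Omega).
Implicit Types (u v w : H -> R) (V : nat -> H -> R) (k n : nat).

Lemma gagliardo_fatou V u c : (forall n, measurable_fun [set: H] (V n)) ->
  measurable_fun [set: H] u -> {ae mu, forall x, V ^~ x @ \oo --> u x} ->
  (forall n, gagliardo s p (V n) <= c)%E -> (gagliardo s p u <= c)%E.
Proof.
move=> mV mu' Vu Gc.
have mk := @measurable_hkernel R N s p.
apply: (rint_fatou (F := fun n (z : H * H) => pw p (V n z.1 - V n z.2) * hkernel s p z)).
- by move=> n; exact: measurable_funM (measurable_pwdiff p (mV n)) mk.
- exact: measurable_funM (measurable_pwdiff p mu') mk.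
- by move=> n z; rewrite mulr_ge0 ?pw_ge0 ?hkernel_ge0.
- by move=> z; rewrite mulr_ge0 ?powR_ge0 ?hkernel_ge0.
- apply: filterS2 (ae_prod1 mu Vu) (ae_prod2 mu Vu) => z h1 h2.
  apply: cvgMl; apply: (cvg_comp (fun n => V n z.1 - V n z.2) (pw p)); first exact: cvgB h1 h2.
  by apply: continuous_pw; have := p_gt1; lra.
- exact: Gc.
Qed.

(** Once multiplied by 2^(n p), a bound of this form on energies is summable; by
    Poincare's inequality successive differences then decay like 2^-n at almost
    every point. *)
Definition rate (c : R) n : R := c * (2^-1 ^+ n * (2^-1 ^+ n) `^ p).

Lemma rate_gt0 c n : 0 < c -> 0 < rate c n.
Proof. by move=> c0; rewrite !mulr_gt0 ?powR_gt0 ?exprn_gt0 ?invr_gt0. Qed.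

Lemma rate_le c n : 0 < c -> rate c n <= c * 2^-1 ^+ n.
Proof.
move=> c0; rewrite ler_pM2l// ler_piMr ?exprn_ge0 ?invr_ge0//.
apply: (@le_trans _ _ (1 `^ p)); last by rewrite powR1.
rewrite ge0_ler_powR ?nnegrE ?exprn_ge0 ?invr_ge0//; first by have := p_gt1; lra.
by rewrite exprn_ile1 ?invr_ge0// invf_le1// ler1n.
Qed.

(** The rate makes the sequence converge almost everywhere, and Fatou's lemma
    shows that the pointwise limit is also the limit in the seminorm. *)
Lemma Wsp_complete : exists2 c : R, 0 < c & forall V,
  (forall n, Wsp s p Omega (V n)) -> (forall n x, 0 <= V n x) ->
  (forall n k, (n <= k)%N -> gagliardo s p (fun x => V n x - V k x)%R <= (rate c n)%:E)%E ->
  exists u, [/\ Wsp s p Omega u, forall x, 0 <= u x,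
    {ae mu, forall x, V ^~ x @ \oo --> u x} &
    forall n, (gagliardo s p (fun x => V n x - u x)%R <= (rate c n)%:E)%E].
Proof.
have [CP CP0 HP] := poincare s_gt0 p_gt1 Oopen Obnd.
exists CP^-1 => [|V WV V0 GV]; first by rewrite invr_gt0.
have mV n : measurable_fun [set: H] (V n) by case: (WV n).
have mD n k : measurable_fun [set: H] (fun x => V n x - V k x).
  exact: measurable_funB (mV n) (mV k).
have pp : 0 < p by have := p_gt1; lra.
have bdd : {ae mu, forall x, exists C : R, forall n, pw p (2 ^+ n * (V n x - V n.+1 x)) <= C}.
  have mpw n : measurable_fun [set: H] (fun x => pw p (V n x - V n.+1 x)).
    exact: (measurableT_comp (@measurable_pw R p) (mD n n.+1)).
  apply: (rint_ae_bounded (F := fun n x => pw p (2 ^+ n * (V n x - V n.+1 x)))).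
  - move=> n; apply: (measurableT_comp (@measurable_pw R p)).
    exact: measurable_funM (measurable_cst _) (mD n n.+1).
  - by move=> n x; exact: pw_ge0.
  - move=> n; under eq_integral do rewrite pwM.
    rewrite (rintZ mu (mpw n) (pw_ge0 p _) (fun x => pw_ge0 p _)).
    have dO x : ~ Omega x -> V n x - V n.+1 x = 0.
      by move=> xO; case: (WV n) => _ -> // _; case: (WV n.+1) => _ -> // _; rewrite subrr.
    apply: le_trans (lee_wpmul2l _ (HP _ (mD n n.+1) dO)) _; first by rewrite lee_fin pw_ge0.
    apply: le_trans (lee_wpmul2l _ (lee_wpmul2l _ (GV n n.+1 (leqnSn n)))) _.
    + by rewrite lee_fin pw_ge0.
    + by rewrite lee_fin ltW.
    rewrite -!EFinM lee_fin /rate [CP * _]mulrA mulfV ?gt_eqF// mul1r.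
    rewrite mulrCA pw_ger0 ?exprn_ge0// -powRM ?exprn_ge0 ?invr_ge0//.
    by rewrite -exprMn mulfV ?gt_eqF// expr1n powR1 mulr1.
have cvgV : {ae mu, forall x, cvgn (V ^~ x)}.
  apply: filterS bdd => x [C HC].
  apply: (@cvg_fast_cauchy _ _ (C `^ p^-1)) => n.
  have C0 : 0 <= C by apply: le_trans (HC 0%N); exact: pw_ge0.
  have h2 : 0 < 2 ^+ n :> R by rewrite exprn_gt0.
  rewrite exprVn ler_pdivlMr// mulrC.
  rewrite -[X in X * _ <= _](gtr0_norm h2) -normrM.
  have -> : `|2 ^+ n * (V n x - V n.+1 x)| = pw p (2 ^+ n * (V n x - V n.+1 x)) `^ p^-1.
    by rewrite /pw -powRrM mulfV ?gt_eqF// powRr1.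
  by rewrite ge0_ler_powR ?nnegrE ?invr_ge0 ?pw_ge0// ltW.
(* The upper limit is measurable and equals the limit almost everywhere; u is
   then made nonnegative, and zero off the domain, at every point. *)
pose u0 x := fine (limn_esup (fun n => (V n x)%:E)).
have mu0 : measurable_fun [set: H] u0.
  apply: (measurableT_comp (@fine_measurable R setT measurableT)).
  apply: measurable_fun_limn_esup => n; exact/measurable_EFinP.
pose u x := Num.max 0 (u0 x) * \1_Omega x.
have mu1 : measurable_fun [set: H] u.
  apply: measurable_funM; last exact: measurable_indic (measurable_domain Oopen).
  exact: measurable_maxr (measurable_cst _) mu0.
have uO x : ~ Omega x -> u x = 0 by move=> xO; rewrite /u indicE memNset// mulr0.
have Vu : {ae mu, forall x, V ^~ x @ \oo --> u x}.
  apply: filterS cvgV => x Vx; have [xO|xO] := pselect (Omega x); last first.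
    rewrite uO// (_ : V ^~ x = fun=> 0); first exact: cvg_cst.
    by apply/funext => n; case: (WV n) => _ -> // _.
  rewrite /u indicE mem_set// mulr1.
  have e : u0 x = limn (V ^~ x).
    have : (fun n => (V n x)%:E) @ \oo --> (limn (V ^~ x))%:E by apply: cvg_EFin => //; exact: nearW.
    by rewrite /u0 => /cvg_limn_einf_sup[_ ->].
  rewrite e max_r; first exact: Vx.
  by apply: limr_ge => //; apply: nearW => n; exact: V0.
exists u.
have GVu n : (gagliardo s p (fun x => V n x - u x)%R <= (rate CP^-1 n)%:E)%E.
  apply: (gagliardo_fatou (V := fun k x => V n x - V (k + n)%N x)).
  - by move=> k; exact: mD.
  - exact: measurable_funB (mV n) mu1.
  - apply: filterS Vu => x Vx; apply: cvgB; first exact: cvg_cst.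
    by rewrite (cvg_shiftn n (V ^~ x)).
  - by move=> k; apply: GV; exact: leq_addl.
split => //.
- split; [exact: mu1|exact: uO|].
  have mVu : measurable_fun [set: H] (fun x => u x - V 0%N x) by exact: measurable_funB mu1 (mV 0%N).
  have e : u = (fun x => V 0%N x + (u x - V 0%N x)) by apply/funext => x; rewrite addrC subrK.
  rewrite e; apply: le_lt_trans (gagliardoD s p_gt1 (mV 0%N) mVu) _.
  have G0 : (gagliardo s p (V 0%N) < +oo)%E by case: (WV 0%N).
  have G1 : (gagliardo s p (fun x => u x - V 0%N x)%R < +oo)%E.
    apply: le_lt_trans (_ : (_ <= (rate CP^-1 0)%:E)%E) _; last exact: ltry.
    apply: le_trans (GVu 0%N); apply: gagliardo_contraction => //.
      exact: measurable_funB (mV 0%N) mu1.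
    move=> x y; rewrite -normrN; rewrite le_eqVlt; apply/orP; left; apply/eqP; congr `|_|; ring.
  by rewrite (gagliardo_fin G0) (gagliardo_fin G1) -EFinD -EFinM ltry.
- by move=> x; rewrite mulr_ge0// le_max lexx.
Qed.

End completeness.

Local Opaque gagliardo.

Section linear_steps.
Variable R : realType.
Implicit Types a b c d e k t : R.

Lemma lin_uniform e k a b c d : a + k * b <= (e + k / 2) * (c + d) ->
  a <= e * (c + d) + k * ((c + d) / 2 - b).
Proof. lra. Qed.

Lemma lin_bound iota t A a b c : iota <= c -> b - A <= a -> a <= iota + t -> t <= 1 ->
  b <= c + 1 + A.
Proof. lra. Qed.

Lemma lin_defect iota t a1 a2 a3 a4 a5 a6 : iota <= a4 - a1 -> a5 - a2 <= iota + t ->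
  a6 - a3 <= iota + t -> (a2 + a3) / 2 <= a1 -> (a5 + a6) / 2 - t <= a4.
Proof. lra. Qed.

Lemma lin_gV iota d a1 a2 a3 a4 : a1 - a2 <= iota + a3 -> a3 <= d -> a2 <= a4 ->
  a1 <= iota + d + a4.
Proof. lra. Qed.

Lemma lin_final iota d e a1 a2 a3 : a1 <= iota + d + (a2 + a3) -> d + a3 = e ->
  a1 - a2 <= iota + e.
Proof. lra. Qed.

Lemma lin_scale q a b c t : 0 < q -> (a / q + b / q) / 2 - t <= c / q ->
  (a + b) / 2 - c <= q * t.
Proof.
move=> q0 h; have := ler_wpM2l (ltW q0) h.
have -> : q * ((a / q + b / q) / 2 - t) = (a + b) / 2 - q * t by field; rewrite gt_eqF.
have -> : q * (c / q) = c by rewrite mulrCA divff ?mulr1// gt_eqF.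
lra.
Qed.

End linear_steps.

(** * The minimiser *)

Section minimizer.
Variables (R : realType) (N : nat) (s p m : R).
Local Notation mu := (hmu R N).
Local Notation H := (heis R N).
Variables (Omega : set H) (f : H -> R).
Hypotheses (s_gt0 : 0 < s) (s_lt1 : s < 1) (p_gt1 : 1 < p).
Hypotheses (m_gt0 : 0 < m) (m_lt1 : m < 1).
Hypotheses (Oopen : open Omega) (Obnd : bounded_set Omega).
Hypotheses (mf : measurable_fun [set: H] f) (f_ge0 : forall x, 0 <= f x)
  (f_out : forall x, ~ Omega x -> f x = 0) (f_neq0 : ~ {ae mu, forall x, f x = 0}).
Implicit Types (u v w : H -> R) (V : nat -> H -> R) (e t c : R).

(** The functional whose derivative is m f u^(m-1), the right-hand side of the
    equation up to the factor m. *)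
Definition Fi v : \bar R := (\int[mu]_x (pw m (v x) * f x)%:E)%E.

Lemma measurable_Fi v : measurable_fun [set: H] v ->
  measurable_fun [set: H] (fun x => pw m (v x) * f x).
Proof.
by move=> mv; exact: measurable_funM (measurableT_comp (@measurable_pw R m) mv) mf.
Qed.

Lemma Fi_integrand_ge0 v x : 0 <= pw m (v x) * f x.
Proof. by rewrite mulr_ge0// pw_ge0. Qed.

Lemma Fi_ge0 v : (0 <= Fi v)%E.
Proof. by apply: rint_ge0 => x; exact: Fi_integrand_ge0. Qed.

Variable C1 : R.
Hypotheses (C1_gt0 : 0 < C1)
  (HI : forall v, Wsp s p Omega v -> (C1%:E * Fi v `^ (p / m) <= gagliardo s p v)%E).

Let pp : 0 < p. Proof. by have := p_gt1; lra. Qed.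
Let pm0 : 0 < p / m. Proof. by rewrite divr_gt0. Qed.

Let g v := fine (gagliardo s p v).
Let phi v := fine (Fi v).
Let W v := Wsp s p Omega v.

Lemma Fi_fin v : W v -> Fi v = (phi v)%:E.
Proof.
move=> Wv; have := HI Wv; have Gf : (gagliardo s p v < +oo)%E by case: Wv.
rewrite (gagliardo_fin Gf) /phi; have := Fi_ge0 v; case: (Fi v) => [r| |]//= _.
by rewrite (gt_eqF pm0) gt0_muley ?lte_fin.
Qed.

Let gE v : W v -> gagliardo s p v = (g v)%:E.
Proof. by move=> [_ _]; exact: gagliardo_fin. Qed.

Let g_ge0 v : 0 <= g v. Proof. by apply: fine_ge0; exact: gagliardo_ge0. Qed.
Let phi_ge0 v : 0 <= phi v. Proof. by apply: fine_ge0; exact: Fi_ge0. Qed.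

Lemma HI_fin v : W v -> C1 * phi v `^ (p / m) <= g v.
Proof. by move=> Wv; have := HI Wv; rewrite (Fi_fin Wv) (gE Wv) -EFinM lee_fin. Qed.

Let K v := W v /\ forall x, 0 <= v x.
Let I v := g v / p - phi v / m.

(** By [HI] the concave term grows at most like the power m / p < 1 of the
    energy, and half of the energy absorbs it. *)
Lemma coercive : exists2 A : R, 0 < A & forall v, W v -> g v / (2 * p) - A <= I v.
Proof.
have mp : 0 < m / p < 1.
  by rewrite divr_gt0//= ltr_pdivrMr// mul1r (lt_trans m_lt1).
have th : 0 < m * C1 / (2 * p) by rewrite !mulr_gt0// invr_gt0 mulr_gt0.
have [A A0 HA] := powR_le_affine (andP mp).1 (andP mp).2 th.
exists (A / m) => [|v Wv]; first by rewrite divr_gt0.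
have := HA (phi v) (phi_ge0 v); rewrite invf_div => h1.
have h2 := HI_fin Wv.
have h3 : phi v <= A + m / (2 * p) * g v.
  apply: le_trans h1 _; rewrite lerD2l.
  have -> : m * C1 / (2 * p) * phi v `^ (p / m) = m / (2 * p) * (C1 * phi v `^ (p / m)).
    by field; rewrite gt_eqF.
  apply: ler_wpM2l; last exact: h2.
  by rewrite divr_ge0 ?mulr_ge0// ltW.
have h4 : phi v / m <= A / m + g v / (2 * p).
  rewrite ler_pdivrMr//; apply: le_trans h3 _.
  rewrite le_eqVlt; apply/orP; left; apply/eqP; field; rewrite ?gt_eqF//.
have e : g v / p = g v / (2 * p) + g v / (2 * p) by field; rewrite gt_eqF.
rewrite /I e; move: h4; move: (g v / (2 * p)) (phi v / m) (A / m) => a1 a2 a3; lra.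
Qed.

Let K0 : K (fun=> 0).
Proof. by split; [exact: Wsp0|move=> x]. Qed.

Let Kmid v w : K v -> K w -> K (fun x => 2^-1 * (v x + w x)).
Proof.
move=> [Wv v0] [Ww w0]; split; first exact: (WspZ _ (WspD p_gt1 Wv Ww)).
by move=> x; rewrite mulr_ge0// ?invr_ge0// addr_ge0.
Qed.

Let phi_mid v w : K v -> K w -> (phi v + phi w) / 2 <= phi (fun x => 2^-1 * (v x + w x)).
Proof.
move=> Kv Kw; have [Wz z0] := Kmid Kv Kw; case: Kv => Wv v0; case: Kw => Ww w0.
have [mv _ _] := Wv; have [mw _ _] := Ww; have [mz _ _] := Wz.
have h : ((2^-1)%:E * (Fi v + Fi w) <= Fi (fun x => 2^-1 * (v x + w x))%R)%E.
  rewrite /Fi -(rintD mu (measurable_Fi mv) (measurable_Fi mw) (Fi_integrand_ge0 v) (Fi_integrand_ge0 w)).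
  have mvw : measurable_fun [set: H] (fun x => pw m (v x) * f x + pw m (w x) * f x) :=
    measurable_funD (measurable_Fi mv) (measurable_Fi mw).
  have vw0 x : 0 <= pw m (v x) * f x + pw m (w x) * f x by rewrite addr_ge0 ?Fi_integrand_ge0.
  have h0 : 0 <= 2^-1 :> R by rewrite invr_ge0.
  rewrite -(rintZ mu mvw h0 vw0); apply: rint_le.
  - exact: measurable_funM (measurable_cst _) mvw.
  - exact: measurable_Fi.
  - by move=> x; rewrite mulr_ge0.
  - move=> x; rewrite -mulrDl mulrA ler_wpM2r// !pw_ger0 ?z0//.
    by rewrite ![2^-1 * _]mulrC; exact: powR_concave_mid.
move: h; rewrite (Fi_fin Wv) (Fi_fin Ww) (Fi_fin Wz) -EFinD -EFinM lee_fin.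
by rewrite mulrC.
Qed.

Let uniform_g e : 0 < e -> exists2 k : R, 0 < k & forall v w, W v -> W w ->
  g (fun x => v x - w x) <= e * (g v + g w) + k * ((g v + g w) / 2 - g (fun x => 2^-1 * (v x + w x))).
Proof.
move=> e0; have [k k0 Hk] := pw_uniform_convex p_gt1 e0.
exists k; [exact: k0|move=> v w Wv Ww].
have Wz : W (fun x => 2^-1 * (v x + w x)) := WspZ _ (WspD p_gt1 Wv Ww).
have Wd : W (fun x => v x - w x) := WspB p_gt1 Wv Ww.
have [mv _ _] := Wv; have [mw _ _] := Ww; have [mz _ _] := Wz; have [md _ _] := Wd.
have Mv := measurable_pwdiff p mv; have Mw := measurable_pwdiff p mw.
have Mz := measurable_pwdiff p mz; have Md := measurable_pwdiff p md.
have P v' (z : H * H) : 0 <= pw p (v' z.1 - v' z.2) by exact: pw_ge0.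
have ek0 : 0 <= e + k / 2 by rewrite addr_ge0 ?divr_ge0 ?ltW.
have h : (gagliardo s p (fun x => v x - w x)%R + k%:E * gagliardo s p (fun x => 2^-1 * (v x + w x))%R
   <= (e + k / 2)%:E * (gagliardo s p v + gagliardo s p w))%E.
  have Mkz : measurable_fun [set: H * H]
      (fun z : H * H => k * pw p (2^-1 * (v z.1 + w z.1) - 2^-1 * (v z.2 + w z.2))) :=
    measurable_funM (measurable_cst _) Mz.
  have Mvw : measurable_fun [set: H * H] (fun z : H * H => pw p (v z.1 - v z.2) + pw p (w z.1 - w z.2)) :=
    measurable_funD Mv Mw.
  have Pkz (z : H * H) : 0 <= k * pw p (2^-1 * (v z.1 + w z.1) - 2^-1 * (v z.2 + w z.2)).
    by rewrite mulr_ge0 ?pw_ge0// ltW.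
  have Pvw (z : H * H) : 0 <= pw p (v z.1 - v z.2) + pw p (w z.1 - w z.2) by rewrite addr_ge0 ?pw_ge0.
  have E1 := dKZ s p Mz (ltW k0) (P (fun x => 2^-1 * (v x + w x))).
  have E2 := dKD s p Md Mkz (P (fun x => v x - w x)) Pkz.
  have E3 := dKZ s p Mvw ek0 Pvw.
  have E4 := dKD s p Mv Mw (P v) (P w).
  rewrite ![gagliardo _ _ _]gagliardoE -E1 -E2 -E4 -E3; apply: dK_le.
  - exact: measurable_funD Md Mkz.
  - exact: measurable_funM (measurable_cst _) Mvw.
  - by move=> z; rewrite addr_ge0 ?pw_ge0.
  - move=> z; set a := v z.1 - v z.2; set b := w z.1 - w z.2.
    have := Hk a b.
    have -> : v z.1 - w z.1 - (v z.2 - w z.2) = a - b by rewrite /a /b; ring.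
    have -> : 2^-1 * (v z.1 + w z.1) - 2^-1 * (v z.2 + w z.2) = (a + b) / 2 by rewrite /a /b; field.
    lra.
move: h; rewrite (gE Wd) (gE Wz) (gE Wv) (gE Ww) => h.
have {}h : g (fun x => v x - w x) + k * g (fun x => 2^-1 * (v x + w x)) <= (e + k / 2) * (g v + g w).
  by rewrite -lee_fin.
move: h; exact: lin_uniform.
Qed.

Let inf_exists : exists iota : R, (forall v, K v -> iota <= I v) /\
  forall e, 0 < e -> exists2 v, K v & I v <= iota + e.
Proof.
have [A A0 HA] := coercive.
pose S := [set r | exists2 v, K v & r = I v].
have S0 : S !=set0 by exists (I (fun=> 0)); exists (fun=> 0); [exact: K0|by []].
have lbS : has_lbound S.
  exists (- A) => _ [v [Wv _] ->]; apply: le_trans (HA v Wv).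
  by rewrite -[leLHS]add0r lerD2r divr_ge0// mulr_ge0// ltW.
have hS : has_inf S by split.
exists (inf S); split=> [v Kv|e e0].
  by apply: ge_inf; [exact: lbS|exists v; [exact: Kv|by []]].
by have [_ [v Kv ->] h] := inf_adherent e0 hS; exists v; [exact: Kv|exact: ltW].
Qed.

(** The direct method, with uniform convexity in place of weak compactness:
    almost minimisers are close to each other in the seminorm, so a fast
    minimising sequence converges almost everywhere. Fatou's lemma passes to the
    limit in the energy; in the concave term it is subadditivity of t^m together
    with [HI]. *)
Lemma minimizer : exists u, [/\ W u, forall x, 0 <= u x,
  ~ {ae mu, forall x, u x = 0} & forall v, W v -> (forall x, 0 <= v x) -> I u <= I v].
Proof.
have [A A0 HA] := coercive.
have [iota [iota_le iota_inf]] := inf_exists.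
have [c c0 complete] := Wsp_complete s_gt0 p_gt1 Oopen Obnd.
(* The midpoint of v and w is not below iota, and the concave term does not drop
   there, so the convexity gap of the energy is at most p t; the energies
   themselves are at most B by coercivity. *)
have close e : 0 < e -> exists2 t : R, 0 < t & forall v w, K v -> K w ->
    I v <= iota + t -> I w <= iota + t -> g (fun x => v x - w x) <= e.
  move=> e0; pose B := 2 * p * (`|iota| + 1 + A).
  have B0 : 0 < B by rewrite !mulr_gt0//; have := normr_ge0 iota; lra.
  have e1 : 0 < e / (4 * B) by rewrite divr_gt0// mulr_gt0.
  have [k k0 Hk] := uniform_g e1.
  exists (Num.min 1 (e / (2 * (k * p)))) => [|v w Kv Kw Iv Iw].
    by rewrite lt_min ltr01 divr_gt0 ?mulr_gt0.
  set t := Num.min _ _ in Iv Iw.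
  have t1 : t <= 1 by rewrite ge_min lexx.
  have t2 : t <= e / (2 * (k * p)) by rewrite ge_min lexx orbT.
  have gB v' : K v' -> I v' <= iota + t -> g v' <= B.
    move=> [Wv' _] Iv'; have h2 := HA _ Wv'; have h1 := ler_norm iota.
    rewrite /B mulrC -ler_pdivrMr ?mulr_gt0//.
    move: h1 h2 Iv' t1; move: (I v') (g v' / (2 * p)) `|iota| => a b c'.
    exact: lin_bound.
  have Iz := iota_le _ (Kmid Kv Kw); have fz := phi_mid Kv Kw.
  have := Hk v w Kv.1 Kw.1; set gz := g (fun x => 2^-1 * (v x + w x)).
  have dz : (g v + g w) / 2 - gz <= p * t.
    have h : (g v / p + g w / p) / 2 - t <= gz / p.
      have fm : (phi v / m + phi w / m) / 2 <= phi (fun x => 2^-1 * (v x + w x)) / m.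
        by rewrite -mulrDl mulrAC ler_wpM2r// invr_ge0 ltW.
      move: Iz Iv Iw fm; rewrite /I -/gz.
      by move=> q1 q2 q3 q4; exact: (lin_defect q1 q2 q3 q4).
    exact: (lin_scale pp h).
  have h1 := gB v Kv Iv; have h2 := gB w Kw Iw.
  move=> /le_trans; apply.
  have a1 : e / (4 * B) * (g v + g w) <= e / 2.
    apply: (@le_trans _ _ (e / (4 * B) * (B + B))); first by rewrite ler_wpM2l ?lerD// ltW.
    by rewrite le_eqVlt; apply/orP; left; apply/eqP; field; rewrite gt_eqF.
  have a2 : k * ((g v + g w) / 2 - gz) <= e / 2.
    apply: (@le_trans _ _ (k * (p * (e / (2 * (k * p)))))).
      rewrite ler_wpM2l ?(ltW k0)//; apply: le_trans dz _; by rewrite ler_wpM2l// ltW.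
    by rewrite le_eqVlt; apply/orP; left; apply/eqP; field; rewrite !gt_eqF.
  by rewrite [leRHS]splitr lerD.
(* T n is at most tau 0, ..., tau n, so that two terms of index at least n are
   within the reach of tau n. *)
have /boolp.choice[tau tauP] : forall n, exists t : R, 0 < t /\ forall v w, K v -> K w ->
    I v <= iota + t -> I w <= iota + t -> g (fun x => v x - w x) <= rate p c n.
  by move=> n; have [t t0 ht] := close _ (rate_gt0 p n c0); exists t; split; [exact: t0|exact: ht].
pose T n : R := \big[Num.min/2^-1 ^+ n]_(i < n.+1) tau i.
have T0 n : 0 < T n.
  rewrite /T; elim/big_ind : _ => [|x y x0 y0|i _]; first by rewrite exprn_gt0// invr_gt0.
    by rewrite lt_min x0.
  exact: (tauP i).1.
have Ttau n k : (n <= k)%N -> T k <= tau n.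
  move=> nk; have nk' : (n < k.+1)%N by [].
  exact: (@bigmin_le _ R _ (2^-1 ^+ k) (Ordinal nk') (fun i : 'I_k.+1 => tau i)).
have Thalf n : T n <= 2^-1 ^+ n by exact: bigmin_le_id.
have /boolp.choice[V VP] : forall n, exists v, K v /\ I v <= iota + T n.
  by move=> n; have [v Kv Iv] := iota_inf _ (T0 n); exists v; split; [exact: Kv|exact: Iv].
have WV n : W (V n) by exact: (VP n).1.1.
have V0 n x : 0 <= V n x by exact: (VP n).1.2.
have GV n k : (n <= k)%N -> (gagliardo s p (fun x => V n x - V k x)%R <= (rate p c n)%:E)%E.
  move=> nk; rewrite (gE (WspB p_gt1 (WV n) (WV k))) lee_fin.
  apply: (tauP n).2; [exact: (VP n).1|exact: (VP k).1| |].
    by apply: le_trans (VP n).2 _; rewrite lerD2l Ttau.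
  by apply: le_trans (VP k).2 _; rewrite lerD2l Ttau.
have [u [Wu u0 Vu GVu]] := complete V WV V0 GV.
have Ku : K u := conj Wu u0.
have u_min : I u <= iota.
  apply/ler_addgt0Pr => e e0.
  have e1 : 0 < e / (1 + m^-1) by rewrite divr_gt0// addr_gt0// invr_gt0.
  set d := e / (1 + m^-1) in e1.
  (* The second term makes the concave term of V n - u at most d, by HI. *)
  pose b := Num.min d (C1 * d `^ (p / m) / c).
  have b0 : 0 < b by rewrite lt_min e1 !divr_gt0// mulr_gt0// powR_gt0.
  have [k hk] := half_pow_lt b0.
  have small n : (k <= n)%N -> 2^-1 ^+ n < b.
    move=> kn; apply: le_lt_trans hk; apply: ler_wiXn2l => //; rewrite ?invr_ge0//.
    by rewrite invf_le1// ler1n.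
  have phiV n : (k <= n)%N -> phi (V n) <= phi u + d.
    move=> kn; have Wd : W (fun x => V n x - u x) := WspB p_gt1 (WV n) Wu.
    have sub : phi (V n) <= phi u + phi (fun x => V n x - u x).
      suff : (Fi (V n) <= Fi u + Fi (fun x => V n x - u x)%R)%E.
        by rewrite (Fi_fin (WV n)) (Fi_fin Wu) (Fi_fin Wd) -EFinD lee_fin.
      have [mVn _ _] := WV n; have [mu1 _ _] := Wu; have [md _ _] := Wd.
      rewrite /Fi -(rintD mu (measurable_Fi mu1) (measurable_Fi md) (Fi_integrand_ge0 u) (Fi_integrand_ge0 _)).
      apply: rint_le; [exact: measurable_Fi|exact: measurable_funD (measurable_Fi mu1) (measurable_Fi md)|by move=> x; exact: Fi_integrand_ge0|].
      move=> x; rewrite -mulrDl ler_wpM2r//.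
      rewrite /pw; apply: le_trans (powR_subadd m_gt0 m_lt1 (normr_ge0 _) (normr_ge0 _)).
      rewrite ge0_ler_powR ?nnegrE ?addr_ge0 ?(ltW m_gt0)//.
      by rewrite -{1}(subrK (u x) (V n x)) addrC ler_normD.
    apply: le_trans sub _; rewrite lerD2l.
    have h1 := HI_fin Wd.
    have h2 : g (fun x => V n x - u x) <= c * 2^-1 ^+ n.
      apply: le_trans (rate_le p_gt1 n c0); have := GVu n; rewrite (gE Wd) lee_fin; exact.
    have h3 : c * 2^-1 ^+ n <= C1 * d `^ (p / m).
      rewrite mulrC -ler_pdivlMr//; apply: le_trans (ltW (small n kn)) _.
      by rewrite /b ge_min lexx orbT.
    have := le_trans h1 (le_trans h2 h3); rewrite ler_pM2l// => h4.
    rewrite leNgt; apply/negP => h5; move: h4; apply/negP; rewrite -ltNge.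
    by apply: (gt0_ltr_powR pm0) h5; rewrite nnegrE; [exact: ltW|exact: phi_ge0].
  have gV n : (k <= n)%N -> g (V n) <= p * (iota + d + (phi u + d) / m).
    move=> kn; have := (VP n).2; rewrite /I => h1; have h2 := phiV n kn.
    have h3 : T n <= d by apply: le_trans (Thalf n) _; apply: le_trans (ltW (small n kn)) _; rewrite /b ge_min lexx.
    have h4 : phi (V n) / m <= (phi u + d) / m by rewrite ler_wpM2r// invr_ge0 ltW.
    rewrite mulrC -ler_pdivrMr//.
    exact: (lin_gV h1 h3 h4).
  have gu : g u <= p * (iota + d + (phi u + d) / m).
    suff : (gagliardo s p u <= (p * (iota + d + (phi u + d) / m))%:E)%E by rewrite (gE Wu) lee_fin.
    apply: (gagliardo_fatou p_gt1 (V := fun n => V (n + k)%N)).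
    - by move=> n; case: (WV (n + k)%N).
    - by case: Wu.
    - by apply: filterS Vu => x Vx; rewrite (cvg_shiftn k (V ^~ x)).
    - by move=> n; rewrite (gE (WV _)) lee_fin; apply: gV; exact: leq_addl.
  rewrite /I; have : g u / p <= iota + d + (phi u + d) / m.
    by rewrite ler_pdivrMr// mulrC.
  have : d + d / m = e by rewrite -[X in X + _]mulr1 -mulrDr /d divfK// gt_eqF// addr_gt0// invr_gt0.
  by rewrite mulrDl => q1 q2; exact: (lin_final q2 q1).
exists u; split; [exact: Wu|exact: u0| |by move=> v Wv v0; apply: le_trans u_min _; exact: iota_le].
(* If u vanished, the minimum would be 0; but t^m (b t^(p-m) - a), the value of I
   at t eta, is negative for small t, because m < p. *)
move=> uae; have [mu1 _ _] := Wu.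
have Wz := K0.1; have [mz _ _] := Wz.
have Iu0 : I u = 0.
  have g0 : g u = 0.
    by rewrite /g (gagliardo_ae_eq s p mu1 mz uae) gagliardo0.
  have p0 : phi u = 0.
    rewrite /phi /Fi (rint_ae_eq (measurable_Fi mu1) (measurable_Fi mz)).
      rewrite (eq_integral (cst 0%E)) ?integral0// => x _.
      by rewrite pw0 ?mul0r// gt_eqF.
    by apply: filterS uae => x ->.
  by rewrite /I g0 p0 !mul0r subrr.
have Weta := Wsp_cutd s_gt0 s_lt1 p_gt1 Oopen Obnd.
have cO := compl_nonempty Obnd.
pose eta := cutd Omega; have [me _ _] := Weta.
have phi0 : 0 < phi eta.
  rewrite lt_neqAle phi_ge0 andbT eq_sym; apply/eqP => e0; apply: f_neq0.
  have := rint_eq0 (mu := mu) (measurable_Fi me) (Fi_integrand_ge0 eta).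
  rewrite -/(Fi eta) (Fi_fin Weta) e0 => /(_ (lexx _)); apply: filterS => x.
  have [xO|xO] := pselect (Omega x); last by move=> _; exact: f_out.
  move=> /eqP; rewrite mulf_eq0 => /orP[|/eqP//].
  by rewrite gt_eqF// pw_gt0// gt_eqF//; apply: cutd_gt0.
pose a := phi eta / m; pose b := g eta / p.
have a0 : 0 < a by rewrite divr_gt0.
have b0 : 0 <= b by rewrite divr_ge0// ltW.
have pm : 0 < p - m by rewrite subr_gt0 (lt_trans m_lt1).
have ab : 0 < a / (b + 1) by rewrite divr_gt0// ltr_wpDl.
pose t := (a / (b + 1)) `^ (p - m)^-1.
have t0 : 0 < t by rewrite powR_gt0.
have tpm : t `^ (p - m) = a / (b + 1) by rewrite /t -powRrM mulVf ?gt_eqF// powRr1// ltW.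
have Wt := WspZ t Weta.
have ga : g (fun x => t * eta x) = t `^ p * g eta.
  by rewrite /g gagliardoZ// (gE Weta) -EFinM /= (pw_ger0 _ (ltW t0)).
have pa : phi (fun x => t * eta x) = t `^ m * phi eta.
  rewrite /phi /Fi; under eq_integral do rewrite pwM -mulrA.
  rewrite (rintZ mu (measurable_Fi me) (pw_ge0 m t) (Fi_integrand_ge0 eta)) -/(Fi eta) (Fi_fin Weta) -EFinM /=.
  by rewrite (pw_ger0 _ (ltW t0)).
have : I u <= I (fun x => t * eta x).
  apply: le_trans u_min _; apply: iota_le; split; [exact: Wt|move=> x].
  by rewrite mulr_ge0 ?(ltW t0)// cutd_ge0.
rewrite Iu0 /I ga pa -!mulrA -/a -/b.
have -> : t `^ p = t `^ m * t `^ (p - m).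
  by rewrite -powRD ?(gt_eqF t0) ?implybT//; congr (_ `^ _); ring.
rewrite tpm -mulrA -mulrBr pmulr_rge0 ?powR_gt0// subr_ge0 => h.
have : a * (b / (b + 1)) < a.
  by rewrite gtr_pMr// ltr_pdivrMr ?ltr_wpDl// mul1r ltrDl.
by rewrite mulrCA mulrA [b * a]mulrC -mulrA ltNge; move: h; rewrite mulrAC -mulrA => ->.
Qed.

End minimizer.

Section source_lemmas.
Variable R : realType.
Implicit Types a b c A X Y : R.

Lemma max0_contraction c a b : `|Num.max 0 (a - c) - Num.max 0 (b - c)| <= `|a - b|.
Proof.
have [h1|h1] := leP 0 (a - c); have [h2|h2] := leP 0 (b - c).
- by rewrite (_ : a - c - (b - c) = a - b)//; ring.
- by rewrite subr0 !ger0_norm; lra.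
- by rewrite sub0r normrN ger0_norm// ler0_norm; lra.
- by rewrite subrr normr0.
Qed.

Lemma degiorgi_scaling A X Y a b : 0 < a -> 0 < b ->
  (a * b)^-1 * (A * (Y * b) * (X / 2)) = X * (A / a * Y) / 2.
Proof. by move=> a0 b0; field; rewrite !gt_eqF. Qed.
End source_lemmas.

(** * Positivity and local lower bounds of supersolutions *)

Section supersolution.
Variables (R : realType) (N : nat) (s p : R).
Local Notation Q := (hdim N).
Local Notation mu := (hmu R N).
Local Notation H := (heis R N).
Variable Omega : set H.
Hypotheses (s_gt0 : 0 < s) (s_lt1 : s < 1) (p_gt1 : 1 < p).
Hypotheses (Oopen : open Omega) (Obnd : bounded_set Omega).
Implicit Types (v w phi : H -> R) (e t c k sg M : R).
Variable u : H -> R.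
Hypotheses (Wu : Wsp s p Omega u) (u_ge0 : forall x, 0 <= u x).
Hypothesis u_super : forall phi, Wsp s p Omega phi -> (forall x, 0 <= phi x) ->
  (gagliardo s p u <= gagliardo s p (fun x => u x + phi x)%R)%E.

Let mu_ : measurable_fun [set: H] u. Proof. by case: Wu. Qed.
Let uO x : ~ Omega x -> u x = 0. Proof. by case: Wu => _ h _; exact: h. Qed.
Let Gu : gagliardo s p u = (fine (gagliardo s p u))%:E.
Proof. by case: Wu => _ _; exact: gagliardo_fin. Qed.
Let pp : 0 < p. Proof. by have := p_gt1; lra. Qed.

Let eta := cutd Omega.
Let Weta : Wsp s p Omega eta.
Proof. exact: (Wsp_cutd s_gt0 s_lt1 p_gt1 Oopen Obnd). Qed.
Let cO := compl_nonempty Obnd.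
Let meta : measurable_fun [set: H] eta. Proof. by case: Weta. Qed.
Let etaO x : ~ Omega x -> eta x = 0. Proof. exact: cutd_out. Qed.
Let eta0 x : 0 <= eta x. Proof. exact: cutd_ge0. Qed.
Let eta1 x : eta x <= 1. Proof. by apply: le_trans (ler_norm _) _; exact: cutd_le1. Qed.

(** What the barrier k (eta - sg) has above u. The factor k fixes the height of
    the barrier; the levels sg leave room for an iteration. *)
Definition trunc k sg x : R := Num.max 0 (k * (eta x - sg) - u x).
Definition tsupp k sg : set H := [set x | u x < k * (eta x - sg)].

Lemma trunc_ge0 k sg x : 0 <= trunc k sg x. Proof. by rewrite /trunc le_max lexx. Qed.

Let mlevel k sg : measurable_fun [set: H] (fun x => k * (eta x - sg)).
Proof. exact: measurable_funM (measurable_cst _) (measurable_funB meta (measurable_cst _)). Qed.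

Lemma measurable_tsupp k sg : measurable (tsupp k sg).
Proof.
have mb := measurable_fun_ltr mu_ (mlevel k sg).
have m1 : measurable [set true] by [].
by have := mb measurableT _ m1; rewrite setTI.
Qed.

Lemma trunc_out k sg x : ~ tsupp k sg x -> trunc k sg x = 0.
Proof. by move=> /negP; rewrite -leNgt => h; rewrite /trunc max_l// subr_le0. Qed.

Lemma tsupp_domain k sg x : 0 <= k -> 0 <= sg -> tsupp k sg x -> Omega x.
Proof.
move=> k0 sg0 /= h; have [//|xO] := pselect (Omega x).
move: h; rewrite /tsupp/= etaO// uO// sub0r mulrN ltNge oppr_le0 mulr_ge0//.
Qed.

Lemma Wsp_trunc k sg : 0 <= k -> 0 <= sg -> Wsp s p Omega (trunc k sg).
Proof.
move=> k0 sg0; have W1 := WspB p_gt1 (WspZ k Weta) Wu.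
have ks : 0 <= k * sg by rewrite mulr_ge0.
have := @Wsp_contraction R N s p Omega p_gt1 (fun t => Num.max 0 (t - k * sg)) _ _ _ (max0_contraction (k * sg)) W1.
rewrite (_ : (fun x => Num.max 0 (k * eta x - u x - k * sg)) = trunc k sg); last first.
  by apply/funext => x; rewrite /trunc; congr Num.max; ring.
apply; last by rewrite sub0r max_l// oppr_le0.
exact: measurable_maxr (measurable_cst _) (measurable_funB (@measurable_id _ _ _) (measurable_cst _)).
Qed.

Lemma source_bound : exists2 C : R, 0 < C & forall k sg, 0 <= k -> 0 <= sg ->
  (dK s p (fun z : H * H => 2 * pw p (k * (eta z.1 - sg) - k * (eta z.2 - sg)) *
     (\1_(tsupp k sg) z.1 + \1_(tsupp k sg) z.2))%R <= (C * k `^ p)%:E * mu (tsupp k sg))%E.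
Proof.
have [Rr R1 OR] := bounded_radius Obnd; have R0 : 0 <= Rr by lra.
have [C C0 HC] := lipschitz_dK N s_gt0 s_lt1 p_gt1 ler01 ler01 R0.
exists (2 * C) => [|k sg k0 sg0]; first by rewrite mulr_gt0.
have mS := measurable_tsupp k sg.
have := HC eta meta (fun x => cutd_le1 cO x) (fun x y => cutd_lip cO x y) _ mS
  (fun x Sx => hz_domain OR (tsupp_domain k0 sg0 Sx)).
have k2 : 0 <= 2 * k `^ p by rewrite mulr_ge0// powR_ge0.
move=> /(lee_wpmul2l (_ : (0 <= (2 * k `^ p)%:E)%E)); rewrite lee_fin => /(_ k2).
have mi1 : measurable_fun [set: H * H] (fun z : H * H => \1_(tsupp k sg) z.1 : R).
  exact: (measurableT_comp (measurable_indic mS) measurable_fst).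
have mi2 : measurable_fun [set: H * H] (fun z : H * H => \1_(tsupp k sg) z.2 : R).
  exact: (measurableT_comp (measurable_indic mS) measurable_snd).
have M1 : measurable_fun [set: H * H] (fun z : H * H => pw p (eta z.1 - eta z.2) *
    (\1_(tsupp k sg) z.1 + \1_(tsupp k sg) z.2)) :=
  measurable_funM (measurable_pwdiff p meta) (measurable_funD mi1 mi2).
have P1 (z : H * H) : 0 <= pw p (eta z.1 - eta z.2) * (\1_(tsupp k sg) z.1 + \1_(tsupp k sg) z.2).
  by rewrite mulr_ge0 ?pw_ge0 ?addr_ge0.
rewrite -(dKZ s p M1 k2 P1) muleA -EFinM.
have -> : 2 * k `^ p * C = 2 * C * k `^ p by ring.
apply: le_trans; rewrite le_eqVlt; apply/orP; left; apply/eqP.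
congr dK; apply/funext => z.
rewrite (_ : k * (eta z.1 - sg) - k * (eta z.2 - sg) = k * (eta z.1 - eta z.2)); last by ring.
by rewrite pwM (pw_ger0 _ k0); ring.
Qed.

(** Adding the truncation does not lower the energy of the supersolution u, so
    any surplus F in a pointwise estimate of the two energy densities is paid by
    the error term. F is proportional to the energy density of the truncation in
    one application and the nonlocal gain in the other. *)
Lemma energy_trunc : exists2 C : R, 0 < C & forall k sg (F : H * H -> R), 0 <= k -> 0 <= sg ->
  measurable_fun [set: H * H] F -> (forall z, 0 <= F z) ->
  (forall z, pw p ((u z.1 + trunc k sg z.1) - (u z.2 + trunc k sg z.2)) + F z <=
     pw p (u z.1 - u z.2) + 2 * pw p (k * (eta z.1 - sg) - k * (eta z.2 - sg)) *
     (\1_(tsupp k sg) z.1 + \1_(tsupp k sg) z.2)) ->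
  (dK s p F <= (C * k `^ p)%:E * mu (tsupp k sg))%E.
Proof.
have [C C0 HC] := source_bound; exists C => // k sg F k0 sg0 mF F0 HF.
have Wt := Wsp_trunc k0 sg0; have [mt _ _] := Wt.
have mS := measurable_tsupp k sg.
have mut : measurable_fun [set: H] (fun x => u x + trunc k sg x) := measurable_funD mu_ mt.
have mi1 : measurable_fun [set: H * H] (fun z : H * H => \1_(tsupp k sg) z.1 : R).
  exact: (measurableT_comp (measurable_indic mS) measurable_fst).
have mi2 : measurable_fun [set: H * H] (fun z : H * H => \1_(tsupp k sg) z.2 : R).
  exact: (measurableT_comp (measurable_indic mS) measurable_snd).
pose F2 (z : H * H) := 2 * pw p (k * (eta z.1 - sg) - k * (eta z.2 - sg)) *
     (\1_(tsupp k sg) z.1 + \1_(tsupp k sg) z.2).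
have mF2 : measurable_fun [set: H * H] F2.
  exact: measurable_funM (measurable_funM (measurable_cst _) (measurable_pwdiff p (mlevel k sg))) (measurable_funD mi1 mi2).
have F20 z : 0 <= F2 z by rewrite /F2 mulr_ge0 ?addr_ge0// mulr_ge0 ?pw_ge0.
have P1 (z : H * H) : 0 <= pw p (u z.1 - u z.2) by exact: pw_ge0.
have P2 (z : H * H) : 0 <= pw p ((u z.1 + trunc k sg z.1) - (u z.2 + trunc k sg z.2)) by exact: pw_ge0.
have h1 := dKD s p (measurable_pwdiff p mut) mF P2 F0.
have h2 := dKD s p (measurable_pwdiff p mu_) mF2 P1 F20.
have h3 : (gagliardo s p (fun x => u x + trunc k sg x)%R + dK s p F <= gagliardo s p u + dK s p F2)%E.
  rewrite ![gagliardo _ _ _]gagliardoE -h1 -h2; apply: dK_le.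
  - exact: measurable_funD (measurable_pwdiff p mut) mF.
  - exact: measurable_funD (measurable_pwdiff p mu_) mF2.
  - by move=> z; rewrite addr_ge0 ?pw_ge0.
  - exact: HF.
have h4 : (gagliardo s p u + dK s p F <= gagliardo s p u + dK s p F2)%E.
  by apply: le_trans h3; rewrite leeD2r// u_super// => x; exact: trunc_ge0.
have h5 : (dK s p F <= dK s p F2)%E by move: h4; rewrite Gu leeD2lE.
exact: le_trans h5 (HC k sg k0 sg0).
Qed.

Lemma indic_bool (A : set H) (b : bool) x : (A x <-> b) -> \1_A x = b%:R :> R.
Proof.
move=> Ab; rewrite indicE; congr (nat_of_bool _)%:R.
by apply/idP/idP; [rewrite inE => /Ab|move=> /Ab; rewrite inE].
Qed.

Lemma gagliardo_trunc : exists2 C : R, 0 < C & forall k sg, 0 <= k -> 0 <= sg ->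
  (gagliardo s p (trunc k sg) <= (C * k `^ p)%:E * mu (tsupp k sg))%E.
Proof.
have [C C0 HC] := energy_trunc; exists (2 `^ p * C) => [|k sg k0 sg0].
  by rewrite mulr_gt0// powR_gt0.
have [mt _ _] := Wsp_trunc k0 sg0.
have c0 : 0 <= (2 `^ p)^-1 :> R by rewrite invr_ge0 powR_ge0.
pose F (z : H * H) := (2 `^ p)^-1 * pw p (trunc k sg z.1 - trunc k sg z.2).
have mF : measurable_fun [set: H * H] F := measurable_funM (measurable_cst _) (measurable_pwdiff p mt).
have F0 z : 0 <= F z by rewrite /F mulr_ge0 ?pw_ge0.
have := HC k sg F k0 sg0 mF F0 _.
have E := dKZ s p (measurable_pwdiff p mt) c0 (fun z : H * H => pw_ge0 p (trunc k sg z.1 - trunc k sg z.2)).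
rewrite [dK s p F]E -/(gagliardo s p (trunc k sg)) lee_pdivrMl ?powR_gt0// muleA -EFinM mulrA.
apply=> z; rewrite /F [X in _ + X]mulrC.
rewrite (@indic_bool _ (u z.1 < k * (eta z.1 - sg))) // (@indic_bool _ (u z.2 < k * (eta z.2 - sg)))//.
by apply: pw_truncation.
Qed.

Lemma kernel_domain : exists2 k : R, 0 < k & forall x y, Omega x -> Omega y -> x != y ->
  k <= hkernel s p (x, y).
Proof.
have [Rr R1 OR] := bounded_radius Obnd; have R0 : 0 <= Rr by lra.
pose D := (N + N).+1%:R * (2 * Rr + N%:R * (Rr * Rr) + 1).
have NR : 0 <= N%:R * (Rr * Rr) by rewrite !mulr_ge0.
have b1 : 1 <= 2 * Rr + N%:R * (Rr * Rr) + 1 by lra.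
have D0 : 0 < D by rewrite mulr_gt0//; lra.
have q0 := hexp_gt0 N s_gt0 p_gt1.
exists ((D `^ ((hdim N)%:R + s * p))^-1) => [|x y xO yO xy]; first by rewrite invr_gt0 powR_gt0.
rewrite hkernelE /kap.
have z0 : hmul (- y) x != 0 by apply: contra_neq xy => e0; rewrite -(hmulNKx y x) e0 hmulx0.
have n0 := hnorm_gt0 z0.
have h1 : 0 < hnorm (hmul (- y) x) `^ ((hdim N)%:R + s * p) by exact: powR_gt0.
have h2 : 0 < D `^ ((hdim N)%:R + s * p) by exact: powR_gt0.
rewrite lef_pV2 ?posrE//.
apply: ge0_ler_powR; [exact: ltW|by rewrite nnegrE hnorm_ge0|by rewrite nnegrE ltW|].
have xb i := hz_domain OR xO i; have yb i := hz_domain OR yO i.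
apply: hnorm_le; first by lra.
  move=> i; rewrite hz_hmul hzN addrC; apply: le_trans (ler_normB _ _) _.
  have := xb i; have := yb i; lra.
rewrite ht_hmul htN hformNl.
have f1 : `|hform y x| <= N%:R * (Rr * Rr) by apply: hform_le.
have t1 : `|ht x| <= Rr by apply: le_trans (OR _ xO); exact: mx_norm_coord.
have t2 : `|ht y| <= Rr by apply: le_trans (OR _ yO); exact: mx_norm_coord.
apply: le_trans (ler_normB _ _) _.
have := ler_normD (- ht y) (ht x); rewrite normrN => h.
apply: (@le_trans _ _ (2 * Rr + N%:R * (Rr * Rr) + 1)); first by lra.
by rewrite expr2 ler_peMl//; lra.
Qed.

(** Raise u to k eta on its zero set Z. The interaction with {u >= M}, a set of
    positive measure, gains an amount proportional to k times the integral of
    eta over Z, whereas the cost is of order k^p. As p > 1, letting k tend to 0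
    shows that Z is null. *)
Lemma supersolution_pos : ~ {ae mu, forall x, u x = 0} ->
  {ae mu, forall x, Omega x -> 0 < u x}.
Proof.
move=> un0.
have [M M0 muA] : exists2 M : R, 0 < M & (0 < mu [set x | M <= u x]%R)%E.
  apply: contrapT => h; apply: un0.
  have hn n : {ae mu, forall x, u x < n.+1%:R^-1}.
    have mA : measurable [set x | n.+1%:R^-1 <= u x].
      have mb := measurable_fun_ler (measurable_cst (n.+1%:R^-1 : R)) mu_.
      have m1 : measurable [set true] by [].
      by have := mb measurableT _ m1; rewrite setTI.
    exists [set x | n.+1%:R^-1 <= u x]; split => //.
      apply/eqP; rewrite eq_le measure_ge0 andbT leNgt; apply/negP => h1; apply: h.
      by exists n.+1%:R^-1; [rewrite invr_gt0|exact: h1].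
    by move=> x /= /negP; rewrite -leNgt.
  apply: filterS (ae_foralln hn) => x hx; apply/eqP; rewrite eq_le u_ge0 andbT leNgt.
  apply/negP => ux0; have [n hn'] := ltr_add_invr ux0.
  by have := hx n; rewrite ltNge => /negP; apply; apply: ltW; rewrite add0r in hn'.
pose A := [set x | M <= u x].
have mA : measurable A.
  have mb := measurable_fun_ler (measurable_cst M) mu_.
  have m1 : measurable [set true] by [].
  by have := mb measurableT _ m1; rewrite setTI.
have AO x : A x -> Omega x.
  move=> Ax; apply: contrapT => xO; move: Ax; rewrite /A/= uO// leNgt => /negP; exact.
have Afin : (mu A < +oo)%E.
  by apply: le_lt_trans (hmu_domain Oopen Obnd); apply: le_measure; rewrite ?inE//; exact: measurable_domain.
have [kap0 kap0_gt0 Hkap] := kernel_domain.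
have [C C0 HC] := energy_trunc.
pose a := fine (mu A).
have aE : mu A = a%:E by rewrite /a fineK// ge0_fin_numE.
have a0 : 0 < a by rewrite -lte_fin -aE.
pose o := fine (mu Omega).
have oE : mu Omega = o%:E by rewrite /o fineK// ge0_fin_numE// hmu_domain.
have o0 : 0 <= o by exact: fine_ge0.
pose c := p * (M / 2) `^ (p - 1).
have M2 : 0 < M / 2 by rewrite divr_gt0.
have c0 : 0 < c by rewrite mulr_gt0// powR_gt0.
pose Z := [set x | u x <= 0] `&` Omega.
have mZ : measurable Z.
  apply: measurableI; last exact: measurable_domain.
  have mb := measurable_fun_ler mu_ (measurable_cst (0 : R)).
  have m1 : measurable [set true] by [].
  by have := mb measurableT _ m1; rewrite setTI.
have metaZ : measurable_fun [set: H] (fun x => eta x * \1_Z x) := measurable_funM meta (measurable_indic mZ).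
have etaZ0 x : 0 <= eta x * \1_Z x by rewrite mulr_ge0.
have key k : 0 < k -> k <= M / 2 ->
    ((c * (kap0 * a) * k)%:E * \int[mu]_x (eta x * \1_Z x)%:E <= (C * k `^ p * o)%:E)%E.
  move=> k0 kM; have k0' := ltW k0.
  have [mt _ _] := Wsp_trunc k0' (lexx 0).
  have mS := measurable_tsupp k 0.
  have mt1 : measurable_fun [set: H * H] (fun z : H * H => trunc k 0 z.1).
    exact: (measurableT_comp mt measurable_fst).
  have mA2 : measurable_fun [set: H * H] (fun z : H * H => \1_A z.2 : R).
    exact: (measurableT_comp (measurable_indic mA) measurable_snd).
  pose F (z : H * H) := c * (trunc k 0 z.1 * \1_A z.2).
  have mtA : measurable_fun [set: H * H] (fun z : H * H => trunc k 0 z.1 * \1_A z.2) := measurable_funM mt1 mA2.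
  have tA0 (z : H * H) : 0 <= trunc k 0 z.1 * \1_A z.2 by rewrite mulr_ge0 ?trunc_ge0.
  have mF : measurable_fun [set: H * H] F := measurable_funM (measurable_cst _) mtA.
  have F0 z : 0 <= F z by rewrite /F mulr_ge0// ltW.
  have up : (dK s p F <= (C * k `^ p * o)%:E)%E.
    apply: (@le_trans _ _ ((C * k `^ p)%:E * mu (tsupp k 0))%E).
      apply: HC => // z; rewrite /F.
      rewrite (@indic_bool (tsupp k 0) (u z.1 < k * (eta z.1 - 0)))// (@indic_bool (tsupp k 0) (u z.2 < k * (eta z.2 - 0)))//.
      rewrite (@indic_bool A (M <= u z.2))//.
      have em x : k * (eta x - 0) <= M / 2.
        by rewrite subr0; apply: le_trans kM; rewrite ler_piMr.
      by apply: pw_truncation_source.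
    rewrite [leRHS]EFinM lee_wpmul2l ?lee_fin ?mulr_ge0 ?powR_ge0 ?(ltW C0)// -oE.
    by apply: le_measure; rewrite ?inE//; [exact: measurable_domain|move=> x; exact: tsupp_domain].
  apply: le_trans up.
  rewrite [dK s p F](dKZ s p mtA (ltW c0) tA0) -mulrA EFinM -muleA lee_wpmul2l ?lee_fin ?(ltW c0)//.
  rewrite (dK_tonelli1 s p mtA tA0).
  have ka : 0 <= kap0 * a * k by rewrite !mulr_ge0// ltW.
  rewrite -(rintZ mu metaZ ka etaZ0).
  apply: (@le_trans _ _ (\int[mu]_x (kap0 * a * trunc k 0 x)%:E)%E).
    apply: rint_le.
    - exact: measurable_funM (measurable_cst _) metaZ.
    - exact: measurable_funM (measurable_cst _) mt.
    - by move=> x; rewrite mulr_ge0.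
    - move=> x; rewrite -mulrA ler_wpM2l ?mulr_ge0 ?(ltW a0) ?(ltW kap0_gt0)//.
      rewrite indicE; have [|xZ] := boolP (x \in Z); last by rewrite !mulr0 trunc_ge0.
      rewrite inE => -[/= ux xO]; rewrite mulr1 /trunc le_max subr0.
      by apply/orP; right; rewrite lerDl oppr_ge0.
  apply: ge0_le_integral => //.
  - by move=> x _; rewrite lee_fin mulr_ge0 ?trunc_ge0// mulr_ge0 ?ltW.
  - by apply/measurable_EFinP; exact: measurable_funM (measurable_cst _) mt.
  - apply: (measurable_fun_fubini_tonelli_F (m2 := mu) (fun z : H * H => (trunc k 0 z.1 * \1_A z.2 * hkernel s p z)%:E)).
      by apply/measurable_EFinP; exact: measurable_funM mtA (@measurable_hkernel R N s p).
    by move=> z; rewrite lee_fin mulr_ge0 ?hkernel_ge0.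
  - move=> x _.
    have kt : 0 <= kap0 * trunc k 0 x by rewrite mulr_ge0 ?trunc_ge0 ?ltW.
    have i0 y : 0 <= \1_A y :> R by [].
    rewrite (_ : kap0 * a * trunc k 0 x = kap0 * trunc k 0 x * a); last by ring.
    rewrite EFinM -aE -(rint_indic mu mA) -(rintZ mu (measurable_indic mA) kt i0).
    apply: rint_le.
    + exact: measurable_funM (measurable_cst _) (measurable_indic mA).
    + have mm1 : measurable_fun [set: H] (fun y : H => trunc k 0 x * \1_A y) := measurable_funM (measurable_cst _) (measurable_indic mA).
      have mm : measurable_fun [set: H] (fun y : H => trunc k 0 x * \1_A y * hkernel s p (x, y)) := measurable_funM mm1 (@measurable_hkernel1 R N s p x).
      exact: mm.
    + by move=> y; rewrite mulr_ge0.
    + move=> y /=; rewrite [\1_A y]indicE; have [|yA] := boolP (y \in A); last by rewrite !mulr0 mul0r.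
      rewrite inE => yA; rewrite !mulr1.
      have [tx|tx] := pselect (tsupp k 0 x); last by rewrite trunc_out// mulr0 mul0r.
      rewrite mulrC ler_wpM2l ?trunc_ge0//; apply: Hkap.
      * exact: tsupp_domain k0' (lexx 0) tx.
      * exact: AO.
      * apply/eqP => xy; move: tx yA; rewrite /tsupp /A/= xy subr0 => h1 h2.
        have : k * eta y <= M / 2 by apply: le_trans kM; rewrite ler_piMr.
        by move: h1 h2; move: (u y) (k * eta y) => a1 a2; lra.
have Ifin : (\int[mu]_x (eta x * \1_Z x)%:E <= 0)%E.
  pose I := (\int[mu]_x (eta x * \1_Z x)%:E)%E; rewrite -/I.
  have I0 : (0 <= I)%E by apply: rint_ge0.
  have c1 : 0 < c * (kap0 * a) := mulr_gt0 c0 (mulr_gt0 kap0_gt0 a0).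
  apply/lee_addgt0Pr => e e0; rewrite add0e.
  pose B := C * o / (c * (kap0 * a)).
  have B0 : 0 <= B := divr_ge0 (mulr_ge0 (ltW C0) o0) (ltW c1).
  (* After division by k the cost is B k^(p-1), which this choice makes at
     most e. *)
  pose k := Num.min (M / 2) ((e / (B + 1)) `^ (p - 1)^-1).
  have eB : 0 < e / (B + 1) by rewrite divr_gt0// ltr_wpDl.
  have k0 : 0 < k by rewrite lt_min M2 powR_gt0.
  have kM : k <= M / 2 by rewrite ge_min lexx.
  have ck : 0 < c * (kap0 * a) * k by rewrite mulr_gt0.
  have := key k k0 kM; rewrite -(lee_pdivlMl _ _ ck) => /le_trans; apply.
  rewrite -EFinM lee_fin -(mulr_powRB1 (ltW k0) pp).
  have -> : (c * (kap0 * a) * k)^-1 * (C * (k * k `^ (p - 1)) * o) = B * k `^ (p - 1).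
    by rewrite /B; field; rewrite !gt_eqF.
  have kp : k `^ (p - 1) <= e / (B + 1).
    have p1 : 0 < p - 1 by rewrite subr_gt0.
    have -> : e / (B + 1) = ((e / (B + 1)) `^ (p - 1)^-1) `^ (p - 1).
      by rewrite -powRrM mulVf ?gt_eqF// powRr1// ltW.
    apply: ge0_ler_powR; [exact: ltW|by rewrite nnegrE ltW|by rewrite nnegrE powR_ge0|].
    by rewrite /k ge_min lexx orbT.
  apply: le_trans (ler_wpM2l B0 kp) _.
  by rewrite mulrCA ler_piMr ?(ltW e0)// ler_pdivrMr ?ltr_wpDl// mul1r lerDl.
have := rint_eq0 metaZ etaZ0 Ifin; apply: filterS => x hx xO.
rewrite lt_neqAle u_ge0 andbT eq_sym; apply/eqP => ux0; move: hx.
rewrite indicE mem_set; last by split => //=; rewrite ux0.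
by rewrite mulr1 => /eqP; rewrite gt_eqF//; exact: cutd_gt0.
Qed.

(** At the points where u lies below the barrier of level s1, the truncation of
    level s0 exceeds k (s1 - s0), and its p-th power is integrable by
    [faber_krahn] and the energy estimate. The powers of k cancel, so the
    constant does not depend on k. *)
Lemma degiorgi_step : exists2 A : R, 0 < A & forall k s0 s1 r, 0 < k -> 0 <= s0 -> s0 < s1 ->
  0 < r -> (mu (tsupp k s0) <= (r ^+ Q / 2)%:E)%E ->
  (((s1 - s0) `^ p)%:E * mu (tsupp k s1) <= (A * r `^ (s * p))%:E * mu (tsupp k s0))%E.
Proof.
have [C C0 HC] := gagliardo_trunc.
have bc := box_const_gt0 N s p.
exists (2 * box_const N s p * C) => [|k s0 s1 r k0 s00 s01 r0 muS].
  by rewrite !mulr_gt0.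
have k0' := ltW k0.
have [mt _ _] := Wsp_trunc k0' s00.
have d0 : 0 < k * (s1 - s0) by rewrite mulr_gt0 ?subr_gt0.
have mS0 := measurable_tsupp k s0; have mS1 := measurable_tsupp k s1.
have fk := faber_krahn s_gt0 p_gt1 mS0 mt (@trunc_out k s0) r0 muS.
have c0 : 0 <= 2 * box_const N s p * r `^ (s * p) by rewrite !mulr_ge0 ?powR_ge0 ?(ltW bc).
have h1 := le_trans fk (lee_wpmul2l (_ : (0 <= (2 * box_const N s p * r `^ (s * p))%:E)%E) (HC k s0 k0' s00)).
rewrite lee_fin in h1; have {}h1 := h1 c0.
have h2 : (((k * (s1 - s0)) `^ p)%:E * mu (tsupp k s1) <= \int[mu]_x (pw p (trunc k s0 x))%:E)%E.
  have i0 x : 0 <= \1_(tsupp k s1) x :> R by [].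
  rewrite -(rint_indic mu mS1) -(rintZ mu (measurable_indic mS1) (powR_ge0 _ p) i0).
  apply: rint_le.
  - exact: measurable_funM (measurable_cst _) (measurable_indic mS1).
  - exact: (measurableT_comp (@measurable_pw R p) mt).
  - by move=> x; rewrite mulr_ge0 ?powR_ge0.
  - move=> x; rewrite indicE; have [|xS] := boolP (x \in _); last by rewrite mulr0 pw_ge0.
    rewrite inE mulr1 /tsupp/= => ux; rewrite pw_ger0 ?trunc_ge0//.
    apply: ge0_ler_powR; [exact: ltW|by rewrite nnegrE ltW|by rewrite nnegrE trunc_ge0|].
    rewrite /trunc le_max; apply/orP; right.
    rewrite (_ : k * (s1 - s0) = k * (eta x - s0) - k * (eta x - s1)); last by ring.
    by rewrite lerD2l lerN2 ltW.
have kp : 0 < k `^ p by exact: powR_gt0.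
have h3 := le_trans h2 h1.
have s01' : 0 <= s1 - s0 by rewrite subr_ge0 ltW.
rewrite -(@lee_pmul2l _ (k `^ p)%:E)// muleA -EFinM -powRM//.
apply: le_trans h3 _; rewrite !muleA -!EFinM le_eqVlt; apply/orP; left; apply/eqP.
by congr ((_)%:E * _)%E; ring.
Qed.

(** The sets {u < k eta} decrease to a null set as k tends to 0, because u is
    positive. *)
Lemma small_initial_measure e : {ae mu, forall x, Omega x -> 0 < u x} -> 0 < e ->
  exists2 k, 0 < k & (mu (tsupp k 0) <= e%:E)%E.
Proof.
move=> upos e0.
pose F n := tsupp n.+1%:R^-1 0.
have mF n : measurable (F n) by exact: measurable_tsupp.
have F0 n : 0 <= n.+1%:R^-1 :> R by rewrite invr_ge0.
have Ffin : (mu (F 0%N) < +oo)%E.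
  apply: le_lt_trans (hmu_domain Oopen Obnd); apply: le_measure; rewrite ?inE//.
    exact: measurable_domain.
  by move=> x; exact: tsupp_domain (F0 0%N) (lexx 0).
have mI : measurable (\bigcap_n F n) by exact: bigcapT_measurable.
have Fdec : nonincreasing_seq F.
  move=> n m nm; apply/subsetPset => x; rewrite /F/tsupp/= subr0 => /lt_le_trans; apply.
  by rewrite ler_wpM2r// lef_pV2 ?posrE// ler_nat.
have I0 : mu (\bigcap_n F n) = 0%E.
  case: upos => B [mB muB sB].
  apply/eqP; rewrite eq_le measure_ge0 andbT -muB; apply: le_measure; rewrite ?inE//.
  move=> x Fx; apply: sB => /= h.
  have xO : Omega x by exact: tsupp_domain (F0 0%N) (lexx 0) (Fx 0%N I).
  have [n hn] := ltr_add_invr (h xO); rewrite add0r in hn.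
  have := Fx n I; rewrite /F/tsupp/= subr0 ltNge => /negP; apply; apply: ltW.
  by apply: le_lt_trans hn; rewrite ler_piMr.
have cv : mu \o F @ \oo --> 0%E by rewrite -I0; exact: nonincreasing_cvg_mu.
move: cv => /fine_cvgP[_ /cvgrPdist_lt /(_ _ e0)] [n _ /(_ n (leqnn n))] /=.
rewrite sub0r normrN => hn.
exists n.+1%:R^-1; first by rewrite invr_gt0.
have fin : mu (F n) \is a fin_num.
  rewrite ge0_fin_numE//; apply: le_lt_trans Ffin; apply: le_measure; rewrite ?inE//.
  by apply/subsetPset/Fdec.
rewrite -(fineK fin) lee_fin ltW//.
by apply: le_lt_trans hn; exact: ler_norm.
Qed.

(** De Giorgi iteration with levels sg (1 - 2^-j) and radii r0 th^j. The
    distance of the levels loses a factor 2^(j p), which is exactly what the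
    factor r^(s p) gains if th^s = 1/2; so the measures of the sets below the
    barrier decay geometrically and the limit set is null. *)
Lemma lower_bound sg : {ae mu, forall x, Omega x -> 0 < u x} -> 0 < sg ->
  exists2 k, 0 < k & {ae mu, forall x, k * (eta x - sg) <= u x}.
Proof.
move=> upos sg0; have [A A0 HA] := degiorgi_step.
(* th^s = 1/2 balances the loss 2^p of each step; r0 makes the first step
   start, B r0^(s p) = th^Q being the decay that keeps the measure below half
   a box of radius r0 th^j. *)
pose th : R := 2^-1 `^ s^-1.
have half01 : 0 < (2^-1 : R) < 1 by apply/andP; split; lra.
have /andP[th0 th1] : 0 < th < 1 by apply: powR_lt1 => //; rewrite invr_gt0.
have sp0 : 0 < s * p by rewrite mulr_gt0.
pose B := A / (sg / 2) `^ p.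
have sg2 : 0 < sg / 2 by rewrite divr_gt0.
have sgp : 0 < (sg / 2) `^ p by exact: powR_gt0.
have B0 : 0 < B by rewrite divr_gt0.
pose r0 := (th ^+ Q / B) `^ (s * p)^-1.
have thQ : 0 < th ^+ Q / B by rewrite divr_gt0// exprn_gt0.
have r00 : 0 < r0 by exact: powR_gt0.
have r0E : B * r0 `^ (s * p) = th ^+ Q.
  by rewrite /r0 -powRrM mulVf ?gt_eqF// powRr1 ?ltW// mulrC divfK ?gt_eqF.
have e0 : 0 < r0 ^+ Q / 2 by rewrite divr_gt0// exprn_gt0.
have [k k0 Hk] := small_initial_measure upos e0.
exists k => //.
pose sj j : R := sg * (1 - 2^-1 ^+ j).
have h0 j : 0 < 2^-1 ^+ j :> R by rewrite exprn_gt0.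
have h1 j : 2^-1 ^+ j <= 1 :> R by apply: exprn_ile1; apply: ltW; case/andP: half01.
have sj0 j : 0 <= sj j by apply: mulr_ge0; [exact: ltW|rewrite subr_ge0].
have iter j : (mu (tsupp k (sj j)) <= ((r0 * th ^+ j) ^+ Q / 2)%:E)%E.
  elim: j => [|j IH]; first by rewrite expr0 mulr1 /sj expr0 subrr mulr0.
  have dj : sj j.+1 - sj j = sg / 2 * 2^-1 ^+ j by rewrite /sj exprS; field.
  have d0 : 0 < sg / 2 * 2^-1 ^+ j by rewrite mulr_gt0.
  have rj : 0 < r0 * th ^+ j by rewrite mulr_gt0// exprn_gt0.
  have := HA k (sj j) (sj j.+1) _ k0 (sj0 j) _ rj IH; rewrite -subr_gt0 dj => /(_ d0).
  have dp : (sg / 2 * 2^-1 ^+ j) `^ p = (sg / 2) `^ p * (2^-1 `^ p) ^+ j.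
    by rewrite powRM ?(ltW sg2) ?(ltW (h0 j))// powR_expn// ltW.
  have rp : (r0 * th ^+ j) `^ (s * p) = r0 `^ (s * p) * (2^-1 `^ p) ^+ j.
    rewrite powRM ?(ltW r00) ?exprn_ge0 ?(ltW th0)// powR_expn ?(ltW th0)//.
    congr (_ * _ ^+ _); rewrite /th -powRrM; congr (_ `^ _).
    by rewrite mulrA mulVf ?mul1r// gt_eqF.
  have c0 : 0 < (2^-1 `^ p) ^+ j :> R by rewrite exprn_gt0// powR_gt0.
  rewrite dp rp => /le_trans /(_ (lee_wpmul2l _ IH)) h.
  have dpos : 0 < (sg / 2) `^ p * (2^-1 `^ p) ^+ j by exact: mulr_gt0.
  have {}h := h _; rewrite -(lee_pdivlMl _ _ dpos) in h.
  apply: le_trans (h _) _.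
    by rewrite lee_fin; apply: mulr_ge0; [exact: ltW|apply: mulr_ge0; [exact: powR_ge0|exact: ltW]].
  rewrite -!EFinM lee_fin le_eqVlt; apply/orP; left; apply/eqP.
  rewrite (exprSr th j) (mulrA r0) (exprMn Q (r0 * th ^+ j) th) -r0E /B.
  exact: degiorgi_scaling.
have nul : mu (tsupp k sg) = 0%E.
  apply/eqP; rewrite eq_le measure_ge0 andbT.
  apply/lee_addgt0Pr => e e1; rewrite add0e.
  have : (fun j => (r0 ^+ Q / 2) * th ^+ j) @ \oo --> (r0 ^+ Q / 2) * 0.
    by apply: cvgMr; apply: cvg_expr; rewrite gtr0_norm.
  rewrite mulr0 => /cvgrPdist_lt /(_ _ e1) [j _ /(_ j (leqnn j))] /=.
  rewrite sub0r normrN => hj.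
  apply: (@le_trans _ _ (mu (tsupp k (sj j)))).
    apply: le_measure; rewrite ?inE; [exact: measurable_tsupp..|].
    move=> x; rewrite /tsupp/= => /lt_le_trans; apply.
    rewrite ler_pM2l// lerD2l lerN2 /sj.
    by apply: ler_piMr; [exact: ltW|rewrite gerBl; exact: ltW].
  apply: le_trans (iter j) _; rewrite lee_fin.
  apply: le_trans (ltW (le_lt_trans (ler_norm _) hj)).
  rewrite exprMn [leRHS]mulrAC ler_pM2r ?invr_gt0// ler_pM2l ?exprn_gt0//.
  have tj0 : 0 <= th ^+ j by exact: exprn_ge0 (ltW th0).
  have tj1 : th ^+ j <= 1 by exact: exprn_ile1 (ltW th0) (ltW th1).
  rewrite (_ : Q = (N + N).+1.+1)// (exprS _ (N + N).+1).
  by apply: ler_piMr => //; exact: exprn_ile1.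
exists (tsupp k sg); split => //; first exact: measurable_tsupp.
by move=> x /= /negP; rewrite -ltNge.
Qed.

Lemma lower_bound_compact (K : set H) : {ae mu, forall x, Omega x -> 0 < u x} ->
  compact K -> K `<=` Omega -> exists2 C : R, 0 < C & {ae mu, forall x, K x -> C <= u x}.
Proof.
move=> upos cK KO; have [e e0 He] := cutd_compact cO Oopen cK KO.
have [k k0 Hk] := lower_bound upos (divr_gt0 e0 (ltr0Sn R 1)).
exists (k * (e / 2)); first by rewrite mulr_gt0// divr_gt0.
apply: filterS Hk => x hx Kx; apply: le_trans hx; rewrite ler_pM2l//.
by have := He x Kx; rewrite -/eta => h; lra.
Qed.

End supersolution.

(** * Functions of class C^1 and dominated integrals *)

Section C1_functions.
Variables (R : realType) (n : nat).
Implicit Types (phi : 'rV[R]_n -> R) (x y v : 'rV[R]_n) (L M c t : R).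

Lemma is_derive_line phi x v t : differentiable phi (x + t *: v) ->
  is_derive t (1 : R) (fun c : R => phi (x + c *: v)) (\sum_i v 0 i * partial i phi (x + t *: v)).
Proof.
move=> df; set a := x + t *: v in df *.
have E : (fun h : R => h^-1 *: (phi (x + (h *: 1 + t) *: v) - phi (x + t *: v))) =
         (fun h : R => h^-1 *: (phi (h *: v + a) - phi a)).
  apply/funext => h; rewrite /a; congr (_ *: (phi _ - _)).
  by rewrite scalerDl addrCA /GRing.scale/= mulr1.
split; first by rewrite /derivable /= E; exact: diff_derivable.
rewrite /derive /= E -/(derive phi a v) deriveE//.
rewrite [in LHS](row_sum_delta v) linear_sum; apply: eq_bigr => i _.
by rewrite linearZ /= /partial deriveE.
Qed.

(** Stated with partial derivatives, through which the regularity classes are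
    defined. *)
Lemma mean_value_line phi x v : (forall y, differentiable phi y) ->
  exists2 c, 0 < c < 1 & phi (x + v) - phi x = \sum_i v 0 i * partial i phi (x + c *: v).
Proof.
move=> df.
have D (t : R) : is_derive t (1 : R) (fun c : R => phi (x + c *: v))
    (\sum_i v 0 i * partial i phi (x + t *: v)) by exact: is_derive_line.
have [|c c01] := @MVT R (fun c : R => phi (x + c *: v)) _ 0 1 ltr01 (fun t _ => D t).
  apply: continuous_subspaceT => t; apply: differentiable_continuous.
  by apply/derivable1_diffP; case: (D t).
rewrite subr0 mulr1 scale1r scale0r addr0 => E.
by exists c => //; rewrite in_itv in c01.
Qed.

Lemma C1_lipschitz phi L : 0 <= L -> (forall y, differentiable phi y) ->
  (forall i x, `|partial i phi x| <= L) ->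
  forall x y, `|phi x - phi y| <= n%:R * L * `|x - y|.
Proof.
move=> L0 df dL x y; have [c _] := mean_value_line y (x - y) df.
rewrite addrCA subrr addr0 => ->; apply: le_trans (ler_norm_sum _ _ _) _.
apply: (@le_trans _ _ (\sum_(i < n) L * `|x - y|)); last first.
  by rewrite sumr_const card_ord -[X in X <= _]mulr_natl mulrA.
apply: ler_sum => i _; rewrite normrM mulrC ler_pM//.
exact: mx_norm_coord.
Qed.

Lemma compact_fun_bounded (K : set 'rV[R]_n) (g : 'rV[R]_n -> R) : compact K -> continuous g ->
  exists2 M : R, 0 <= M & forall x, K x -> `|g x| <= M.
Proof.
move=> cK cg.
have cI : compact (g @` K) by apply: continuous_compact => //; exact: continuous_subspaceT.
have [M [Mr HM]] := compact_bounded cI.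
exists (`|M| + 1) => [|x Kx]; first by rewrite addr_ge0.
by apply: (HM (`|M| + 1)); [rewrite (le_lt_trans (ler_norm M))// ltrDl|exists x].
Qed.

Lemma C1c_bounded (A : set 'rV[R]_n) phi : C1c A phi ->
  exists2 L : R, 0 <= L & (forall x, `|phi x| <= L) /\
     (forall x y, `|phi x - phi y| <= L * `|x - y|).
Proof.
move=> [[df dphi] [cK KA]]; set K := closure _ in cK KA.
have out x : ~ K x -> \forall y \near x, phi y = 0.
  move=> Kx; have oK : open (~` K) by apply: closed_openC; exact: closed_closure.
  apply: filterS (open_nbhs_nbhs (conj oK Kx)) => y Ky.
  by apply/eqP; apply: contrapT => /negP py; apply: Ky; exact: subset_closure.
have cphi : continuous phi by move=> x; exact: differentiable_continuous.
have [M0 M00 HM0] := compact_fun_bounded cK cphi.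
have dK i : exists2 M : R, 0 <= M & forall x, `|partial i phi x| <= M.
  have [M MM HM] := compact_fun_bounded cK (dphi i); exists M => // x.
  have [/HM//|Kx] := pselect (K x).
  rewrite /partial (near_eq_derive _ (_ : {near x, phi =1 cst 0})) ?derive_cst ?normr0//.
  exact: out.
pose Mi i := sval (cid2 (dK i)).
have Mi0 i : 0 <= Mi i by rewrite /Mi; case: cid2.
have HMi i x : `|partial i phi x| <= Mi i by rewrite /Mi; case: cid2.
pose L := \sum_i Mi i.
have L0 : 0 <= L by apply: sumr_ge0.
have LE i x : `|partial i phi x| <= L.
  by apply: le_trans (HMi i x) _; rewrite /L (bigD1 i)//= lerDl sumr_ge0.
exists (M0 + n%:R * L); first by rewrite addr_ge0// mulr_ge0.
split=> [x|x y].
  have nL : 0 <= n%:R * L by rewrite mulr_ge0.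
  have [/HM0 h|Kx] := pselect (K x); first by apply: le_trans h _; rewrite lerDl.
  by rewrite (nbhs_singleton (out x Kx)) normr0 addr_ge0.
apply: le_trans (C1_lipschitz L0 df LE x y) _.
by rewrite ler_wpM2r// lerDr.
Qed.

Lemma C1c_out (A : set 'rV[R]_n) phi x : C1c A phi -> ~ A x -> phi x = 0.
Proof.
move=> [_ [_ KA]] xA; apply/eqP; apply: contrapT => /negP px.
by apply/xA/KA/subset_closure.
Qed.

End C1_functions.

Section integrable_dominated.
Context d (T : measurableType d) (R : realType) (mu : {measure set T -> \bar R}).
Implicit Types (f g h : T -> R).

Lemma dominated_int h g : measurable_fun [set: T] h -> measurable_fun [set: T] g ->
  (forall x, `|h x| <= g x) -> (\int[mu]_x (g x)%:E < +oo)%E ->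
  mu.-integrable [set: T] (EFin \o h).
Proof.
move=> mh mg hg gfin; apply/integrableP; split; first exact/measurable_EFinP.
apply: le_lt_trans gfin; apply: ge0_le_integral => //.
- by apply/measurable_EFinP; exact: measurableT_comp.
- by apply/measurable_EFinP.
- by move=> x _; rewrite /= lee_fin.
Qed.

Lemma rint_real h : mu.-integrable [set: T] (EFin \o h) ->
  (\int[mu]_x (h x)%:E)%E = (\int[mu]_x h x)%:E.
Proof. by move=> ih; rewrite /Rintegral fineK//; exact: integrable_fin_num. Qed.

Lemma rint_dct (F : nat -> T -> R) h g : (forall n, measurable_fun [set: T] (F n)) ->
  measurable_fun [set: T] h -> measurable_fun [set: T] g ->
  (forall n x, `|F n x| <= g x) -> (\int[mu]_x (g x)%:E < +oo)%E ->
  (forall x, F ^~ x @ \oo --> h x) ->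
  (fun n => \int[mu]_x F n x) @ \oo --> \int[mu]_x h x /\ mu.-integrable [set: T] (EFin \o h).
Proof.
move=> mF mh mg Fg gfin Fh.
have g0 x : 0 <= g x by apply: le_trans (Fg 0%N x).
have ig : mu.-integrable [set: T] (EFin \o g).
  by apply: (dominated_int mg mg) => // x; rewrite ger0_norm.
have [|||||ih _ cv] := @dominated_convergence _ _ _ mu _ measurableT
   (fun n => EFin \o F n) (EFin \o h) (EFin \o g).
- by move=> n; exact/measurable_EFinP.
- exact/measurable_EFinP.
- by apply: aeW => x _; apply: cvg_EFin; [exact: nearW|exact: Fh].
- exact: ig.
- by apply: aeW => x n _; rewrite /= lee_fin.
split => //; apply: fine_cvg.
by rewrite -(rint_real ih).
Qed.

End integrable_dominated.

Section linear_steps.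
Variable R : realType.
Implicit Types p m c g k F t a b : R.

Lemma lin_super p m g k F F' : 0 < p -> 0 < m -> F <= F' ->
  g / p - F / m <= k / p - F' / m -> g <= k.
Proof.
move=> p0 m0 FF h; rewrite -(ler_pM2r (_ : 0 < p^-1)) ?invr_gt0//.
have : F / m <= F' / m by rewrite ler_wpM2r// invr_ge0 ltW.
by move: h; lra.
Qed.

Lemma lin_young c x y z w : x <= c * (y + z) -> c * (y + z) <= c * (y + w) -> 0 <= y ->
  x + w <= (c + 1) * (y + w).
Proof. lra. Qed.

Lemma lin_variation p m g k F F' t a b : 0 < p -> 0 < m ->
  g / p - F / m <= k / p - F' / m -> F + m * (t * a) <= F' -> k <= g + p * (t * b) ->
  t * a <= t * b.
Proof.
move=> p0 m0 h1 h2 h3.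
have : (F + m * (t * a)) / m <= F' / m by rewrite ler_wpM2r// invr_ge0 ltW.
have : k / p <= (g + p * (t * b)) / p by rewrite ler_wpM2r// invr_ge0 ltW.
rewrite !mulrDl [m * _ / m]mulrAC [p * _ / p]mulrAC !divff ?gt_eqF// !mul1r.
by move: h1; lra.
Qed.

Lemma powR_antitone m a b : m < 1 -> 0 < a -> a <= b -> b `^ (m - 1) <= a `^ (m - 1).
Proof.
move=> m1 a0 ab; have b0 : 0 < b by apply: lt_le_trans ab.
rewrite -[m - 1]opprB !powRN lef_pV2 ?posrE ?powR_gt0//.
by rewrite ge0_ler_powR// ?nnegrE ?ltW// subr_gt0.
Qed.

(** The tangent is taken at the perturbed point a + t b, the only one that has
    to be positive. *)
Lemma concave_variation m a b t : 0 < m -> m < 1 -> 0 <= a -> (b != 0 -> 0 < a + t * b) ->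
  a `^ m + m * (t * ((a + t * b) `^ (m - 1) * b)) <= (a + t * b) `^ m.
Proof.
move=> m0 m1 a0 v0; have [->|/v0 {}v0] := eqVneq b 0; first by rewrite !mulr0 !addr0.
have := powR_concave_tangent m0 m1 a0 v0.
rewrite -(mulr_powRB1 (ltW v0) m0).
by set X := (a + t * b) `^ (m - 1); set Y := a `^ m; nra.
Qed.

Lemma continuous_powR_neg m (v : nat -> R) a : m < 1 -> 0 < a -> v @ \oo --> a ->
  (fun n => v n `^ (m - 1)) @ \oo --> a `^ (m - 1).
Proof.
move=> m1 a0 va; rewrite -[m - 1]opprB powRN.
under eq_fun do rewrite powRN.
apply: cvgV; first by rewrite gt_eqF// powR_gt0.
have q0 : 0 < 1 - m by rewrite subr_gt0.
have := cvg_comp _ _ va (@continuous_pw R (1 - m) q0 a).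
rewrite pw_ger0 ?ltW//; apply: cvg_trans; apply: near_eq_cvg.
have /cvgrPdist_lt /(_ _ a0) := va; apply: filterS => n /=.
rewrite ltr_norml => /andP[_ h]; rewrite pw_ger0//; lra.
Qed.

End linear_steps.

(** * The Euler-Lagrange equation *)

Section energy.
Variables (R : realType) (N : nat) (s p : R).
Local Notation mu := (hmu R N).
Local Notation H := (heis R N).
Implicit Types (u w phi : H -> R).

Lemma measurable_Jp : measurable_fun [set: R] (Jp p : R -> R).
Proof.
apply: measurable_funM => //; apply: (measurableT_comp (@measurable_powR R _)).
exact: normr_measurable.
Qed.

Lemma measurable_weighted (r : R) u phi (f : H -> R) : measurable_fun [set: H] u ->
  measurable_fun [set: H] phi -> measurable_fun [set: H] f ->
  measurable_fun [set: H] (fun x => u x `^ r * phi x * f x).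
Proof.
move=> mu_ mphi mf.
exact: measurable_funM (measurable_funM (measurableT_comp (@measurable_powR R r) mu_) mphi) mf.
Qed.

Lemma measurable_diff u : measurable_fun [set: H] u ->
  measurable_fun [set: H * H] (fun z : H * H => u z.1 - u z.2).
Proof.
move=> mu_; exact: measurable_funB (measurableT_comp mu_ measurable_fst) (measurableT_comp mu_ measurable_snd).
Qed.

Lemma measurable_energy u phi : measurable_fun [set: H] u -> measurable_fun [set: H] phi ->
  measurable_fun [set: H * H] (fun z : H * H => Jp p (u z.1 - u z.2) * (phi z.1 - phi z.2) * hkernel s p z).
Proof.
move=> mu_ mphi; apply: measurable_funM (@measurable_hkernel R N s p).
apply: measurable_funM (measurable_diff mphi).
exact: (measurableT_comp measurable_Jp (measurable_diff mu_)).
Qed.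

Lemma energy_ae_eq u w phi : measurable_fun [set: H] u -> measurable_fun [set: H] w ->
  measurable_fun [set: H] phi -> {ae mu, forall x, u x = w x} ->
  energy s p u phi = energy s p w phi.
Proof.
move=> mu_ mw mphi uw; apply: rint_ae_eq; [exact: measurable_energy..|].
by apply: filterS2 (ae_prod1 mu uw) (ae_prod2 mu uw) => z -> ->.
Qed.

End energy.

Section euler_lagrange.
Variables (R : realType) (N : nat) (s p m : R).
Local Notation mu := (hmu R N).
Local Notation H := (heis R N).
Variables (Omega : set H) (f : H -> R).
Hypotheses (s_gt0 : 0 < s) (s_lt1 : s < 1) (p_gt1 : 1 < p).
Hypotheses (m_gt0 : 0 < m) (m_lt1 : m < 1).
Hypotheses (mf : measurable_fun [set: H] f) (f_ge0 : forall x, 0 <= f x)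
  (f_fin : (\int[mu]_x (f x)%:E < +oo)%E).
Implicit Types (v w phi : H -> R) (t c M : R).
Hypothesis Fi_fin : forall v, Wsp s p Omega v -> (Fi m f v < +oo)%E.
Variable u : H -> R.
Hypotheses (Wu : Wsp s p Omega u) (u_ge0 : forall x, 0 <= u x).
Hypothesis u_min : forall v, Wsp s p Omega v -> (forall x, 0 <= v x) ->
  fine (gagliardo s p u) / p - fine (Fi m f u) / m <=
  fine (gagliardo s p v) / p - fine (Fi m f v) / m.

Let pp : 0 < p. Proof. by have := p_gt1; lra. Qed.
Let mu_ : measurable_fun [set: H] u. Proof. by case: Wu. Qed.

(** A nonnegative perturbation does not lower the concave term, so by minimality
    it cannot lower the energy. *)
Lemma minimizer_super phi : Wsp s p Omega phi -> (forall x, 0 <= phi x) ->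
  (gagliardo s p u <= gagliardo s p (fun x => u x + phi x)%R)%E.
Proof.
move=> Wphi phi0; have Wv := WspD p_gt1 Wu Wphi.
have v0 x : 0 <= u x + phi x by rewrite addr_ge0.
have [_ _ Gu] := Wu; have [mv _ Gv] := Wv.
rewrite (gagliardo_fin Gu) (gagliardo_fin Gv) lee_fin.
have FF : fine (Fi m f u) <= fine (Fi m f (fun x => u x + phi x)).
  apply: fine_le; [by rewrite ge0_fin_numE ?Fi_ge0 ?Fi_fin..|].
  apply: rint_le.
  - exact: measurable_Fi.
  - exact: measurable_Fi.
  - by move=> x; exact: Fi_integrand_ge0.
  - move=> x; rewrite ler_wpM2r// !pw_ger0//.
    by rewrite ge0_ler_powR ?(ltW m_gt0)// ?nnegrE ?addr_ge0// lerDl.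
exact: lin_super pp m_gt0 FF (u_min Wv v0).
Qed.

Section variation.
Variables (phi : H -> R) (K : set H) (c0 M : R).
Hypotheses (Wphi : Wsp s p Omega phi) (phiM : forall x, `|phi x| <= M) (M0 : 0 <= M).
Hypotheses (phiK : forall x, ~ K x -> phi x = 0) (c00 : 0 < c0) (uK : forall x, K x -> c0 <= u x).

Let mphi : measurable_fun [set: H] phi. Proof. by case: Wphi. Qed.

Let A t x : R := (u x + t * phi x) `^ (m - 1) * phi x * f x.
Let a (z : H * H) := u z.1 - u z.2.
Let b (z : H * H) := phi z.1 - phi z.2.
Let B t z : R := Jp p (a z + t * b z) * b z * hkernel s p z.

Let ma : measurable_fun [set: H * H] a.
Proof. exact: measurable_funB (measurableT_comp mu_ measurable_fst) (measurableT_comp mu_ measurable_snd). Qed.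
Let mb : measurable_fun [set: H * H] b.
Proof. exact: measurable_funB (measurableT_comp mphi measurable_fst) (measurableT_comp mphi measurable_snd). Qed.

Let mA t : measurable_fun [set: H] (A t).
Proof.
apply: measurable_funM => //; apply: measurable_funM => //.
apply: (measurableT_comp (@measurable_powR R _)); apply: measurable_funD => //.
exact: measurable_funM (measurable_cst _) mphi.
Qed.

Let mB t : measurable_fun [set: H * H] (B t).
Proof.
apply: measurable_funM (@measurable_hkernel R N s p); apply: measurable_funM mb.
apply: (measurableT_comp (@measurable_Jp R p)); apply: measurable_funD ma _.
exact: measurable_funM (measurable_cst _) mb.
Qed.

Let small t := `|t| <= 1 /\ `|t| * M <= c0 / 2.

Let v_pos t x : small t -> K x -> c0 / 2 <= u x + t * phi x.
Proof.
move=> [_ tM] /uK ux; have h : `|t * phi x| <= c0 / 2.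
  by rewrite normrM; apply: le_trans tM; rewrite ler_wpM2l.
by move: h; rewrite ler_norml => /andP[h _]; lra.
Qed.

Let v_ge0 t x : small t -> 0 <= u x + t * phi x.
Proof.
move=> st; have [Kx|Kx] := pselect (K x); last by rewrite phiK// mulr0 addr0.
by apply: le_trans (v_pos st Kx); rewrite divr_ge0 ?ltW.
Qed.

Let Ag x := (c0 / 2) `^ (m - 1) * M * f x.
Let AleAg t x : small t -> `|A t x| <= Ag x.
Proof.
move=> st; rewrite /A /Ag normrM (ger0_norm (f_ge0 x)) ler_wpM2r// normrM.
rewrite (ger0_norm (powR_ge0 _ _)).
have [Kx|Kx] := pselect (K x); last by rewrite phiK// normr0 mulr0 mulr_ge0 ?powR_ge0.
apply: ler_pM => //; first exact: powR_ge0.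
by apply: powR_antitone => //; [rewrite divr_gt0|exact: v_pos].
Qed.
Let mAg : measurable_fun [set: H] Ag.
Proof. exact: measurable_funM (measurable_cst _) mf. Qed.
Let Ag_fin : (\int[mu]_x (Ag x)%:E < +oo)%E.
Proof.
have k0 : 0 <= (c0 / 2) `^ (m - 1) * M by rewrite mulr_ge0// powR_ge0.
rewrite [ltLHS](rintZ mu mf k0 f_ge0); apply: lte_mul_pinfty => //.
Qed.

Let Bg z := (2 `^ p + 1) * (pw p (a z) + pw p (b z)) * hkernel s p z.
Let mBg : measurable_fun [set: H * H] Bg.
Proof.
apply: measurable_funM (@measurable_hkernel R N s p).
exact: measurable_funM (measurable_cst _) (measurable_funD (measurable_pwdiff p mu_) (measurable_pwdiff p mphi)).
Qed.
Let BleBg t z : small t -> `|B t z| <= Bg z.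
Proof.
move=> [t1 _]; rewrite /B /Bg normrM (ger0_norm (hkernel_ge0 _ _ _)) ler_wpM2r ?hkernel_ge0//.
apply: le_trans (Jp_young p_gt1 _ _) _.
have h1 := pwD p_gt1 (a z) (t * b z).
have h2 : pw p (t * b z) <= pw p (b z).
  by apply: ler_pw => //; rewrite normrM ler_piMl.
have h3 : 0 <= 2 `^ p :> R by exact: powR_ge0.
have h4 := pw_ge0 p (a z).
have h5 := ler_wpM2l h3 (lerD (lexx (pw p (a z))) h2).
exact: lin_young h1 h5 h4.
Qed.
Let Bg_fin : (\int[(mu \x mu)%E]_z (Bg z)%:E < +oo)%E.
Proof.
have [_ _ Gu] := Wu; have [_ _ Gp] := Wphi.
have m1 := measurable_pwdiff p mu_; have m2 := measurable_pwdiff p mphi.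
have p1 z : 0 <= pw p (a z) by exact: pw_ge0.
have p2 z : 0 <= pw p (b z) by exact: pw_ge0.
have p12 z : 0 <= pw p (a z) + pw p (b z) by rewrite addr_ge0.
have k0 : 0 <= 2 `^ p + 1 :> R by rewrite addr_ge0 ?powR_ge0.
rewrite -/(dK s p (fun z => (2 `^ p + 1) * (pw p (a z) + pw p (b z)))).
rewrite (dKZ s p (measurable_funD m1 m2) k0 p12) (dKD s p m1 m2 p1 p2) -!gagliardoE.
by rewrite lte_mul_pinfty// lte_add_pinfty.
Qed.

Let iA t : small t -> mu.-integrable [set: H] (EFin \o A t).
Proof. by move=> st; apply: (dominated_int (mA t) mAg) => // x; exact: AleAg. Qed.
Let iB t : small t -> (mu \x mu)%E.-integrable [set: H * H] (EFin \o B t).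
Proof. by move=> st; apply: (dominated_int (mB t) mBg) => // z; exact: BleBg. Qed.

(** Minimality compares u with u + t phi. Both functionals are replaced by their
    tangents at u + t phi: the energy is convex and the other term concave, so
    both inequalities go in the useful direction. *)
Lemma variation_le t : small t -> t * \int[mu]_x A t x <= t * \int[(mu \x mu)%E]_z B t z.
Proof.
move=> st; have Wv := WspD p_gt1 Wu (WspZ t Wphi).
have v0 x := v_ge0 x st.
have h1 := u_min Wv v0.
apply: (lin_variation pp m_gt0 h1).
- have iF w : Wsp s p Omega w -> mu.-integrable [set: H] (EFin \o (fun x => pw m (w x) * f x)).
    move=> Ww; have [mw _ _] := Ww; have mF := measurable_Fi m mf mw.
    apply: (dominated_int mF mF) => [x|]; last exact: Fi_fin.
    by rewrite ger0_norm// Fi_integrand_ge0.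
  have FE w : fine (Fi m f w) = \int[mu]_x (pw m (w x) * f x) by [].
  rewrite !FE -RintegralZl//; last exact: iA.
  have itA : mu.-integrable [set: H] (EFin \o (fun x => t * A t x)).
    by have := integrableZl measurableT t (iA st).
  rewrite -RintegralZl// -RintegralD//; [|exact: iF|by have := integrableZl measurableT m itA].
  apply: le_Rintegral => //.
  + have := integrableD measurableT (iF _ Wu) (integrableZl measurableT m itA).
    by apply: eq_integrable => // x _ /=; rewrite EFinD.
  + exact: iF.
  + move=> x _; rewrite !pw_ger0// /A.
    have pos : phi x != 0 -> 0 < u x + t * phi x.
      move=> px; have [Kx|Kx] := pselect (K x); last by rewrite phiK// eqxx in px.
      by apply: lt_le_trans (v_pos st Kx); rewrite divr_gt0.
    have := ler_wpM2r (f_ge0 x) (concave_variation m_gt0 m_lt1 (u_ge0 x) pos).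
    by rewrite mulrDl !mulrA.
- have iG w : Wsp s p Omega w -> (mu \x mu)%E.-integrable [set: H * H]
      (EFin \o (fun z => pw p (w z.1 - w z.2) * hkernel s p z)).
    move=> [mw _ Gw].
    have mF : measurable_fun [set: H * H] (fun z : H * H => pw p (w z.1 - w z.2) * hkernel s p z) :=
      measurable_funM (measurable_pwdiff p mw) (@measurable_hkernel R N s p).
    apply: (dominated_int mF mF) => [z|]; last by rewrite gagliardoE in Gw.
    by rewrite ger0_norm// mulr_ge0 ?pw_ge0 ?hkernel_ge0.
  have GE w : fine (gagliardo s p w) = \int[(mu \x mu)%E]_z (pw p (w z.1 - w z.2) * hkernel s p z).
    by rewrite gagliardoE.
  rewrite !GE.
  have itB : (mu \x mu)%E.-integrable [set: H * H] (EFin \o (fun x => t * B t x)).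
    by have := integrableZl measurableT t (iB st).
  have ipB := integrableZl measurableT p itB.
  rewrite -RintegralZl//; last exact: iB.
  rewrite -RintegralZl// -RintegralD//; last exact: iG.
  apply: le_Rintegral => //; first exact: iG Wv.
  + have := integrableD measurableT (iG _ Wu) ipB.
    by apply: eq_integrable => // x _ /=; rewrite EFinD.
  + move=> z _; have k0 := hkernel_ge0 s p z.
    have := pw_tangent p_gt1 (a z + t * b z) (a z).
    move=> /(ler_wpM2r k0).
    have -> : u z.1 + t * phi z.1 - (u z.2 + t * phi z.2) = a z + t * b z by rewrite /a /b; ring.
    rewrite mulrDl -lerBrDr => /le_trans; apply; rewrite le_eqVlt; apply/orP; left; apply/eqP.
    by rewrite /B /a; ring.
Qed.

(** Divide [variation_le] by t and let t tend to 0 from either side. The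
    singular power stays dominated because u is at least c0 on the support of
    phi. *)
Lemma euler_lagrange_away :
  energy s p u phi = (\int[mu]_x (u x `^ (m - 1) * phi x * f x)%:E)%E.
Proof.
pose t0 := Num.min 1 (c0 / 2 / (M + 1)).
have M1 : 0 < M + 1 by rewrite ltr_wpDl.
have t00 : 0 < t0 by rewrite lt_min ltr01 !divr_gt0.
have sm t : `|t| <= t0 -> small t.
  rewrite /t0 le_min => /andP[h1 h2]; split => //.
  apply: (@le_trans _ _ (`|t| * (M + 1))); first by rewrite ler_wpM2l// lerDl.
  by rewrite -ler_pdivlMr.
pose tn (e : R) n := e * (t0 / n.+1%:R).
have tn0 e : tn e @ \oo --> (0 : R).
  rewrite -[X in _ --> X](mulr0 e); apply: cvgMr.
  rewrite -[X in _ --> X](mulr0 t0); apply: cvgMr; exact: cvg_harmonic.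
have tnsm e n : `|e| = 1 -> small (tn e n).
  move=> e1; apply: sm; rewrite /tn normrM e1 mul1r ger0_norm; last first.
    by rewrite divr_ge0// ltW.
  by rewrite ler_pdivrMr// ler_peMr ?(ltW t00)// ler1n.
have sm0 : small 0 by apply: sm; rewrite normr0 ltW.
have cA e : `|e| = 1 -> (fun n => \int[mu]_x A (tn e n) x) @ \oo --> \int[mu]_x A 0 x.
  move=> e1; have [] // := rint_dct (fun n => mA (tn e n)) (mA 0) mAg _ Ag_fin _.
    by move=> n x; apply: AleAg; exact: tnsm.
  move=> x; rewrite /A; apply: cvgMl; have [Kx|Kx] := pselect (K x); last first.
    by rewrite phiK//; under eq_fun do rewrite mulr0; rewrite mulr0; exact: cvg_cst.
  apply: cvgMl; apply: continuous_powR_neg => //.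
    by rewrite mul0r addr0; exact: lt_le_trans c00 (uK Kx).
  by apply: cvgD; [exact: cvg_cst|apply: cvgMl; exact: tn0].
have cB e : `|e| = 1 -> (fun n => \int[(mu \x mu)%E]_z B (tn e n) z) @ \oo --> \int[(mu \x mu)%E]_z B 0 z.
  move=> e1; have [] // := rint_dct (fun n => mB (tn e n)) (mB 0) mBg _ Bg_fin _.
    by move=> n z; apply: BleBg; exact: tnsm.
  move=> z; rewrite /B; apply: cvgMl; apply: cvgMl.
  have cz : (fun n => a z + tn e n * b z) @ \oo --> a z + 0 * b z.
    by apply: cvgD; [exact: cvg_cst|apply: cvgMl; exact: tn0].
  exact: (cvg_comp _ _ cz (@continuous_Jp R p p_gt1 _)).
have tpos n : 0 < t0 / n.+1%:R by rewrite divr_gt0.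
have AB : \int[mu]_x A 0 x = \int[(mu \x mu)%E]_z B 0 z.
  have e1 : `|1 : R| = 1 by rewrite normr1.
  have eN1 : `|-1 : R| = 1 by rewrite normrN1.
  apply/eqP; rewrite eq_le; apply/andP; split.
    apply: ler_cvg_to (cA 1 e1) (cB 1 e1) _; apply: nearW => n.
    by have := variation_le (tnsm 1 n e1); rewrite /tn mul1r ler_pM2l.
  apply: ler_cvg_to (cB _ eN1) (cA _ eN1) _; apply: nearW => n.
  by have := variation_le (tnsm _ n eN1); rewrite /tn mulN1r !mulNr lerN2 ler_pM2l.
have EA : (\int[mu]_x (A 0 x)%:E)%E = (\int[mu]_x A 0 x)%:E by apply: rint_real; exact: iA.
have EB : (\int[(mu \x mu)%E]_z (B 0 z)%:E)%E = (\int[(mu \x mu)%E]_z B 0 z)%:E by apply: rint_real; exact: iB.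
transitivity (\int[(mu \x mu)%E]_z (B 0 z)%:E)%E.
  by rewrite /energy; apply: eq_integral => z _; rewrite /B mul0r addr0.
rewrite EB -AB -EA; apply: eq_integral => x _; by rewrite /A mul0r addr0.
Qed.

End variation.
End euler_lagrange.

Section minimizer_solves.
Variables (R : realType) (N : nat) (s p m : R).
Local Notation mu := (hmu R N).
Local Notation H := (heis R N).
Variables (Omega : set H) (f : H -> R).
Hypotheses (s_gt0 : 0 < s) (s_lt1 : s < 1) (p_gt1 : 1 < p).
Hypotheses (m_gt0 : 0 < m) (m_lt1 : m < 1).
Hypotheses (Oopen : open Omega) (Obnd : bounded_set Omega).
Hypotheses (mf : measurable_fun [set: H] f) (f_ge0 : forall x, 0 <= f x)
  (f_fin : (\int[mu]_x (f x)%:E < +oo)%E).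
Hypothesis Fi_fin : forall v, Wsp s p Omega v -> (Fi m f v < +oo)%E.
Variable u : H -> R.
Hypotheses (Wu : Wsp s p Omega u) (u_ge0 : forall x, 0 <= u x) (u_neq0 : ~ {ae mu, forall x, u x = 0}).
Hypothesis u_min : forall v, Wsp s p Omega v -> (forall x, 0 <= v x) ->
  fine (gagliardo s p u) / p - fine (Fi m f u) / m <=
  fine (gagliardo s p v) / p - fine (Fi m f v) / m.

Lemma minimizer_lower_bound (K : set H) : compact K -> K `<=` Omega ->
  exists2 C : R, 0 < C & {ae mu, forall x, K x -> C <= u x}.
Proof.
have sup := minimizer_super p_gt1 m_gt0 mf f_ge0 Fi_fin Wu u_ge0 u_min.
have pos := supersolution_pos s_gt0 s_lt1 p_gt1 Oopen Obnd Wu u_ge0 sup u_neq0.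
exact: (lower_bound_compact s_gt0 s_lt1 p_gt1 Oopen Obnd Wu sup pos).
Qed.

Lemma C1c_Wsp phi : C1c Omega phi -> Wsp s p Omega phi.
Proof.
move=> Cphi; have [L L0 [phiL phiLip]] := C1c_bounded Cphi.
apply: (Wsp_lipschitz s_gt0 s_lt1 p_gt1 Oopen Obnd L0 L0) => // [|x xO].
  by apply: continuous_measurable_rV; exact: lip_continuous phiLip.
exact: C1c_out xO.
Qed.

(** The lower bound of the minimiser on K holds almost everywhere only, so u is
    first changed on a null set. *)
Lemma minimizer_euler_lagrange phi : C1c Omega phi ->
  energy s p u phi = (\int[mu]_x (u x `^ (m - 1) * phi x * f x)%:E)%E.
Proof.
move=> Cphi; have Wphi := C1c_Wsp Cphi.
have [L L0 [phiL _]] := C1c_bounded Cphi.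
have [_ [cK KO]] := Cphi; set K := closure _ in cK KO.
have phiK x : ~ K x -> phi x = 0.
  move=> Kx; apply/eqP; apply: contrapT => /negP px.
  by apply: Kx; apply: subset_closure.
have [c c0 uc] := minimizer_lower_bound cK KO.
have mK : measurable K.
  rewrite -(setCK K); apply: measurableC; apply: open_measurable_rV.
  by apply: closed_openC; exact: closed_closure.
(* w equals u almost everywhere and is at least c on all of K. *)
pose w x := Num.max (u x) (c * \1_K x).
have [mu_ uO Gu] := Wu; have [mphi _ _] := Wphi.
have mw : measurable_fun [set: H] w.
  exact: measurable_maxr mu_ (measurable_funM (measurable_cst _) (measurable_indic mK)).
have uw : {ae mu, forall x, u x = w x}.
  apply: filterS uc => x ux; rewrite /w indicE.
  have [|xK] := boolP (x \in K); last by rewrite mulr0 max_l.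
  by rewrite inE mulr1 => /ux cu; rewrite max_l.
have GE := gagliardo_ae_eq s p mu_ mw uw.
have Ww : Wsp s p Omega w.
  split; [exact: mw| |by rewrite -GE].
  move=> x xO; rewrite /w uO// indicE memNset ?mulr0 ?maxxx//.
  by move=> /KO.
have w_ge0 x : 0 <= w x by rewrite /w le_max u_ge0.
have FE : Fi m f w = Fi m f u.
  apply: rint_ae_eq; [exact: measurable_Fi..|].
  by apply: filterS uw => x ->.
have w_min v : Wsp s p Omega v -> (forall x, 0 <= v x) ->
  fine (gagliardo s p w) / p - fine (Fi m f w) / m <=
  fine (gagliardo s p v) / p - fine (Fi m f v) / m.
  by rewrite -GE FE; exact: u_min.
have wK x : K x -> c <= w x by move=> Kx; rewrite /w indicE mem_set// mulr1 le_max lexx orbT.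
have -> : (\int[mu]_x (u x `^ (m - 1) * phi x * f x)%:E = \int[mu]_x (w x `^ (m - 1) * phi x * f x)%:E)%E.
  by apply: rint_ae_eq; [exact: measurable_weighted..|apply: filterS uw => x ->].
rewrite -(euler_lagrange_away p_gt1 m_gt0 m_lt1 mf f_ge0 f_fin Fi_fin Ww w_ge0 w_min Wphi phiL L0 phiK c0 wK).
exact: (energy_ae_eq s p mu_ mw mphi uw).
Qed.

End minimizer_solves.

(** * Leaving the domain by small left translations *)

Section translations.
Variables (R : realType) (N : nat).
Local Notation H := (heis R N).
Implicit Types (x y z g v : H) (t c : R).

Lemma hformBr z x y : hform z (x - y) = hform z x - hform z y.
Proof.
rewrite -(hformNr z y) -hformDr /hform; congr (_ * _); apply: eq_bigr => i _.
by rewrite !hz_hmul !hzN /hz !mxE.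
Qed.

Lemma hformZl t x y : hform (t *: x) y = t * hform x y.
Proof.
rewrite /hform mulrCA [in RHS]mulr_sumr; congr (_ * _); apply: eq_bigr => i _.
by rewrite /hz !mxE; ring.
Qed.

Definition hdelta (j : 'I_(N + N).+1) : H := delta_mx 0 j.

(** The right-invariant vector fields, which generate left translations: by
    [hmul_line] the translation by t e_j moves every point along a straight
    line. *)
Definition hfield j x : H := hdelta j + hform (hdelta j) x *: hdelta ord_max.

Lemma hmul_line t j x : hmul (t *: hdelta j) x = x + t *: hfield j x.
Proof.
apply/rowP => i; rewrite hmulE hformZl !mxE /=.
by case: (i == ord_max) => /=; rewrite ?mulr0 ?mulr1; ring.
Qed.

Lemma hform_bound z : exists2 C : R, 0 <= C & forall x, `|hform z x| <= C * `|x|.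
Proof.
exists (N%:R * `|z|) => [|x]; first by rewrite mulr_ge0.
rewrite -mulrA; apply: hform_le => // i; exact: mx_norm_coord.
Qed.

Lemma continuous_hform z : continuous (hform z).
Proof.
have [C C0 HC] := hform_bound z.
by apply: (@lip_continuous R _ _ C) => x y; rewrite -hformBr.
Qed.

Lemma hform_hdelta_max x : hform (hdelta ord_max) x = 0.
Proof.
rewrite /hform big1 ?mulr0// => i _; rewrite /hz !mxE !eqxx/=.
by rewrite !widen_neq_max !mul0r subrr.
Qed.

Lemma continuous_hform_fst z : continuous (fun w : H * R => hform z w.1).
Proof.
move=> w; exact: (cvg_comp _ _ (@cvg_fst _ _ (nbhs w.1) (nbhs w.2) _) (@continuous_hform z w.1)).
Qed.

(** The derivative in t of r (x + t * hfield j x), at z = (x, t). *)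
Definition dfield (r : H -> R) j (z : H * R) : R :=
  \sum_i hfield j z.1 0 i * partial i r (z.1 + z.2 *: hfield j z.1).

Lemma continuous_line j : continuous (fun z : H * R => z.1 + z.2 *: hfield j z.1).
Proof.
move=> z; apply: cvgD; first exact: cvg_fst.
apply: cvgZ; first exact: cvg_snd.
apply: cvgD; first exact: cvg_cst.
by apply: cvgZ; [exact: continuous_hform_fst|exact: cvg_cst].
Qed.

Lemma continuous_dfield r j : Ck 1 r -> continuous (dfield r j).
Proof.
move=> [_ dr] z; apply: cvg_big => [|i _]; first exact: add_continuous.
 apply: cvgM.
  have E w : hfield j w 0 i = hdelta j 0 i + hform (hdelta j) w * hdelta ord_max 0 i by rewrite !mxE.
  rewrite E; under eq_fun do rewrite E.
  apply: cvgD; first exact: cvg_cst.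
  by apply: cvgMl; exact: continuous_hform_fst.
exact: (cvg_comp _ _ (@continuous_line j z) (dr i (z.1 + z.2 *: hfield j z.1))).
Qed.

(** The fields are expressed in the coordinate directions by a unitriangular
    matrix, so they see every nonzero gradient. *)
Lemma dfield_neq0 r x : (exists i, partial i r x != 0) -> exists j, dfield r j (x, 0) != 0.
Proof.
move=> [i ri].
have E j : dfield r j (x, 0) = partial j r x + hform (hdelta j) x * partial ord_max r x.
  rewrite /dfield /= scale0r addr0.
  under eq_bigr do rewrite !mxE eqxx/= mulrDl.
  rewrite big_split/=; congr (_ + _).
    by rewrite (bigD1 j)//= eqxx mul1r big1 ?addr0// => k kj; rewrite (negbTE kj) mul0r.
  rewrite (bigD1 ord_max)//= eqxx mulr1 big1 ?addr0// => k km.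
  by rewrite (negbTE km) mulr0 mul0r.
have [m0|m0] := eqVneq (partial ord_max r x) 0.
  by exists i; rewrite E m0 mulr0 addr0.
by exists ord_max; rewrite E hform_hdelta_max mul0r addr0.
Qed.

Variable Omega : set H.
Hypotheses (Oopen : open Omega) (Obnd : bounded_set Omega) (Osm : smooth_boundary Omega).

Definition signed_shift t (k : 'I_(N + N).+1 * bool) : H := ((-1) ^+ k.2 * t) *: hdelta k.1.

(** Some field is transversal to the boundary at x0, and remains so nearby.
    Following it in the direction in which the defining function r increases
    takes a point outside the domain out of the closure. *)
Lemma exit_boundary x0 : closure Omega x0 -> ~ Omega x0 ->
  exists2 e : R, 0 < e & forall x t, `|x - x0| < e -> ~ Omega x -> 0 < t -> t < e ->
  exists k, ~ closure Omega (hmul (signed_shift t k) x).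
Proof.
move=> clx0 Ox0; have [r [rk ri Or]] := Osm clx0 Ox0.
have r1 : Ck 1 r := rk 1%N.
have [j a0] := dfield_neq0 ri; set a := dfield r j (x0, 0) in a0.
have cr : continuous r by move=> y; exact: differentiable_continuous (r1.1 y).
have near1 : \forall z \near ((x0, 0) : H * R), 0 < dfield r j z * a.
  have cz : (fun z : H * R => dfield r j z * a) @ ((x0, 0) : H * R) --> a * a.
    by apply: cvgMl; exact: continuous_dfield.
  by apply: (cvgr_gt (a * a) cz); rewrite -expr2 exprn_even_gt0.
have near2 : \forall z \near ((x0, 0) : H * R), \forall y \near (z.1 + z.2 *: hfield j z.1 : H), (Omega y <-> r y < 0).
  have cl : (fun z : H * R => z.1 + z.2 *: hfield j z.1) @ ((x0, 0) : H * R) --> x0.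
    by have := @continuous_line j (x0, 0); rewrite /continuous_at /= scale0r addr0.
  exact: cl _ (near_join Or).
have [e e0 He] : exists2 e : R, 0 < e & forall x t, `|x - x0| < e -> `|t| < e ->
    0 < dfield r j (x, t) * a /\ \forall y \near (x + t *: hfield j x : H), (Omega y <-> r y < 0).
  have [[A B] [/= nA nB] AB] := filterI near1 near2.
  have [e1 /= e10 He1] := (nbhs_ballP _ _).1 nA.
  have [e2 /= e20 He2] := (nbhs_ballP _ _).1 nB.
  exists (Num.min e1 e2) => [|x t]; first by rewrite lt_min e10 e20.
  rewrite !lt_min => /andP[xe _] /andP[_ te]; apply: (AB (x, t)); split => /=.
    by apply: He1; rewrite -ball_normE /= distrC.
  by apply: He2; rewrite -ball_normE /= sub0r normrN.
exists e => // x t xe Ox t0 te.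
(* The sign of the shift is that of a, so that r increases along it. *)
pose b := a < 0.
have ab c : 0 < c * a -> 0 < (-1) ^+ b * c.
  rewrite /b => ca; have [aneg|apos] := ltP a 0.
    by rewrite expr1 mulN1r oppr_gt0 -(nmulr_lgt0 _ aneg).
  have ap : 0 < a by rewrite lt_neqAle eq_sym a0.
  by rewrite expr0 mul1r -(pmulr_lgt0 _ ap).
exists (j, b) => clx; pose tau := (-1) ^+ b * t.
have tau_le c : 0 <= c -> c <= 1 -> `|c * tau| < e.
  move=> c0 c1; rewrite /tau !normrM normrX normrN1 expr1n mul1r (ger0_norm c0) (gtr0_norm t0).
  by apply: le_lt_trans te; rewrite ler_piMl// ltW.
have rx : 0 <= r x.
  have z0 : `|0 : R| < e by rewrite normr0.
  have [_ /nbhs_singleton] := He x 0 xe z0.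
  by rewrite scale0r addr0 leNgt => h; apply/negP => /h.
have [c /andP[c0 c1] rE] := mean_value_line x (tau *: hfield j x) r1.1.
have [D0 _] := He x (c * tau) xe (tau_le c (ltW c0) (ltW c1)).
have rpos : 0 < r (x + tau *: hfield j x).
  apply: le_lt_trans rx _; rewrite -subr_gt0 rE.
  under eq_bigr do rewrite mxE -mulrA scalerA.
  rewrite -mulr_sumr -/(dfield r j (x, c * tau)).
  have D1 := mulr_gt0 (ab _ D0) t0.
  by rewrite [_ * t]mulrAC -/tau in D1.
have [_ eqv] := He x (1 * tau) xe (tau_le 1 ler01 (lexx 1)).
rewrite mul1r in eqv; move: clx; rewrite /signed_shift /= -/tau hmul_line => clx.
have rnear : \forall y \near (x + tau *: hfield j x : H), 0 < r y by apply: (cvgr_gt _ (cr _)).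
have [y [Oy [eqy ry]]] := clx _ (filterI eqv rnear).
by move/eqy: Oy => /lt_trans /(_ ry); rewrite ltxx.
Qed.

Definition shifts t : seq H := [seq signed_shift t k | k <- enum {: 'I_(N + N).+1 * bool}].

Lemma compact_domain_closure : compact (closure Omega).
Proof.
apply: bounded_closed_compact; last exact: closed_closure.
have [Rr R1 OR] := bounded_radius Obnd.
exists Rr; split; first exact: num_real.
move=> M RM x clx; have cl : closed [set y : H | `|y| <= Rr].
  apply: (closed_comp (f := fun y : H => `|y|) (D := [set z : R | z <= Rr])).
    by move=> y _; exact: norm_continuous.
  exact: closed_le.
have : closure Omega `<=` [set y : H | `|y| <= Rr].
  have := closure_subset OR; rewrite -[X in _ `<=` X -> _]((closure_id _).1 cl); exact.
by move=> /(_ _ clx) /= h; apply: le_trans h (ltW RM).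
Qed.

(** Each boundary point has a shift that leaves the closure, and by compactness
    of the boundary one size t suits all of them. Hence the points all of whose
    shifts remain in the closure form a compact subset of the domain. *)
Lemma shifts_inside : \forall t \near (0 : R)^'+, forall x, closure Omega x ->
  (forall g, g \in shifts t -> closure Omega (hmul g x)) -> Omega x.
Proof.
have cB : compact (closure Omega `&` ~` Omega).
  apply: (subclosed_compact _ compact_domain_closure); last by move=> x [].
  by apply: closedI; [exact: closed_closure|exact: open_closedC].
have /near_covering_withinP nc := (compact_near_coveringP _).1 cB.
have := nc R ((0 : R)^'+) (fun t x => exists k, ~ closure Omega (hmul (signed_shift t k) x)) _.
have h x : (closure Omega `&` ~` Omega) x -> \forall x' \near x & i \near (0 : R)^'+,
    (closure Omega `&` ~` Omega) x' -> exists k, ~ closure Omega (hmul (signed_shift i k) x').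
  move=> [clx Ox]; have [e e0 He] := exit_boundary clx Ox.
  exists ([set y | `|y - x| < e], [set t : R | 0 < t < e]) => /=.
    split; last first.
      near=> t; apply/andP; split; [near: t; exact: nbhs_right_gt|near: t; exact: nbhs_right_lt].
    by apply/nbhs_ballP; exists e => //= y; rewrite -ball_normE /= distrC.
  move=> [y t] /= [ye /andP[t0 te]] [cly Oy]; exact: He ye Oy t0 te.
move=> /(_ _ h); apply: filterS => t Ht x clx gx; apply: contrapT => Ox.
have [k] := Ht x (conj clx Ox); apply; apply: gx.
by apply: map_f; rewrite mem_enum.
Unshelve. all: by end_near.
Qed.

End translations.

(** * Smoothing *)

Section quadratic_remainder.
Variables (R : realType) (n : nat).
Local Notation V := 'rV[R]_n.
Implicit Types (x v a b : V) (c : R).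

Section linear_form.
Variable L : V -> R.
Hypothesis linL : forall c a b, L (c *: a + b) = c * L a + L b.

Let L0 : L 0 = 0.
Proof. by have := linL (-1) 0 0; rewrite scaler0 addr0 mulN1r addNr. Qed.
Let LD a b : L (a + b) = L a + L b.
Proof. by have := linL 1 a b; rewrite scale1r mul1r. Qed.
Let LZ c a : L (c *: a) = c * L a.
Proof. by have := linL c a 0; rewrite addr0 L0 addr0. Qed.

Lemma linear_form_bounded : exists2 C : R, 0 <= C & forall v, `|L v| <= C * `|v|.
Proof.
exists (\sum_j `|L (delta_mx 0 j)|) => [|v]; first exact: sumr_ge0.
have LS : {morph L : a b / a + b} := LD.
rewrite {1}(row_sum_delta v) (big_morph L LS L0) mulr_suml.
apply: le_trans (ler_norm_sum _ _ _) _; apply: ler_sum => j _.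
by rewrite LZ normrM mulrC ler_wpM2l// mx_norm_coord.
Qed.

(** A name for L to which the structure of a linear map can be attached. *)
Definition linear_form : V -> R := L.
HB.instance Definition _ := GRing.isLinear.Build R V R _ linear_form linL.

Lemma is_diff_quadratic phi x C : (forall v, `|v| <= 1 -> `|phi (x + v) - phi x - L v| <= C * `|v| ^+ 2) ->
  differentiable phi x /\ forall v, 'D_v phi x = L v.
Proof.
move=> HC; have cL : continuous linear_form.
  have [D _ HD] := linear_form_bounded; apply: (@lip_continuous R n _ D) => a b.
  by rewrite -[linear_form a - linear_form b]linearB; exact: HD.
have E : phi \o shift x = cst (phi x) + linear_form +o_ (0 : V) id.
  apply/eqaddoP => e e0; have C1 : 0 < `|C| + 1 by rewrite ltr_wpDl.
  have m0 : 0 < Num.min 1 (e / (`|C| + 1)) by rewrite lt_min ltr01 divr_gt0.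
  apply/nbhs_ballP; exists (Num.min 1 (e / (`|C| + 1))) => //= v.
  rewrite -ball_normE /= sub0r normrN lt_min => /andP[/ltW v1 ve].
  have -> : (phi \o +%R^~ x - (cst (phi x) + linear_form)) v = phi (x + v) - phi x - L v.
    by rewrite -[LHS]/(phi (v + x) - (phi x + L v)) (addrC v x) opprD addrA.
  apply: le_trans (HC v v1) _.
  rewrite expr2 mulrA ler_wpM2r//; apply: le_trans (_ : (`|C| + 1) * `|v| <= e).
    rewrite ler_wpM2r//; apply: le_trans (ler_norm C) _; by rewrite lerDl.
  by rewrite mulrC -ler_pdivlMr// ltW.
have dE := diff_unique cL E.
have df : differentiable phi x by apply/diff_locallyP; rewrite dE.
by split=> // v; rewrite deriveE// dE.
Qed.

End linear_form.

(** Expand phi at x and at x + v: the remainders at the increments v, v + |v|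
    e_i and |v| e_i bound the change of the i-th partial derivative, times |v|,
    by O(|v|^2). So the partial derivatives are even locally Lipschitz. *)
Lemma Ck1_of_quadratic (phi : V -> R) (D : V -> V -> R) :
  (forall x c a b, D x (c *: a + b) = c * D x a + D x b) ->
  (forall X : R, exists C : R, forall x v, `|x| <= X -> `|v| <= 1 ->
     `|phi (x + v) - phi x - D x v| <= C * `|v| ^+ 2) -> Ck 1 phi.
Proof.
move=> linD HC.
have dif x : differentiable phi x /\ forall v, 'D_v phi x = D x v.
  have [C HC'] := HC `|x|; apply: (is_diff_quadratic (linD x) (C := C)) => v v1.
  exact: HC'.
split=> [x|i x]; first by case: (dif x).
have -> : partial i phi = fun x => D x (delta_mx 0 i).
  by apply/funext => y; rewrite /partial; case: (dif y) => _ ->.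
have [C0 HC0] := HC (`|x| + 1); pose C := `|C0| + 1.
have C1 : 0 < C by rewrite ltr_wpDl.
have {}HC y v : `|y| <= `|x| + 1 -> `|v| <= 1 -> `|phi (y + v) - phi y - D y v| <= C * `|v| ^+ 2.
  move=> yx v1; apply: le_trans (HC0 y v yx v1) _; rewrite ler_wpM2r ?sqr_ge0//.
  by apply: le_trans (ler_norm C0) _; rewrite lerDl.
have DD y a b : D y (a + b) = D y a + D y b by rewrite -{1}[a]scale1r linD mul1r.
have D0 y : D y 0 = 0 by have := linD y (-1) 0 0; rewrite scaler0 addr0 mulN1r addNr.
have DZ y c a : D y (c *: a) = c * D y a by have := linD y c a 0; rewrite addr0 D0 addr0.
set d := delta_mx 0 i : V.
have d1 : `|d| <= 1.
  apply: mx_norm_le => // k; rewrite mxE /=; case: (_ == _) => /=; by rewrite ?normr1 ?normr0.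
have lip v : v != 0 -> `|v| <= 2^-1 -> `|D (x + v) d - D x d| <= 6 * C * `|v|.
  move=> v0 v2; set r := `|v|.
  have r0 : 0 < r by rewrite normr_gt0.
  have r2 : r <= 2^-1 by [].
  have rd : `|r *: d| <= r by rewrite normrZ (gtr0_norm r0) ler_piMr// ltW.
  have xr : `|x + v| <= `|x| + 1 by apply: le_trans (ler_normD _ _) _; rewrite lerD2l; lra.
  have rd1 : `|r *: d| <= 1 by lra.
  have x1 : `|x| <= `|x| + 1 by rewrite lerDl.
  have v1 : `|v| <= 1 by lra.
  have vrd : `|v + r *: d| <= 2 * r by apply: le_trans (ler_normD _ _) _; rewrite -/r; lra.
  have vrd1 : `|v + r *: d| <= 1 by lra.
  have h1 := HC (x + v) (r *: d) xr rd1.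
  have h2 := HC x (v + r *: d) x1 vrd1.
  have h3 := HC x v x1 v1.
  have b1 : C * `|r *: d| ^+ 2 <= C * r ^+ 2 by rewrite ler_pM2l// lerXn2r ?nnegrE ?(ltW r0).
  have b2 : C * `|v + r *: d| ^+ 2 <= C * (4 * r ^+ 2).
    rewrite ler_pM2l// (_ : 4 * r ^+ 2 = (2 * r) ^+ 2); last by ring.
    by rewrite lerXn2r ?nnegrE ?mulr_ge0 ?(ltW r0).
  rewrite DZ in h1; rewrite DD DZ addrA in h2.
  have key : r * `|D (x + v) d - D x d| <= 6 * C * r ^+ 2.
    rewrite -[X in X * `|_|](gtr0_norm r0) -normrM.
    move: (le_trans h1 b1) (le_trans h2 b2) h3; rewrite -/r.
    move: (phi _) (phi (x + v)) (phi x) (D (x + v) d) (D x d) (D x v) => p1 p2 p3 D1 D2 D3.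
    by rewrite !ler_norml => /andP[? ?] /andP[? ?] /andP[? ?]; apply/andP; split; lra.
  by move: key; rewrite expr2 mulrA mulrC ler_pM2r.
apply/(@cvgrPdist_lt _ _ _ (nbhs x) (@nbhs_filter _ x) (fun y : V => D y d) (D x d)) => e e0.
have C6 : 0 < 6 * C by rewrite mulr_gt0.
have m0 : 0 < Num.min 2^-1 (e / (6 * C)) by rewrite lt_min divr_gt0// invr_gt0 ltr0Sn.
apply/nbhs_ballP; exists (Num.min 2^-1 (e / (6 * C))) => //= y.
rewrite -ball_normE /= distrC lt_min => /andP[/ltW y2 ye].
have [->|xy] := eqVneq y x; first by rewrite subrr normr0.
have := lip (y - x); rewrite subr_eq0 addrCA subrr addr0 => /(_ xy y2).
rewrite distrC => /le_lt_trans; apply.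
by rewrite mulrC -ltr_pdivlMr.
Qed.

End quadratic_remainder.

Section inner_product.
Variables (R : realType) (n : nat).
Local Notation V := 'rV[R]_n.
Implicit Types (a b h l v : V) (c e B t : R).

Definition dotp a b : R := \sum_j a 0 j * b 0 j.

Lemma dotpDr a b h : dotp h (a + b) = dotp h a + dotp h b.
Proof. by rewrite /dotp -big_split; apply: eq_bigr => j _; rewrite mxE mulrDr. Qed.

Lemma dotpZr c a h : dotp h (c *: a) = c * dotp h a.
Proof. by rewrite /dotp mulr_sumr; apply: eq_bigr => j _; rewrite mxE; ring. Qed.

Lemma dotpC a b : dotp a b = dotp b a.
Proof. by apply: eq_bigr => j _; rewrite mulrC. Qed.

Lemma dotp_ge0 a : 0 <= dotp a a.
Proof. by apply: sumr_ge0 => j _; rewrite -expr2 sqr_ge0. Qed.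

Lemma dotp_le a b : `|dotp a b| <= n%:R * `|a| * `|b|.
Proof.
apply: le_trans (ler_norm_sum _ _ _) _.
apply: (@le_trans _ _ (\sum_(j < n) `|a| * `|b|)); last first.
  by rewrite sumr_const card_ord -[X in X <= _]mulr_natl mulrA.
by apply: ler_sum => j _; rewrite normrM ler_pM// mx_norm_coord.
Qed.

Lemma sqr_coord_le_dotp a j : a 0 j ^+ 2 <= dotp a a.
Proof.
rewrite /dotp (bigD1 j)//= -expr2 lerDl; apply: sumr_ge0 => k _.
by rewrite -expr2 sqr_ge0.
Qed.

Lemma sqpos_remainder t c :
  `|Num.max 0 (t + c) ^+ 2 - Num.max 0 t ^+ 2 - 2 * Num.max 0 t * c| <= c ^+ 2.
Proof.
have [h1|h1] := leP 0 t; have [h2|h2] := leP 0 (t + c).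
- by rewrite (_ : _ - _ - _ = c ^+ 2) ?ger0_norm ?sqr_ge0//; ring.
- rewrite ger0_norm; nra.
- by rewrite !mulr0 mul0r subr0 expr0n/= subr0 ger0_norm ?sqr_ge0//; nra.
- by rewrite mulr0 mul0r subrr subr0 normr0 sqr_ge0.
Qed.

Lemma remainder_scaling (a b c k t : R) : 0 <= a -> 0 <= b -> 0 <= k -> 0 <= t -> t <= 1 ->
  (a * (k * t) + b * (k * t) ^+ 2) ^+ 2 + c * (b * (k * t) ^+ 2) <=
  ((a * k + b * k ^+ 2) ^+ 2 + c * (b * k ^+ 2)) * t ^+ 2.
Proof.
move=> a0 b0 k0 t0 t1; rewrite [leRHS]mulrDl; apply: lerD; last first.
  by rewrite le_eqVlt; apply/orP; left; apply/eqP; ring.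
rewrite (_ : a * (k * t) + b * (k * t) ^+ 2 = (a * k + b * k ^+ 2 * t) * t); last by ring.
have ak : 0 <= a * k by exact: mulr_ge0.
have bk : 0 <= b * k ^+ 2 by rewrite mulr_ge0 ?sqr_ge0.
rewrite exprMn ler_wpM2r ?sqr_ge0// lerXn2r ?nnegrE ?addr_ge0// ?mulr_ge0//.
by rewrite lerD2l ler_piMr.
Qed.

(** The square of the positive part is differentiable with a quadratic
    remainder, so this explicit profile replaces a smooth one. *)
Definition bump e h : R := Num.max 0 (e - dotp h h) ^+ 2.
Definition dbump e h l : R := 2 * Num.max 0 (e - dotp h h) * (- (2 * dotp h l)).

Lemma bump_ge0 e h : 0 <= bump e h. Proof. exact: sqr_ge0. Qed.

Lemma max0_le e h : 0 <= e -> 0 <= Num.max 0 (e - dotp h h) <= e.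
Proof. by move=> e0; rewrite le_max lexx ge_max e0 gerBl dotp_ge0. Qed.

Lemma bump_le e h : 0 <= e -> bump e h <= e ^+ 2.
Proof. by move=> e0; have /andP[? ?] := max0_le h e0; rewrite /bump lerXn2r ?nnegrE. Qed.

Lemma bump_supp e h j : bump e h != 0 -> h 0 j ^+ 2 < e.
Proof.
rewrite sqrf_eq0 => b0; apply: le_lt_trans (sqr_coord_le_dotp h j) _.
by rewrite -subr_gt0; move: b0; have [h1|//] := leP (e - dotp h h) 0; rewrite eqxx.
Qed.

Lemma dbump_le e h l : 0 <= e -> `|dbump e h l| <= 4 * e * (n%:R * `|h| * `|l|).
Proof.
move=> e0; have /andP[m0 me] := max0_le h e0.
have d := dotp_le h l.
rewrite /dbump normrM normrN (normrM 2 (dotp _ _)) (ger0_norm (mulr_ge0 _ m0))// (ger0_norm (ler0n _ 2)).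
rewrite (_ : 4 * e * _ = 2 * e * (2 * (n%:R * `|h| * `|l|))); last by ring.
by apply: ler_pM; rewrite ?mulr_ge0// ler_pM2l.
Qed.

Lemma bump_remainder e h l B c : 0 <= e -> `|h| <= B -> `|l| <= c ->
  `|bump e (h + l) - bump e h - dbump e h l| <=
  (2 * n%:R * B * c + n%:R * c ^+ 2) ^+ 2 + 2 * e * (n%:R * c ^+ 2).
Proof.
move=> e0 hB lc.
have c0 : 0 <= c by apply: le_trans lc.
have B0 : 0 <= B by apply: le_trans hB.
pose d := - (2 * dotp h l + dotp l l).
have qE : e - dotp (h + l) (h + l) = e - dotp h h + d.
  by rewrite /d dotpDr (dotpC (h + l) h) (dotpC (h + l) l) !dotpDr (dotpC l h); ring.
have hl : `|dotp h l| <= n%:R * B * c.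
  by apply: le_trans (dotp_le h l) _; rewrite -!mulrA ler_wpM2l// ler_pM.
have ll : dotp l l <= n%:R * c ^+ 2.
  apply: le_trans (ler_norm _) _; apply: le_trans (dotp_le l l) _.
  by rewrite -mulrA ler_wpM2l// expr2 ler_pM.
have ll0 := dotp_ge0 l.
have dle : `|d| <= 2 * n%:R * B * c + n%:R * c ^+ 2.
  rewrite /d normrN; apply: le_trans (ler_normD _ _) _.
  rewrite (ger0_norm ll0) normrM ger0_norm// lerD//.
  by rewrite (_ : 2 * n%:R * B * c = 2 * (n%:R * B * c)) ?ler_pM2l//; ring.
have d2 : d ^+ 2 <= (2 * n%:R * B * c + n%:R * c ^+ 2) ^+ 2.
  by rewrite -[d ^+ 2]real_normK ?num_real// lerXn2r ?nnegrE// (le_trans _ dle).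
have /andP[m0 me] := max0_le h e0.
have rem := sqpos_remainder (e - dotp h h) d.
rewrite /bump qE.
rewrite (_ : _ - dbump e h l = Num.max 0 (e - dotp h h + d) ^+ 2 - Num.max 0 (e - dotp h h) ^+ 2 -
   2 * Num.max 0 (e - dotp h h) * d - 2 * Num.max 0 (e - dotp h h) * dotp l l); last first.
  by rewrite /dbump /d; ring.
apply: le_trans (ler_normB _ _) _; apply: lerD; first exact: le_trans rem d2.
rewrite ger0_norm ?mulr_ge0// -mulrA -[leRHS]mulrA ler_pM2l//.
exact: ler_pM.
Qed.

Lemma measurable_dotp d (T : measurableType d) (f g : T -> V) :
  measurable_fun [set: T] f -> measurable_fun [set: T] g ->
  measurable_fun [set: T] (fun t : T => dotp (f t) (g t)).
Proof.
move=> /measurable_fun_rVP mf /measurable_fun_rVP mg.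
apply: measurable_sum => j; apply: measurable_funM; [exact: mf|exact: mg].
Qed.

Lemma measurable_posdotp e d (T : measurableType d) (f : T -> V) : measurable_fun [set: T] f ->
  measurable_fun [set: T] (fun t : T => Num.max 0 (e - dotp (f t) (f t))).
Proof.
move=> mf; apply: measurable_maxr (measurable_cst _) _.
exact: measurable_funB (measurable_cst _) (measurable_dotp mf mf).
Qed.

Lemma measurable_bump e d (T : measurableType d) (f : T -> V) : measurable_fun [set: T] f ->
  measurable_fun [set: T] (fun t : T => bump e (f t)).
Proof. by move=> mf; apply: measurable_funX; exact: measurable_posdotp. Qed.

Lemma measurable_dbump e d (T : measurableType d) (f g : T -> V) :
  measurable_fun [set: T] f -> measurable_fun [set: T] g ->
  measurable_fun [set: T] (fun t : T => dbump e (f t) (g t)).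
Proof.
move=> mf mg; apply: measurable_funM.
  exact: measurable_funM (measurable_cst _) (measurable_posdotp _ mf).
by apply: measurableT_comp => //; exact: measurable_funM (measurable_cst _) (measurable_dotp mf mg).
Qed.

End inner_product.

Section mollification.
Variables (R : realType) (N : nat).
Local Notation mu := (hmu R N).
Local Notation H := (heis R N).
Local Notation n := (N + N).+1.
Variables (W : H -> R) (Y e : R).
Hypotheses (mW : measurable_fun [set: H] W) (WY : forall y, W y != 0 -> `|y| <= Y)
  (W_fin : (\int[mu]_y (`|W y|)%:E < +oo)%E) (Y0 : 0 <= Y) (e0 : 0 < e).
Implicit Types (x y v z g : H) (c : R).

(** The linear part of right multiplication by z, which is an affine map. *)
Definition hlin z v : H := v + hform v z *: @hdelta R N ord_max.

Lemma hmul_addl x v z : hmul (x + v) z = hmul x z + hlin z v.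
Proof.
apply/rowP => j; rewrite hmulE !mxE -/(hform x z).
have -> : hform (x + v) z = hform x z + hform v z.
  by rewrite hformC -[x + v]opprK opprD hformNr hformBr hformNr !(hformC _ z); ring.
by rewrite -/(hz _ _) /=; case: (j == ord_max) => /=; rewrite ?mulr1 ?mulr0; ring.
Qed.

Lemma hlin_linear z c a b : hlin z (c *: a + b) = c *: hlin z a + hlin z b.
Proof.
have -> : hlin z (c *: a + b) = c *: a + b + (c * hform a z + hform b z) *: @hdelta R N ord_max.
  congr (_ + _ *: _); rewrite -hformZl hformC -[_ + b]opprK opprD hformNr hformBr hformNr.
  by rewrite !(hformC _ z); ring.
by rewrite /hlin scalerDr scalerDl scalerA addrACA.
Qed.

Lemma hdelta_le j : `|@hdelta R N j| <= 1.
Proof.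
apply: mx_norm_le => // k; rewrite mxE /=; case: (_ == _) => /=; by rewrite ?normr1 ?normr0.
Qed.

Lemma hform_norm x y : `|hform x y| <= N%:R * (`|x| * `|y|).
Proof. by apply: hform_le => // i; exact: mx_norm_coord. Qed.

Lemma hlin_le z v : `|z| <= Y -> `|hlin z v| <= (1 + N%:R * Y) * `|v|.
Proof.
move=> zY; apply: le_trans (ler_normD _ _) _; rewrite mulrDl mul1r lerD2l.
rewrite normrZ; apply: le_trans (_ : `|hform v z| * 1 <= _).
  by rewrite ler_wpM2l// hdelta_le.
rewrite mulr1; apply: le_trans (hform_norm v z) _.
by rewrite -mulrA ler_wpM2l// mulrC ler_wpM2r.
Qed.

Lemma hmul_norm x z : `|hmul x z| <= `|x| + `|z| + N%:R * (`|x| * `|z|).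
Proof.
apply: mx_norm_le => [|j]; first by rewrite !addr_ge0// !mulr_ge0.
rewrite hmulE; apply: le_trans (ler_normD _ _) _; apply: lerD.
  by apply: le_trans (ler_normD _ _) _; apply: lerD; exact: mx_norm_coord.
by case: ifP => _; [exact: hform_norm|rewrite normr0 !mulr_ge0].
Qed.

(** The variable x occurs in the profile only, whence regularity; with h = x
    y^-1 the integral is also an average of left translates of W, whence control
    of the energy. *)
Definition mollify x : R := \int[mu]_y (bump e (hmul x (- y)) * W y).
Definition dmollify x v : R := \int[mu]_y (dbump e (hmul x (- y)) (hlin (- y) v) * W y).

Let mhmulN x : measurable_fun [set: H] (fun y => hmul x (- y)).
Proof. by apply: measurable_fun_hmul; [exact: measurable_cst|exact: measurable_fun_hopp]. Qed.

Let mhlin v : measurable_fun [set: H] (fun y => hlin (- y) v).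
Proof.
apply/measurable_fun_rVP => j.
rewrite (_ : _ \o _ = fun y => v 0 j + hform v (- y) * @hdelta R N ord_max 0 j); last first.
  by apply/funext => y; rewrite /coord_rV /= !mxE.
apply: measurable_funD (measurable_cst _) _; apply: measurable_funM (measurable_cst _).
by apply: measurable_fun_hform; [exact: measurable_cst|exact: measurable_fun_hopp].
Qed.

Let mb x : measurable_fun [set: H] (fun y => bump e (hmul x (- y)) * W y).
Proof. exact: measurable_funM (measurable_bump e (mhmulN x)) mW. Qed.
Let mdb x v : measurable_fun [set: H] (fun y => dbump e (hmul x (- y)) (hlin (- y) v) * W y).
Proof. exact: measurable_funM (measurable_dbump e (mhmulN x) (mhlin v)) mW. Qed.
Let mnW : measurable_fun [set: H] (fun y => `|W y|).
Proof. exact: measurableT_comp. Qed.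

Let integrable_le (h : H -> R) c : 0 <= c -> measurable_fun [set: H] h ->
  (forall y, `|h y| <= c * `|W y|) -> mu.-integrable [set: H] (EFin \o h).
Proof.
move=> c0 mh hc; apply: (dominated_int mh (measurable_funM (measurable_cst c) mnW) hc).
rewrite (rintZ mu mnW c0) ?lte_mul_pinfty//.
Qed.

Lemma mollify_integrable x : mu.-integrable [set: H] (EFin \o (fun y => bump e (hmul x (- y)) * W y)).
Proof.
apply: (@integrable_le _ (e ^+ 2)) => // [|y]; first exact: sqr_ge0.
by rewrite normrM ger0_norm ?bump_ge0// ler_wpM2r// bump_le// ltW.
Qed.

Let hB x y : W y != 0 -> `|hmul x (- y)| <= `|x| + Y + N%:R * (`|x| * Y).
Proof.
move=> /WY yY; apply: le_trans (hmul_norm _ _) _; rewrite normrN.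
by rewrite lerD ?lerD2l// ler_wpM2l// ler_wpM2l.
Qed.

Let dmollify_integrable x v : mu.-integrable [set: H]
  (EFin \o (fun y => dbump e (hmul x (- y)) (hlin (- y) v) * W y)).
Proof.
pose B := `|x| + Y + N%:R * (`|x| * Y).
have B0 : 0 <= B by rewrite !addr_ge0// !mulr_ge0.
have c0 : 0 <= 4 * e * (n%:R * B * ((1 + N%:R * Y) * `|v|)).
  by rewrite !mulr_ge0 ?addr_ge0 ?mulr_ge0 ?(ltW e0).
apply: (integrable_le c0 (mdb x v)) => y; rewrite normrM.
have [->|Wy] := eqVneq (W y) 0; first by rewrite normr0 !mulr0.
rewrite ler_wpM2r//; apply: le_trans (dbump_le _ _ (ltW e0)) _.
have yY : `|- y| <= Y by rewrite normrN; exact: WY.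
rewrite ler_wpM2l ?mulr_ge0 ?(ltW e0)// ler_pM ?mulr_ge0//; last exact: hlin_le.
by rewrite ler_wpM2l//; exact: hB.
Qed.

(** The quadratic remainder of the profile is uniform for y in the bounded
    support of W, so integration gives a quadratic remainder for the
    convolution. *)
Lemma mollify_C1 : Ck 1 mollify.
Proof.
apply: (Ck1_of_quadratic (D := dmollify)) => [x c a b|X].
  rewrite /dmollify -RintegralZl// -RintegralD//; last first.
    by have := integrableZl measurableT c (dmollify_integrable x a).
  apply: eq_Rintegral => y _; rewrite hlin_linear /dbump dotpDr dotpZr; ring.
pose B := `|X| + Y + N%:R * (`|X| * Y); pose k := 1 + N%:R * Y.
have k0 : 0 <= k by rewrite addr_ge0// mulr_ge0.
have B0 : 0 <= B by rewrite !addr_ge0// !mulr_ge0.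
pose C := (2 * n%:R * B * k + n%:R * k ^+ 2) ^+ 2 + 2 * e * (n%:R * k ^+ 2).
exists (C * \int[mu]_y `|W y|) => x v xX v1.
pose F y := bump e (hmul (x + v) (- y)) * W y - bump e (hmul x (- y)) * W y.
have iF : mu.-integrable [set: H] (EFin \o F).
  have := integrableB measurableT (mollify_integrable (x + v)) (mollify_integrable x).
  by apply: eq_integrable => // y _ /=; rewrite EFinB.
pose E y := F y - dbump e (hmul x (- y)) (hlin (- y) v) * W y.
have iE : mu.-integrable [set: H] (EFin \o E).
  have := integrableB measurableT iF (dmollify_integrable x v).
  by apply: eq_integrable => // y _ /=; rewrite EFinB.
have -> : mollify (x + v) - mollify x - dmollify x v = \int[mu]_y E y.
  rewrite /E RintegralB// /F RintegralB//; exact: mollify_integrable.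
have inW : mu.-integrable [set: H] (EFin \o (fun y => `|W y|)).
  by apply: (@integrable_le _ 1) => // y; rewrite mul1r normr_id.
apply: le_trans (le_normr_Rintegral measurableT iE) _.
rewrite mulrAC -RintegralZl//; apply: le_Rintegral => //.
- apply: (dominated_int (g := fun y => `|E y|)) => //.
  + by apply: measurableT_comp => //; case/integrableP: iE => /measurable_EFinP.
  + by apply: measurableT_comp => //; case/integrableP: iE => /measurable_EFinP.
  + by move=> y; rewrite normr_id.
  + by case/integrableP: iE => _.
- by have := integrableZl measurableT (C * `|v| ^+ 2) inW.
- move=> y _; rewrite /E /F -!mulrBl normrM.
  have [->|Wy] := eqVneq (W y) 0; first by rewrite normr0 !mulr0.
  rewrite ler_wpM2r// hmul_addl.
  have yY : `|- y| <= Y by rewrite normrN; exact: WY.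
  have hBx : `|hmul x (- y)| <= B.
    apply: le_trans (hB x Wy) _; have xX' : `|x| <= `|X| by apply: le_trans xX (ler_norm X).
    by rewrite lerD ?lerD2r// ler_wpM2l// ler_wpM2r.
  apply: le_trans (bump_remainder (ltW e0) hBx (hlin_le v yY)) _.
  apply: remainder_scaling => //; first exact: mulr_ge0 (mulr_ge0 (ler0n _ 2) (ler0n _ n)) B0.
Qed.

End mollification.

Section jensen.
Context d (T : measurableType d) (R : realType) (nu : {measure set T -> \bar R}).
Variables (p : R) (b : T -> R).
Hypotheses (p_gt1 : 1 < p) (mb : measurable_fun [set: T] b) (b0 : forall x, 0 <= b x)
  (b1 : (\int[nu]_x (b x)%:E = 1)%E).

(** Integrate [pw_tangent] at the mean value. *)
Lemma jensen_pw (g : T -> R) : measurable_fun [set: T] g ->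
  nu.-integrable [set: T] (EFin \o (fun x => b x * g x)) ->
  ((pw p (\int[nu]_x (b x * g x)))%:E <= \int[nu]_x (b x * pw p (g x))%:E)%E.
Proof.
move=> mg ig; set a := \int[nu]_x (b x * g x).
have mpg : measurable_fun [set: T] (fun x => b x * pw p (g x)).
  exact: measurable_funM mb (measurableT_comp (@measurable_pw R p) mg).
have p0 x : 0 <= b x * pw p (g x) by rewrite mulr_ge0 ?pw_ge0.
have [->|fin] := eqVneq (\int[nu]_x (b x * pw p (g x))%:E)%E (+oo)%E; first by rewrite leey.
have ip : nu.-integrable [set: T] (EFin \o (fun x => b x * pw p (g x))).
  apply: (dominated_int mpg mpg) => [x|]; first by rewrite ger0_norm.
  by rewrite lt_neqAle fin leey.
have ib : nu.-integrable [set: T] (EFin \o b).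
  by apply: (dominated_int mb mb) => [x|]; [rewrite ger0_norm|rewrite b1 ltry].
have rb : \int[nu]_x b x = 1 by rewrite /Rintegral b1.
rewrite (rint_real ip) lee_fin.
have i1 := integrableZl measurableT (pw p a - p * Jp p a * a) ib.
have i2 := integrableZl measurableT (p * Jp p a) ig.
have -> : pw p a = \int[nu]_x ((pw p a - p * Jp p a * a) * b x + p * Jp p a * (b x * g x)).
  by rewrite RintegralD// !RintegralZl// rb -/a; ring.
apply: le_Rintegral => //.
  by have := integrableD measurableT i1 i2; apply: eq_integrable => // x _ /=; rewrite EFinD.
move=> x _; have := ler_wpM2l (b0 x) (pw_tangent p_gt1 a (g x)).
by apply: le_trans; rewrite le_eqVlt; apply/orP; left; apply/eqP; ring.
Qed.

End jensen.

Section bump_mass.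
Variables (R : realType) (N : nat) (e : R).
Local Notation mu := (hmu R N).
Local Notation H := (heis R N).
Local Notation n := (N + N).+1.
Hypothesis e0 : 0 < e.

Lemma measurable_bumpH : measurable_fun [set: H] (bump e : H -> R).
Proof. exact: measurable_bump. Qed.

Lemma bump_mass_fin : (\int[mu]_h (bump e h)%:E < +oo)%E.
Proof.
have r1 : 1 <= 1 + e by rewrite lerDl ltW.
have r0 : 0 < 1 + e by apply: lt_le_trans ltr01 r1.
have mA := @measurable_hcube R N (1 + e).
have i0 (x : H) : 0 <= \1_(@hcube R N (1 + e)) x :> R by [].
apply: (@le_lt_trans _ _ ((e ^+ 2)%:E * mu (@hcube R N (1 + e)))%E).
  rewrite -(rint_indic mu mA) -(rintZ mu (measurable_indic mA) (sqr_ge0 e) i0).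
  apply: rint_le; [exact: measurable_bumpH|exact: measurable_funM (measurable_cst _) (measurable_indic mA)|by move=> x; exact: bump_ge0|].
  move=> h; have [->|b0] := eqVneq (bump e h) 0; first by rewrite mulr_ge0 ?sqr_ge0.
  rewrite indicE mem_set ?mulr1; first exact: bump_le (ltW e0).
  move=> j; have hj := bump_supp j b0.
  have hj1 : `|h 0 j| <= 1 + e.
    have : `|h 0 j| ^+ 2 < e by rewrite real_normK ?num_real.
    by have := normr_ge0 (h 0 j); move: `|h 0 j| => t; nra.
  have hj2 : 1 + e <= (1 + e) ^+ 2 by rewrite expr2 ler_peMl// ltW.
  have : `|h 0 j| <= if j == ord_max then (1 + e) ^+ 2 else 1 + e.
    by case: ifP => // _; exact: le_trans hj1 hj2.
  by rewrite in_itv /= -ler_norml.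
by rewrite (hmu_hcube N r0) -EFinM ltry.
Qed.

Lemma bump_mass_gt0 : (0 < \int[mu]_h (bump e h)%:E)%E.
Proof.
rewrite ltNge; apply/negP => h0.
have [A [mA muA sA]] := rint_eq0 measurable_bumpH (bump_ge0 e) h0.
have n0 : 0 < n%:R :> R by rewrite ltr0Sn.
pose r := Num.min 1 (e / (2 * n%:R)).
have r0 : 0 < r by rewrite lt_min ltr01 divr_gt0// mulr_gt0.
have r1 : r <= 1 by rewrite ge_min lexx.
have re : n%:R * r <= e / 2.
  have : r <= e / (2 * n%:R) by rewrite ge_min lexx orbT.
  by rewrite invfM mulrA ler_pdivlMr// mulrC.
have : (mu (@hbox R N r) <= mu A)%E.
  apply: le_measure; rewrite ?inE//; first exact: measurable_hbox.
  move=> z rz; apply: sA => /= bz.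
  have q : dotp z z <= n%:R * r.
    rewrite /dotp; apply: (@le_trans _ _ (\sum_(j < n) r)); last by rewrite sumr_const card_ord mulr_natl.
    apply: ler_sum => j _; have := rz j; rewrite in_itv /= => /andP[z0 zr].
    have zr1 : z 0 j <= r.
      by move: zr; case: ifP => // _ zr; apply: le_trans zr _; rewrite expr2 ler_piMl// ltW.
    have z1 : z 0 j <= 1 by exact: le_trans zr1 r1.
    by apply: le_trans zr1; rewrite ler_piMl// ltW.
  have : 0 < e - dotp z z by have := e0; have := re; have := q; lra.
  by move=> qe; move: bz; rewrite /bump max_r ?ltW// => /eqP; rewrite sqrf_eq0 gt_eqF.
rewrite muA (hmu_hbox N r0) lee_fin leNgt => /negP; apply; exact: exprn_gt0.
Qed.

End bump_mass.

Section double_measure.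
Variables (R : realType) (N : nat).
Local Notation mu := (hmu R N).
Local Notation H := (heis R N).

(** The product measure under a name that carries the sigma-finite structure
    needed by Tonelli's theorem on (H * H) * H. *)
Definition hmu2 : set (H * H) -> \bar R := (mu \x mu)%E.
HB.instance Definition _ := Measure.on hmu2.

Lemma sigma_finite_hmu2 : sigma_finite setT hmu2.
Proof.
have /sigma_finiteP[F [TF ndF Foo]] := sigma_finiteT mu.
exists (fun n => F n `*` F n).
  rewrite -setXTT TF predeqE => -[x y]; split; last first.
    by move=> [n _ []/= ? ?]; split; exists n.
  move=> [/= [n _ Fnx] [k _ Fky]]; exists (maxn n k) => //; split.
    by move: x Fnx; exact/subsetPset/ndF/leq_maxl.
  by move: y Fky; exact/subsetPset/ndF/leq_maxr.
move=> k; have [mF Fk] := Foo k; split; first exact: measurableX.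
rewrite [ltLHS](product_measure1E mu mu mF mF).
by rewrite lte_mul_pinfty// ge0_fin_numE.
Qed.

HB.instance Definition _ := Measure_isSigmaFinite.Build _ _ _ hmu2 sigma_finite_hmu2.

Lemma tonelli_hmu2 (P : (H * H) * H -> R) : measurable_fun [set: (H * H) * H] P ->
  (forall z, 0 <= P z) ->
  (\int[(mu \x mu)%E]_z \int[mu]_h (P (z, h))%:E = \int[mu]_h \int[(mu \x mu)%E]_z (P (z, h))%:E)%E.
Proof.
move=> mP P0; apply: (@fubini_tonelli _ _ _ _ _ hmu2 mu (fun z => (P z)%:E)).
  exact/measurable_EFinP.
by move=> z; rewrite lee_fin.
Qed.

End double_measure.

Section smoothing.
Variables (R : realType) (N : nat) (s p : R).
Local Notation mu := (hmu R N).
Local Notation H := (heis R N).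
Hypotheses (p_gt1 : 1 < p).
Variables (W : H -> R) (Y e : R).
Hypotheses (mW : measurable_fun [set: H] W) (W0 : forall x, 0 <= W x)
  (WY : forall y, W y != 0 -> `|y| <= Y)
  (W_fin : (\int[mu]_y (W y)%:E < +oo)%E) (Y0 : 0 <= Y) (e0 : 0 < e).

Let c := fine (\int[mu]_h (bump e h)%:E)%E.
Let cE : (\int[mu]_h (bump e h)%:E)%E = c%:E.
Proof.
by rewrite /c fineK// ge0_fin_numE ?(bump_mass_fin N e0)//; apply: rint_ge0 => h; exact: bump_ge0.
Qed.
Let c0 : 0 < c. Proof. by rewrite -lte_fin -cE; exact: bump_mass_gt0. Qed.

Let b (h : H) := c^-1 * bump e h.
Let b_ge0 h : 0 <= b h. Proof. by rewrite mulr_ge0 ?bump_ge0// invr_ge0 ltW. Qed.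
Let mb : measurable_fun [set: H] b.
Proof. exact: measurable_funM (measurable_cst _) (@measurable_bumpH R N e). Qed.
Let b1 : (\int[mu]_h (b h)%:E = 1)%E.
Proof.
have ci : 0 <= c^-1 by rewrite invr_ge0 ltW.
by rewrite (rintZ mu (@measurable_bumpH R N e) ci (bump_ge0 e)) cE -EFinM mulVf// gt_eqF.
Qed.

Let W' y := c^-1 * W y.
Let mW' : measurable_fun [set: H] W'. Proof. exact: measurable_funM (measurable_cst _) mW. Qed.
Let W'0 y : 0 <= W' y. Proof. by rewrite mulr_ge0// invr_ge0 ltW. Qed.
Let W'Y y : W' y != 0 -> `|y| <= Y.
Proof. by move=> h; apply: WY; apply: contra_neq h; rewrite /W' => ->; rewrite mulr0. Qed.
Let W'fin : (\int[mu]_y (`|W' y|)%:E < +oo)%E.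
Proof.
under eq_integral do rewrite ger0_norm//.
have ci : 0 <= c^-1 by rewrite invr_ge0 ltW.
by rewrite (rintZ mu mW ci W0) lte_mul_pinfty.
Qed.

Definition smoothing : H -> R := mollify W' e.

Lemma smoothing_C1 : Ck 1 smoothing.
Proof. exact: mollify_C1 mW' W'Y W'fin Y0 e0. Qed.

Let mshift x : measurable_fun [set: H] (fun h => W (hmul (- h) x)).
Proof.
by apply: (measurableT_comp mW); apply: measurable_fun_hmul; [exact: measurable_fun_hopp|exact: measurable_cst].
Qed.

Let mbW x : measurable_fun [set: H] (fun h => b h * W (hmul (- h) x)).
Proof. exact: measurable_funM mb (mshift x). Qed.

Let bW_ge0 x h : 0 <= b h * W (hmul (- h) x). Proof. exact: mulr_ge0. Qed.

(** Substitute y = h^-1 x. *)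
Lemma smoothing_average x : smoothing x = \int[mu]_h (b h * W (hmul (- h) x)) /\
  mu.-integrable [set: H] (EFin \o (fun h => b h * W (hmul (- h) x))).
Proof.
have E : (\int[mu]_h (b h * W (hmul (- h) x))%:E = \int[mu]_y (bump e (hmul x (- y)) * W' y)%:E)%E.
  have mF : measurable_fun [set: H] (fun h => (b h * W (hmul (- h) x))%:E) by exact/measurable_EFinP.
  have F0 h : (0 <= (b h * W (hmul (- h) x))%:E)%E by rewrite lee_fin.
  rewrite -(integral_hmulNr mF F0 x); apply: eq_integral => y _.
  by rewrite hmulN opprK -hmulA hmulNx hmulx0 /b /W'; congr (_ %:E); ring.
split; first by rewrite /smoothing /mollify /Rintegral E.
have iW := mollify_integrable mW' W'fin e0 x.
apply: (dominated_int (mbW x) (mbW x)) => [h|]; first by rewrite ger0_norm.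
by rewrite E; exact: integrable_lty.
Qed.

Lemma smoothing_ge0 x : 0 <= smoothing x.
Proof.
by have [-> _] := smoothing_average x; apply: fine_ge0; apply: rint_ge0 => h.
Qed.

Lemma smoothing_supp x : smoothing x != 0 ->
  exists2 h : H, forall j, h 0 j ^+ 2 < e & W (hmul (- h) x) != 0.
Proof.
move=> sx; apply: contrapT => no; move/eqP: sx; apply.
have [-> _] := smoothing_average x; rewrite /Rintegral integral0_eq// => h _.
congr (_ %:E).
have [->|Wh] := eqVneq (W (hmul (- h) x)) 0; first by rewrite mulr0.
have [->|bh] := eqVneq (b h) 0; first by rewrite mul0r.
case: no; exists h => // j; apply: bump_supp.
by apply: contra_neq bh; rewrite /b => ->; rewrite mulr0.
Qed.

Lemma continuous_smoothing : continuous smoothing.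
Proof. by move=> x; apply: differentiable_continuous; case: smoothing_C1 => + _. Qed.

Lemma measurable_smoothing : measurable_fun [set: H] smoothing.
Proof. exact: continuous_measurable_rV continuous_smoothing. Qed.

(** Jensen's inequality at each pair of points and Tonelli's theorem: the energy
    of an average of left translates is at most the average of their energies,
    and these are all equal to the energy of W. *)
Lemma gagliardo_smoothing : (gagliardo s p smoothing <= gagliardo s p W)%E.
Proof.
pose P (z : (H * H) * H) := b z.2 * pw p (W (hmul (- z.2) z.1.1) - W (hmul (- z.2) z.1.2)) * hkernel s p z.1.
have mh1 : measurable_fun [set: (H * H) * H] (fun z : (H * H) * H => hmul (- z.2) z.1.1).
  apply: measurable_fun_hmul; first exact: measurable_fun_hopp.
  exact: measurableT_comp measurable_fst measurable_fst.
have mh2 : measurable_fun [set: (H * H) * H] (fun z : (H * H) * H => hmul (- z.2) z.1.2).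
  apply: measurable_fun_hmul; first exact: measurable_fun_hopp.
  exact: measurableT_comp measurable_snd measurable_fst.
have mP : measurable_fun [set: (H * H) * H] P.
  apply: measurable_funM; last exact: measurableT_comp (@measurable_hkernel R N s p) measurable_fst.
  apply: measurable_funM; first exact: measurableT_comp mb measurable_snd.
  apply: (measurableT_comp (@measurable_pw R p)).
  exact: measurable_funB (measurableT_comp mW mh1) (measurableT_comp mW mh2).
have P0 z : 0 <= P z by exact: mulr_ge0 (mulr_ge0 (b_ge0 _) (pw_ge0 _ _)) (hkernel_ge0 _ _ _).
have mPE : measurable_fun [set: (H * H) * H] (fun z => (P z)%:E) by exact/measurable_EFinP.
have P0E z : (0 <= (P z)%:E)%E by rewrite lee_fin.
have step1 z : ((pw p (smoothing z.1 - smoothing z.2) * hkernel s p z)%:E <= \int[mu]_h (P (z, h))%:E)%E.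
  have [E1 i1] := smoothing_average z.1; have [E2 i2] := smoothing_average z.2.
  pose g h := W (hmul (- h) z.1) - W (hmul (- h) z.2).
  have mg : measurable_fun [set: H] g by exact: measurable_funB.
  have ig : mu.-integrable [set: H] (EFin \o (fun h => b h * g h)).
    by have := integrableB measurableT i1 i2; apply: eq_integrable => // h _ /=; rewrite -EFinB mulrBr.
  have E : smoothing z.1 - smoothing z.2 = \int[mu]_h (b h * g h).
    by rewrite E1 E2 -RintegralB//; apply: eq_Rintegral => h _; rewrite /g mulrBr.
  have J := jensen_pw p_gt1 mb b_ge0 b1 mg ig.
  have mbg : measurable_fun [set: H] (fun h => b h * pw p (g h)).
    exact: measurable_funM mb (measurableT_comp (@measurable_pw R p) mg).
  have bg0 h : 0 <= b h * pw p (g h) by rewrite mulr_ge0 ?pw_ge0.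
  have -> : (\int[mu]_h (P (z, h))%:E)%E = ((hkernel s p z)%:E * \int[mu]_h (b h * pw p (g h))%:E)%E.
    rewrite -(rintZ mu mbg (hkernel_ge0 s p z) bg0); apply: eq_integral => h _.
    by congr (_ %:E); rewrite /P /g /=; ring.
  by rewrite mulrC EFinM E lee_wpmul2l// lee_fin hkernel_ge0.
rewrite gagliardoE; apply: (@le_trans _ _ (\int[(mu \x mu)%E]_z \int[mu]_h (P (z, h))%:E)%E).
  apply: ge0_le_integral => //.
  - by move=> z _; rewrite lee_fin mulr_ge0 ?pw_ge0 ?hkernel_ge0.
  - apply/measurable_EFinP.
    exact: measurable_funM (measurable_pwdiff p measurable_smoothing) (@measurable_hkernel R N s p).
  - exact: (measurable_fun_fubini_tonelli_F (m2 := mu) (fun z => (P z)%:E)).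
rewrite (tonelli_hmu2 mP P0).
have GW h : (\int[(mu \x mu)%E]_z (P (z, h))%:E = (b h)%:E * gagliardo s p W)%E.
  have mWh : measurable_fun [set: H] (fun x => W (hmul (- h) x)) by exact: measurableT_comp mW (measurable_hmull _).
  rewrite -(gagliardo_hmull s p (- h) mW) gagliardoE.
  rewrite -(dKZ s p (measurable_pwdiff p mWh) (b_ge0 h) (fun z => pw_ge0 p _)).
  by apply: eq_integral => z _.
under eq_integral do rewrite GW.
rewrite ge0_integralZr//; [by rewrite b1 mul1e|exact/measurable_EFinP| |exact: gagliardo_ge0].
by move=> h _; rewrite lee_fin.
Qed.

(** Jensen's inequality again, now for the distance in L^p from W to its
    translates. *)
Lemma smoothing_close (D : \bar R) :
  (forall h : H, (forall j, h 0 j ^+ 2 < e) ->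
    (\int[mu]_x (pw p (W (hmul (- h) x) - W x))%:E <= D)%E) ->
  (\int[mu]_x (pw p (smoothing x - W x))%:E <= D)%E.
Proof.
move=> HD; pose P (z : H * H) := b z.2 * pw p (W (hmul (- z.2) z.1) - W z.1).
have mP : measurable_fun [set: H * H] P.
  apply: measurable_funM; first exact: measurableT_comp mb measurable_snd.
  apply: (measurableT_comp (@measurable_pw R p)); apply: measurable_funB.
    apply: (measurableT_comp mW); apply: measurable_fun_hmul; last exact: measurable_fst.
    by apply: measurable_fun_hopp; exact: measurable_snd.
  exact: measurableT_comp mW measurable_fst.
have P0 z : 0 <= P z by rewrite mulr_ge0 ?pw_ge0.
have mPE : measurable_fun [set: H * H] (fun z => (P z)%:E) by exact/measurable_EFinP.
have P0E z : (0 <= (P z)%:E)%E by rewrite lee_fin.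
have D0 : (0 <= D)%E.
  have h0 j : (0 : H) 0 j ^+ 2 < e by rewrite mxE expr0n.
  by apply: le_trans (HD 0 h0); apply: rint_ge0 => x; exact: pw_ge0.
have step1 x : ((pw p (smoothing x - W x))%:E <= \int[mu]_h (P (x, h))%:E)%E.
  have [E1 i1] := smoothing_average x.
  pose g h := W (hmul (- h) x) - W x.
  have mg : measurable_fun [set: H] g by exact: measurable_funB (mshift x) (measurable_cst _).
  have ib : mu.-integrable [set: H] (EFin \o b).
    by apply: (dominated_int mb mb) => [h|]; [rewrite ger0_norm|rewrite b1 ltry].
  have i2 := integrableZl measurableT (W x) ib.
  have ig : mu.-integrable [set: H] (EFin \o (fun h => b h * g h)).
    have := integrableB measurableT i1 i2; apply: eq_integrable => // h _ /=.
    by rewrite -EFinD /g mulrBr (mulrC (W x)).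
  have rb : \int[mu]_h b h = 1 by rewrite /Rintegral b1.
  have E : smoothing x - W x = \int[mu]_h (b h * g h).
    rewrite E1 -[W x in LHS]mulr1 -rb -RintegralZl// -RintegralB//.
    by apply: eq_Rintegral => h _; rewrite /g mulrBr (mulrC (W x)).
  have J := jensen_pw p_gt1 mb b_ge0 b1 mg ig.
  by rewrite E; exact: J.
apply: (@le_trans _ _ (\int[mu]_x \int[mu]_h (P (x, h))%:E)%E).
  apply: ge0_le_integral => //.
  - by move=> x _; rewrite lee_fin pw_ge0.
  - apply/measurable_EFinP; apply: (measurableT_comp (@measurable_pw R p)).
    exact: measurable_funB measurable_smoothing mW.
  - exact: (measurable_fun_fubini_tonelli_F (m2 := mu) (fun z => (P z)%:E)).
rewrite (@fubini_tonelli _ _ _ _ _ mu mu (fun z => (P z)%:E) mPE P0E).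
apply: (@le_trans _ _ (\int[mu]_h ((b h)%:E * D))%E); last first.
  rewrite ge0_integralZr//; [by rewrite b1 mul1e|exact/measurable_EFinP|].
  by move=> h _; rewrite lee_fin.
apply: ge0_le_integral => //.
- by move=> h _; apply: integral_ge0.
- exact: (measurable_fun_fubini_tonelli_G (m1 := mu) (fun z => (P z)%:E)).
- by apply: emeasurable_funM; [exact/measurable_EFinP|exact: measurable_cst].
- move=> h _; have mWh : measurable_fun [set: H] (fun x => pw p (W (hmul (- h) x) - W x)).
    apply: (measurableT_comp (@measurable_pw R p)).
    exact: measurable_funB (measurableT_comp mW (measurable_hmull _)) mW.
  rewrite (rintZ mu mWh (b_ge0 h) (fun x => pw_ge0 p _)).
  have [->|bh] := eqVneq (b h) 0; first by rewrite !mul0e.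
  rewrite lee_wpmul2l ?lee_fin// HD// => j; apply: bump_supp.
  by apply: contra_neq bh; rewrite /b => ->; rewrite mulr0.
Qed.

End smoothing.

(** * Approximation by compactly supported functions *)

Section minimum_of_translates.
Variables (R : realType) (N : nat) (s p : R).
Local Notation mu := (hmu R N).
Local Notation H := (heis R N).
Hypothesis p_gt1 : 1 < p.
Implicit Types (w : H -> R) (gs : seq H) (g x y : H).

Lemma min_contraction (a b c d : R) :
  `|Num.min a b - Num.min c d| <= Num.max `|a - c| `|b - d|.
Proof.
rewrite le_max; have [h1|h1] := leP a b; have [h2|h2] := leP c d.
- by rewrite lexx.
- have [h3|h3] := leP a d; apply/orP.
    by left; rewrite !ler0_norm; lra.
  by right; rewrite !ger0_norm; lra.
- have [h3|h3] := leP b c; apply/orP.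
    by right; rewrite !ler0_norm; lra.
  by left; rewrite !ger0_norm; lra.
- by rewrite lexx orbT.
Qed.

Lemma pw_min a b c d : pw p (Num.min a b - Num.min c d) <= pw p (a - c) + pw p (b - d).
Proof.
have := min_contraction a b c d; rewrite le_max => /orP[] h.
  by apply: (le_trans (ler_pw p_gt1 h)); rewrite lerDl pw_ge0.
by apply: (le_trans (ler_pw p_gt1 h)); rewrite lerDr pw_ge0.
Qed.

(** A minimum is supported in the intersection of the translated supports, and
    its energy is at most the sum of the energies. *)
Fixpoint tmin w gs x : R :=
  if gs is g :: gs' then Num.min (w (hmul g x)) (tmin w gs' x) else w x.

Lemma measurable_tmin w gs : measurable_fun [set: H] w -> measurable_fun [set: H] (tmin w gs).
Proof.
move=> mw; elim: gs => [|g gs IH]; first exact: mw.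
exact: measurable_minr (measurableT_comp mw (measurable_hmull g)) IH.
Qed.

Lemma tmin_ge0 w gs x : (forall x, 0 <= w x) -> 0 <= tmin w gs x.
Proof. by move=> w0; elim: gs => //= g gs IH; rewrite le_min w0. Qed.

Lemma tmin_neq0 w gs x : (forall x, 0 <= w x) -> tmin w gs x != 0 ->
  w x != 0 /\ forall g, g \in gs -> w (hmul g x) != 0.
Proof.
move=> w0; elim: gs => [|g gs IH] /=; first by move=> wx; split.
move=> h; have t0 := tmin_ge0 gs x w0; have g0 := w0 (hmul g x).
have tn0 : tmin w gs x != 0 by apply: contra_neq h => ->; rewrite min_r.
have gn0 : w (hmul g x) != 0 by apply: contra_neq h => ->; rewrite min_l.
have [wx gw] := IH tn0; split=> // k; rewrite inE => /predU1P[->//|]; exact: gw.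
Qed.

Lemma gagliardo_tmin w gs : measurable_fun [set: H] w ->
  (gagliardo s p (tmin w gs) <= (size gs).+1%:R%:E * gagliardo s p w)%E.
Proof.
move=> mw; elim: gs => [|g gs IH]; first by rewrite mul1e.
have mg : measurable_fun [set: H] (fun x => w (hmul g x)) := measurableT_comp mw (measurable_hmull g).
have h := @gagliardo_le2 R N s p 1 _ _ _ (measurable_tmin (g :: gs) mw) mg (measurable_tmin gs mw) ler01.
rewrite -[(size (g :: gs)).+1%:R]/((size gs).+2%:R) mulrS EFinD.
rewrite ge0_muleDl ?lee_fin//.
apply: le_trans (h _) _; first by move=> x y; rewrite mul1r; exact: pw_min.
by rewrite mul1e gagliardo_hmull// mul1e leeD2l.
Qed.

Lemma tmin_close w gs (D : R) : measurable_fun [set: H] w ->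
  (forall g, g \in gs -> (\int[mu]_x (pw p (w (hmul g x) - w x))%:E <= D%:E)%E) ->
  (\int[mu]_x (pw p (tmin w gs x - w x))%:E <= ((size gs)%:R * D)%:E)%E.
Proof.
move=> mw; elim: gs => [_|g gs IH hg] /=.
  have p0 : p != 0 by rewrite gt_eqF//; have := p_gt1; lra.
  by rewrite mul0r integral0_eq// => x _; rewrite subrr pw0.
have mg : measurable_fun [set: H] (fun x => w (hmul g x)) := measurableT_comp mw (measurable_hmull g).
have mpw (v : H -> R) : measurable_fun [set: H] v -> measurable_fun [set: H] (fun x => pw p (v x - w x)).
  by move=> mv; apply: (measurableT_comp (@measurable_pw R p)); exact: measurable_funB.
have m1 := mpw _ mg; have m2 := mpw _ (measurable_tmin gs mw).
apply: (@le_trans _ _ (\int[mu]_x (pw p (w (hmul g x) - w x) + pw p (tmin w gs x - w x))%:E)%E).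
  apply: rint_le.
  - exact: mpw (measurable_tmin (g :: gs) mw).
  - exact: measurable_funD m1 m2.
  - by move=> x; exact: pw_ge0.
  - by move=> x; rewrite -[w x in X in X <= _]minxx; exact: pw_min.
rewrite (rintD mu m1 m2 (fun x => pw_ge0 p _) (fun x => pw_ge0 p _)).
rewrite mulrS mulrDl mul1r EFinD; apply: leeD; first by apply: hg; rewrite mem_head.
by apply: IH => k kgs; apply: hg; rewrite inE kgs orbT.
Qed.

Lemma hmul_vec g x : hmul g x = g + x + hform g x *: @hdelta R N ord_max.
Proof.
by apply/rowP => j; rewrite hmulE !mxE /=; case: (j == ord_max) => /=; rewrite ?mulr1 ?mulr0.
Qed.

Lemma continuous_hmull g : continuous (fun x : H => hmul g x).
Proof.
rewrite (_ : (fun x => hmul g x) = (fun x => g + x + hform g x *: @hdelta R N ord_max)); last first.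
  by apply/funext => x; exact: hmul_vec.
move=> x; have Fx := @nbhs_filter _ x.
have c1 : (fun y : H => g + y) @ nbhs x --> g + x by apply: cvgD; [exact: cvg_cst|exact: cvg_id].
have c2 : (fun y : H => hform g y *: @hdelta R N ord_max) @ nbhs x --> hform g x *: @hdelta R N ord_max.
  by apply: cvgZ; [exact: continuous_hform|exact: cvg_cst].
exact: (cvgD c1 c2).
Qed.

End minimum_of_translates.

Section approximation.
Variables (R : realType) (N : nat) (s p : R).
Local Notation mu := (hmu R N).
Local Notation H := (heis R N).
Variable Omega : set H.
Hypotheses (s_gt0 : 0 < s) (s_lt1 : s < 1) (p_gt1 : 1 < p).
Hypotheses (Oopen : open Omega) (Obnd : bounded_set Omega) (Osm : smooth_boundary Omega).
Implicit Types (w : H -> R) (g x y h : H) (A e q r t : R).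

Let pp : 0 < p. Proof. by have := p_gt1; lra. Qed.
Let sp0 : 0 < s * p. Proof. exact: mulr_gt0. Qed.

Lemma small_power A e q : 0 <= A -> 0 < e -> 0 < q ->
  exists2 T, 0 < T <= 1 & forall r, 0 < r -> r <= T -> A * r `^ q <= e.
Proof.
move=> A0 e0 q0; have A1 : 0 < A + 1 by rewrite ltr_wpDl.
have eA : 0 < e / (A + 1) by rewrite divr_gt0.
exists (Num.min 1 ((e / (A + 1)) `^ q^-1)) => [|r r0].
  by rewrite lt_min ltr01 powR_gt0//= ge_min lexx.
rewrite le_min => /andP[_ rT].
have : r `^ q <= e / (A + 1).
  have -> : e / (A + 1) = ((e / (A + 1)) `^ q^-1) `^ q by rewrite -powRrM mulVf ?gt_eqF// powRr1// ltW.
  by rewrite ge0_ler_powR ?nnegrE ?powR_ge0 ?(ltW q0) ?(ltW r0).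
rewrite ler_pdivlMr// => h; apply: le_trans h; rewrite mulrC ler_wpM2l ?powR_ge0//.
by rewrite lerDl.
Qed.

Lemma two_halves A e : 0 < A -> A * (e / (A * 2) + e / (A * 2)) = e.
Proof. by move=> A0; field; rewrite gt_eqF. Qed.

Lemma translation_Wsp : exists2 C : R, 0 < C & forall w g r, Wsp s p Omega w -> 0 < r <= 1 ->
  (forall j, `|g 0 j| <= r ^+ 2) ->
  (\int[mu]_x (pw p (w (hmul g x) - w x))%:E <= (C * r `^ (s * p))%:E * gagliardo s p w)%E.
Proof.
have [Rr R1 OR] := bounded_radius Obnd; have R0 : 0 <= Rr + 1 by lra.
have [C C0 HC] := translation_estimate N s_gt0 p_gt1 R0.
exists C => // w g r [mw wO _] /andP[r0 r1] gr; apply: HC => //; first by rewrite r0.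
have inO x : w x != 0 -> forall i, `|hz x i| <= Rr.
  move=> wx; apply: (hz_domain OR); apply: contrapT => xO.
  by move: wx; rewrite wO// eqxx.
move=> x [/inO h|/inO h] i; first by have := h i; lra.
have := h i; rewrite hz_hmul => h1.
have g1 : `|hz g i| <= 1 by apply: le_trans (gr _) _; rewrite expr2; nra.
have -> : hz x i = (hz g i + hz x i) - hz g i by ring.
by apply: le_trans (ler_normB _ _) _; lra.
Qed.

Lemma Wsp_integrable w : Wsp s p Omega w -> (forall x, 0 <= w x) -> (\int[mu]_x (w x)%:E < +oo)%E.
Proof.
move=> [mw wO Gw] w0; have [C C0 HC] := poincare s_gt0 p_gt1 Oopen Obnd.
have mO := measurable_domain Oopen.
have mpw : measurable_fun [set: H] (fun x => pw p (w x)) := measurableT_comp (@measurable_pw R p) mw.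
apply: (@le_lt_trans _ _ (\int[mu]_x (\1_Omega x + pw p (w x))%:E)%E).
  apply: rint_le => // [|x]; first exact: measurable_funD (measurable_indic mO) mpw.
  have [xO|xO] := pselect (Omega x); last by rewrite wO// addr_ge0 ?pw_ge0.
  rewrite indicE mem_set// pw_ger0//; have [w1|w1] := leP (w x) 1.
    by apply: le_trans w1 _; rewrite lerDl powR_ge0.
  apply: le_trans (le1r_powR (ltW w1) (ltW p_gt1)) _.
  by rewrite lerDr.
rewrite (rintD mu (measurable_indic mO) mpw _ (fun x => pw_ge0 p _))//.
rewrite (rint_indic mu mO); apply: lte_add_pinfty; first exact: hmu_domain.
apply: le_lt_trans (HC w mw wO) _.
by rewrite (gagliardo_fin Gw) -EFinM ltry.
Qed.

Lemma compact_shifts (gs : seq H) : compact (closure Omega `&` [set x | forall g, g \in gs -> closure Omega (hmul g x)]).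
Proof.
apply: (subclosed_compact _ (compact_domain_closure Obnd)); last by move=> x [].
apply: closedI; first exact: closed_closure.
elim: gs => [|g gs IH].
  by rewrite (_ : [set _ | _] = setT); [exact: closedT|apply/seteqP; split].
rewrite (_ : [set _ | _] = (hmul g @^-1` closure Omega) `&` [set x | forall g, g \in gs -> closure Omega (hmul g x)]).
  apply: closedI => //; apply: closed_comp; last exact: closed_closure.
  by move=> x _; exact: (@continuous_hmull R N g).
apply/seteqP; split=> x /=.
  by move=> h; split=> [|k kgs]; apply: h; rewrite inE ?eqxx// kgs orbT.
by move=> [h1 h2] k; rewrite inE => /predU1P[->//|]; exact: h2.
Qed.

Definition shift_card : nat := #|{: 'I_(N + N).+1 * bool}|.

Lemma size_shifts t : size (shifts N t) = shift_card.
Proof. by rewrite size_map -cardE. Qed.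

(** The minimum of w over the shifts has compact support in the domain by
    [shifts_inside], and it is close to w by [translation_estimate]. The
    distance from this support to the complement leaves room for smoothing at a
    small scale. *)
Lemma approximation_step w e : Wsp s p Omega w -> (forall x, 0 <= w x) -> 0 < e ->
  exists phi, [/\ C1c Omega phi, forall x, 0 <= phi x,
    (gagliardo s p phi <= shift_card.+1%:R%:E * gagliardo s p w)%E &
    (\int[mu]_x (pw p (phi x - w x))%:E <= e%:E)%E].
Proof.
move=> Ww w0 e0; have [mw wO Gw] := Ww.
have [C C0 HC] := translation_Wsp.
have [Rr R1 OR] := bounded_radius Obnd.
pose g := fine (gagliardo s p w).
have gE : gagliardo s p w = g%:E by exact: gagliardo_fin.
have g0 : 0 <= g by apply: fine_ge0; exact: gagliardo_ge0.
have p2 : 0 < 2 `^ p * 2 :> R by rewrite mulr_gt0// powR_gt0.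
pose e1 := e / (2 `^ p * 2); have e10 : 0 < e1 by rewrite divr_gt0.
pose L : R := shift_card.+1%:R.
have L0 : 0 <= L by [].
have A0 : 0 <= L * C * g by rewrite !mulr_ge0// ltW.
have [T /andP[T0 T1] HT] := small_power A0 e10 sp0.
have T20 : 0 < T ^+ 2 by rewrite exprn_gt0.
have [t [Ht /andP[t0 tT]]] : exists t : R, (forall x, closure Omega x ->
  (forall g, g \in shifts N t -> closure Omega (hmul g x)) -> Omega x) /\ 0 < t <= T ^+ 2.
  have Hn : \forall t \near (0 : R)^'+, (forall x, closure Omega x ->
    (forall g, g \in shifts N t -> closure Omega (hmul g x)) -> Omega x) /\ 0 < t <= T ^+ 2.
    near=> t; split; first by near: t; exact: shifts_inside.
    by apply/andP; split; near: t; [exact: nbhs_right_gt|exact: nbhs_right_le].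
  have [t Pt] := @filter_ex _ _ (at_right_proper_filter (0 : R)) _ Hn.
  by exists t.
pose W := tmin w (shifts N t).
have mW : measurable_fun [set: H] W := measurable_tmin _ mw.
have W0 x : 0 <= W x := tmin_ge0 _ x w0.
have inO x : w x != 0 -> Omega x.
  by move=> wx; apply: contrapT => xO; move: wx; rewrite wO// eqxx.
pose K := closure Omega `&` [set x | forall g, g \in shifts N t -> closure Omega (hmul g x)].
have WK x : W x != 0 -> K x.
  move=> /(tmin_neq0 w0)[/inO xO gO]; split; first exact: subset_closure.
  by move=> k /gO /inO; exact: subset_closure.
have KO : K `<=` Omega by move=> x [clx gx]; exact: Ht.
have WO x : ~ Omega x -> W x = 0.
  by move=> xO; apply/eqP; apply: contrapT => /negP /WK /KO.
have GW : (gagliardo s p W <= L%:E * gagliardo s p w)%E.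
  by have := @gagliardo_tmin R N s p p_gt1 w (shifts N t) mw; rewrite size_shifts.
have GWL : (gagliardo s p W <= (L * g)%:E)%E by rewrite EFinM -gE.
have WW : Wsp s p Omega W.
  by split; [exact: mW|exact: WO|apply: le_lt_trans GWL _; exact: ltry].
have closeW : (\int[mu]_x (pw p (W x - w x))%:E <= e1%:E)%E.
  pose r := Num.sqrt t.
  have r0 : 0 < r by rewrite sqrtr_gt0.
  have rT : r <= T by rewrite -(ger0_norm (ltW T0)) -sqrtr_sqr ler_wsqrtr.
  have r1 : r <= 1 by exact: le_trans rT T1.
  apply: le_trans (@tmin_close R N p p_gt1 w (shifts N t) (C * r `^ (s * p) * g) mw _) _.
    move=> k /mapP[[j b] _ ->]; rewrite EFinM -gE; apply: HC => //; first by rewrite r0.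
    move=> i; rewrite /signed_shift !mxE /= !normrM normrX normrN1 expr1n mul1r (gtr0_norm t0).
    rewrite sqr_sqrtr ?(ltW t0)//; case: (_ == _) => /=; by rewrite ?normr1 ?normr0 ?mulr1 ?mulr0// ltW.
  rewrite size_shifts lee_fin; apply: le_trans (HT r r0 rT).
  rewrite (_ : L * C * g * r `^ (s * p) = L * (C * r `^ (s * p) * g)); last by ring.
  by rewrite ler_wpM2r ?mulr_ge0 ?powR_ge0 ?(ltW C0)// ler_nat.
have cO := compl_nonempty Obnd.
have [d d0 Hd] := cutd_compact cO Oopen (@compact_shifts (shifts N t)) KO.
have M0 : 0 < 1 + N%:R * Rr by rewrite ltr_wpDr// mulr_ge0//; lra.
have dM : 0 < d / 2 / (1 + N%:R * Rr) by rewrite !divr_gt0.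
(* A left translation by h moves points of the domain by at most |h| (1 + N
   Rr), hence by at most half the distance d. *)
pose eta := Num.min (T ^+ 2) (d / 2 / (1 + N%:R * Rr)).
have eta0 : 0 < eta by rewrite lt_min T20.
have eta2 : 0 < eta ^+ 2 by rewrite exprn_gt0.
have etaM : eta * (1 + N%:R * Rr) <= d / 2 by rewrite -ler_pdivlMr// /eta ge_min lexx orbT.
have WR x : W x != 0 -> `|x| <= Rr by move=> /WK /KO; exact: OR.
have Rr0 : 0 <= Rr by lra.
have Wfin := Wsp_integrable WW W0.
have hle (h : H) : (forall j, h 0 j ^+ 2 < eta ^+ 2) -> forall j, `|h 0 j| <= eta.
  move=> hj j; have := ltW (hj j); rewrite -[X in X <= _]real_normK ?num_real//.
  by rewrite ler_pXn2r ?nnegrE// ltW.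
pose phi := smoothing W (eta ^+ 2).
have phi_cut x : phi x != 0 -> d / 2 <= cutd Omega x.
  move=> /(smoothing_supp mW W0 Wfin eta2)[h hj Wy].
  set y := hmul (- h) x in Wy; have xE : x = hmul h y by rewrite hmulNKx.
  clearbody y.
  have xy : `|y - x| <= d / 2.
    apply: le_trans etaM; have hn : `|h| <= eta by apply: mx_norm_le; [exact: ltW|exact: hle].
    have -> : y - x = - (h + hform h y *: @hdelta R N ord_max).
      rewrite xE hmul_vec; move: (hform h y) => c.
      by rewrite addrAC (addrC _ y) opprD addrA subrr sub0r.
    rewrite normrN mulrDr mulr1; apply: le_trans (ler_normD _ _) _; apply: lerD => //.
    rewrite normrZ; apply: le_trans (_ : `|hform h y| * 1 <= _).
      by rewrite ler_wpM2l// hdelta_le.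
    rewrite mulr1; apply: le_trans (hform_norm h y) _.
    by rewrite [leRHS]mulrCA; apply: ler_wpM2l => //; apply: ler_pM => //; exact: WR.
  have := cutd_lip cO y x; rewrite mul1r => lip.
  have := Hd y (WK _ Wy); have := ler_norm (cutd Omega y - cutd Omega x).
  by move: lip xy; move: (`|y - x|) (`|_|) (cutd _ _) (cutd _ _) => a1 a2 a3 a4; lra.
have Cphi : C1c Omega phi.
  split; first exact: smoothing_C1 mW W0 WR Wfin Rr0 eta2.
  have cl : closed [set x | d / 2 <= cutd Omega x].
    apply: (closed_comp (f := cutd Omega) (D := [set z : R | d / 2 <= z])); last exact: closed_ge.
    by move=> x _; exact: continuous_cutd.
  have sub : closure [set x | phi x != 0] `<=` [set x | d / 2 <= cutd Omega x].
    rewrite [X in _ `<=` X]((closure_id _).1 cl); apply: closureS; exact: phi_cut.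
  have subO : closure [set x | phi x != 0] `<=` Omega.
    move=> x /sub /= h; apply: contrapT => xO; move: h; rewrite cutd_out// leNgt divr_gt0//.
  split=> //; apply: (subclosed_compact _ (compact_domain_closure Obnd)); first exact: closed_closure.
  by move=> x /subO; exact: subset_closure.
exists phi; split.
- exact: Cphi.
- by move=> x; exact: smoothing_ge0 mW W0 Wfin eta2 x.
- by apply: le_trans GW; exact: (gagliardo_smoothing s p_gt1 mW W0 WR Wfin Rr0 eta2).
have closephi : (\int[mu]_x (pw p (phi x - W x))%:E <= e1%:E)%E.
  apply: (smoothing_close p_gt1 mW W0 WR Wfin Rr0 eta2) => h hj.
  pose r := Num.sqrt eta.
  have r0 : 0 < r by rewrite sqrtr_gt0.
  have rT : r <= T.
    by rewrite -(ger0_norm (ltW T0)) -sqrtr_sqr ler_wsqrtr// /eta ge_min lexx.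
  have r1 : r <= 1 by exact: le_trans rT T1.
  apply: le_trans (HC W (- h) r WW _ _) _; first by rewrite r0.
    by move=> j; rewrite mxE normrN sqr_sqrtr ?(ltW eta0)//; exact: hle.
  apply: le_trans (lee_wpmul2l _ GWL) _; first by rewrite lee_fin mulr_ge0 ?powR_ge0 ?ltW.
  rewrite -EFinM lee_fin; apply: le_trans (HT r r0 rT).
  by rewrite le_eqVlt; apply/orP; left; apply/eqP; ring.
have mphi : measurable_fun [set: H] phi by exact: measurable_smoothing mW W0 WR Wfin Rr0 eta2.
have mpw (v1 v2 : H -> R) : measurable_fun [set: H] v1 -> measurable_fun [set: H] v2 ->
    measurable_fun [set: H] (fun x => pw p (v1 x - v2 x)).
  by move=> m1 m2; apply: (measurableT_comp (@measurable_pw R p)); exact: measurable_funB.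
have c2 : 0 <= 2 `^ p :> R by exact: powR_ge0.
have m1 := mpw _ _ mphi mW; have m2 := mpw _ _ mW mw.
have p12 x : 0 <= pw p (phi x - W x) + pw p (W x - w x) by rewrite addr_ge0 ?pw_ge0.
apply: (@le_trans _ _ (\int[mu]_x (2 `^ p * (pw p (phi x - W x) + pw p (W x - w x)))%:E)%E).
  apply: rint_le.
  - exact: mpw.
  - exact: measurable_funM (measurable_cst _) (measurable_funD m1 m2).
  - by move=> x; exact: pw_ge0.
  - move=> x; have -> : phi x - w x = (phi x - W x) + (W x - w x) by ring.
    exact: pwD.
rewrite (rintZ mu (measurable_funD m1 m2) c2 p12).
rewrite (rintD mu m1 m2 (fun x => pw_ge0 p _) (fun x => pw_ge0 p _)).
apply: le_trans (lee_wpmul2l _ (leeD closephi closeW)) _; first by rewrite lee_fin.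
by rewrite -EFinD -EFinM lee_fin /e1 two_halves// powR_gt0.
Unshelve. all: by end_near.
Qed.

Lemma approximation w : Wsp s p Omega w -> (forall x, 0 <= w x) ->
  exists phi : nat -> H -> R, [/\ forall n, C1c Omega (phi n), forall n x, 0 <= phi n x,
    forall n, (gagliardo s p (phi n) <= shift_card.+1%:R%:E * gagliardo s p w)%E &
    {ae mu, forall x, phi ^~ x @ \oo --> w x}].
Proof.
move=> Ww w0; have [mw _ _] := Ww.
(* Errors 4^-n: one factor 2^-n is spent on almost everywhere boundedness and
   the other one gives convergence. *)
have h0 n : 0 < (2^-1 ^+ n) ^+ 2 :> R by rewrite !exprn_gt0// invr_gt0.
pose phi n := sval (cid (approximation_step Ww w0 (h0 n))).
have Hphi n : [/\ C1c Omega (phi n), forall x, 0 <= phi n x,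
    (gagliardo s p (phi n) <= shift_card.+1%:R%:E * gagliardo s p w)%E &
    (\int[mu]_x (pw p (phi n x - w x))%:E <= ((2^-1 ^+ n) ^+ 2)%:E)%E].
  by rewrite /phi; case: cid.
exists phi; split; [by move=> n; case: (Hphi n)..|].
have h1 n : 0 < 2^-1 ^+ n :> R by rewrite exprn_gt0// invr_gt0.
pose F n x := (2^-1 ^+ n)^-1 * pw p (phi n x - w x).
have mpw n : measurable_fun [set: H] (fun x => pw p (phi n x - w x)).
  apply: (measurableT_comp (@measurable_pw R p)); apply: measurable_funB mw.
  by have [+ _ _ _] := Hphi n => /(C1c_Wsp s_gt0 s_lt1 p_gt1 Oopen Obnd)[].
have c0 n : 0 <= (2^-1 ^+ n)^-1 :> R by rewrite invr_ge0 ltW.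
have mF n : measurable_fun [set: H] (F n) := measurable_funM (measurable_cst _) (mpw n).
have F0 n x : 0 <= F n x by rewrite mulr_ge0 ?pw_ge0.
have IF n : (\int[mu]_x (F n x)%:E <= (2^-1 ^+ n)%:E)%E.
  rewrite (rintZ mu (mpw n) (c0 n) (fun x => pw_ge0 p _)).
  have [_ _ _ hn] := Hphi n; apply: le_trans (lee_wpmul2l _ hn) _; first by rewrite lee_fin.
  by rewrite -EFinM lee_fin expr2 mulKf// gt_eqF.
apply: filterS (rint_ae_bounded mF F0 IF) => x [C HC].
have C0 : 0 <= C by exact: le_trans (HC 0%N).
apply/cvgrPdist_lt => e e0.
have ep : 0 < e `^ p by exact: powR_gt0.
have C1 : 0 < C + 1 by rewrite ltr_wpDl.
have : geometric (C + 1) 2^-1 @ \oo --> (0 : R).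
  by apply: cvg_geometric; rewrite gtr0_norm ?invr_gt0// invf_lt1// ltr1n.
move=> /cvgrPdist_lt /(_ _ ep); apply: filterS => n /=.
rewrite sub0r normrN => hn; rewrite distrC.
have : pw p (phi n x - w x) < e `^ p.
  apply: le_lt_trans (le_lt_trans (ler_norm _) hn).
  have := HC n; rewrite /F mulrC ler_pdivrMr// => /le_trans; apply.
  by rewrite ler_wpM2r ?(ltW (h1 n))// lerDl.
rewrite /pw; apply: contraTT; rewrite -!leNgt => h.
by rewrite ge0_ler_powR ?nnegrE ?(ltW e0) ?(ltW pp).
Qed.

End approximation.

(** * From a solution to the inequality *)

Section sobolev_from_solution.
Variables (R : realType) (N : nat) (s p m : R).
Local Notation mu := (hmu R N).
Local Notation H := (heis R N).
Variables (Omega : set H) (f : H -> R).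
Hypotheses (s_gt0 : 0 < s) (s_lt1 : s < 1) (p_gt1 : 1 < p).
Hypotheses (m_gt0 : 0 < m) (m_lt1 : m < 1).
Hypotheses (Oopen : open Omega) (Obnd : bounded_set Omega) (Osm : smooth_boundary Omega).
Hypotheses (mf : measurable_fun [set: H] f) (f_ge0 : forall x, 0 <= f x)
  (f_out : forall x, ~ Omega x -> f x = 0).
Variable u : H -> R.
Hypotheses (Wu : Wsp s p Omega u) (u_ge0 : forall x, 0 <= u x)
  (u_pos : {ae mu, forall x, Omega x -> 0 < u x}).
Hypothesis u_weak : forall phi, C1c Omega phi ->
  energy s p u phi = (\int[mu]_x (u x `^ (m - 1) * phi x * f x)%:E)%E.
Implicit Types (v w phi : H -> R).

Let pp : 0 < p. Proof. by have := p_gt1; lra. Qed.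
Let mu_ : measurable_fun [set: H] u. Proof. by case: Wu. Qed.

Lemma energy_le phi : measurable_fun [set: H] phi ->
  (energy s p u phi <= gagliardo s p u + gagliardo s p phi)%E.
Proof.
move=> mphi; have m1 := measurable_pwdiff p mu_; have m2 := measurable_pwdiff p mphi.
have p1 (z : H * H) : 0 <= pw p (u z.1 - u z.2) by exact: pw_ge0.
have p2 (z : H * H) : 0 <= pw p (phi z.1 - phi z.2) by exact: pw_ge0.
rewrite !gagliardoE -(dKD s p m1 m2 p1 p2).
have mJ := measurable_energy s p mu_ mphi.
rewrite /energy; apply: le_trans (lee_abs _) _.
apply: le_trans (le_abse_integral _ measurableT _) _; first exact/measurable_EFinP.
apply: ge0_le_integral => //.
- by apply: measurableT_comp => //; exact/measurable_EFinP.
- by apply/measurable_EFinP; exact: measurable_funM (measurable_funD m1 m2) (@measurable_hkernel R N s p).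
- move=> z _; rewrite /= lee_fin normrM (ger0_norm (hkernel_ge0 _ _ _)).
  by rewrite ler_wpM2r ?hkernel_ge0// Jp_young.
Qed.

(** Test the equation with the approximations of w, bound the left-hand side by
    Young's inequality and apply Fatou's lemma on the right. What matters is
    that the bound for the energies does not depend on the approximation. *)
Lemma weighted_bound w : Wsp s p Omega w -> (forall x, 0 <= w x) ->
  (\int[mu]_x (u x `^ (m - 1) * w x * f x)%:E <=
   gagliardo s p u + (shift_card N).+1%:R%:E * gagliardo s p w)%E.
Proof.
move=> Ww w0; have [mw _ _] := Ww.
have [phi [Cphi phi0 Gphi phiw]] := approximation s_gt0 s_lt1 p_gt1 Oopen Obnd Osm Ww w0.
have mphi n : measurable_fun [set: H] (phi n).
  by have [] := C1c_Wsp s_gt0 s_lt1 p_gt1 Oopen Obnd (Cphi n).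
apply: (@rint_fatou _ _ R mu (fun n x => u x `^ (m - 1) * phi n x * f x)).
- by move=> n; exact: measurable_weighted.
- exact: measurable_weighted.
- by move=> n x; rewrite !mulr_ge0 ?powR_ge0.
- by move=> x; rewrite !mulr_ge0 ?powR_ge0.
- apply: filterS phiw => x hx; apply: cvgMl; apply: cvgMr; exact: hx.
- move=> n; rewrite -(u_weak (Cphi n)); apply: le_trans (energy_le (mphi n)) _.
  by rewrite leeD2l.
Qed.

(** The tangent of t^m at u gives |v|^m <= m |v| u^(m-1) + (1 - m) u^m, and
    [weighted_bound] applies to both terms since u^m = u^(m-1) u. *)
Lemma Fi_bound : exists2 A : R, 0 < A & forall v, Wsp s p Omega v ->
  (Fi m f v <= A%:E * (1 + gagliardo s p v))%E.
Proof.
have [_ _ Gu] := Wu; pose g := fine (gagliardo s p u).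
have gE : gagliardo s p u = g%:E by exact: gagliardo_fin.
have g0 : 0 <= g by apply: fine_ge0; exact: gagliardo_ge0.
pose L : R := (shift_card N).+1%:R.
have L0 : 0 < L by rewrite ltr0Sn.
exists (m * g + m * L + (1 - m) * (g + L * g) + 1) => [|v Wv].
  rewrite ltr_wpDl// !addr_ge0// ?mulr_ge0// ?(ltW m_gt0) ?(ltW L0) ?subr_ge0 ?(ltW m_lt1)//.
  by rewrite addr_ge0// mulr_ge0// ltW.
pose w x := `|v x|.
have Ww : Wsp s p Omega w.
  have mn : measurable_fun [set: R] (fun t : R => `|t|) by exact: normr_measurable.
  have lip (a b : R) : `| `|a| - `|b| | <= `|a - b| by exact: ler_dist_dist.
  exact: (@Wsp_contraction R N s p Omega p_gt1 (fun t : R => `|t|) v mn (normr0 _) lip Wv).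
have w0 x : 0 <= w x by rewrite /w.
have [mv _ Gv] := Wv; have [mw _ Gw] := Ww.
have GwE : (gagliardo s p w <= gagliardo s p v)%E.
  by apply: (gagliardo_contraction s p_gt1 mw mv) => x y; exact: ler_dist_dist.
have m1 := measurable_weighted (m - 1) mu_ mw mf; have m2 := measurable_weighted (m - 1) mu_ mu_ mf.
have p1 x : 0 <= u x `^ (m - 1) * w x * f x by rewrite !mulr_ge0 ?powR_ge0.
have p2 x : 0 <= u x `^ (m - 1) * u x * f x by rewrite !mulr_ge0 ?powR_ge0.
have m0 : 0 <= m by exact: ltW.
have m10 : 0 <= 1 - m by rewrite subr_ge0 ltW.
have mm1 : measurable_fun [set: H] (fun x => m * (u x `^ (m - 1) * w x * f x)).
  exact: measurable_funM (measurable_cst _) m1.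
have mm2 : measurable_fun [set: H] (fun x => (1 - m) * (u x `^ (m - 1) * u x * f x)).
  exact: measurable_funM (measurable_cst _) m2.
have pm1 x : 0 <= m * (u x `^ (m - 1) * w x * f x) by rewrite mulr_ge0.
have pm2 x : 0 <= (1 - m) * (u x `^ (m - 1) * u x * f x) by rewrite mulr_ge0.
have h1 : (Fi m f v <= \int[mu]_x (m * (u x `^ (m - 1) * w x * f x) + (1 - m) * (u x `^ (m - 1) * u x * f x))%:E)%E.
  apply: rint_le_ae.
  - exact: measurable_Fi.
  - exact: measurable_funD mm1 mm2.
  - by move=> x; exact: Fi_integrand_ge0.
  - by move=> x; rewrite addr_ge0.
  - apply: filterS u_pos => x ux; have [xO|xO] := pselect (Omega x); last first.
      by rewrite f_out// !mulr0 addr0.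
    have up := ux xO; rewrite /pw !mulrA -mulrDl ler_wpM2r//.
    have := powR_concave_tangent m_gt0 m_lt1 (w0 x) up; rewrite /w.
    rewrite -(mulr_powRB1 (ltW up) m_gt0) => /le_trans; apply.
    by rewrite le_eqVlt; apply/orP; left; apply/eqP; ring.
apply: (le_trans h1).
rewrite (rintD mu mm1 mm2 pm1 pm2) (rintZ mu m1 m0 p1) (rintZ mu m2 m10 p2).
have b1 := le_trans (weighted_bound Ww w0) (leeD2l _ (lee_wpmul2l _ GwE)).
have b2 := weighted_bound Wu u_ge0.
rewrite gE in b1 b2; rewrite (gagliardo_fin Gv) in b1 *.
have v0 : 0 <= fine (gagliardo s p v) by apply: fine_ge0; exact: gagliardo_ge0.
move: (fine (gagliardo s p v)) v0 b1 => t t0 b1.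
have {}b1 := b1 (_ : (0 <= L%:E)%E); rewrite lee_fin in b1; have {}b1 := b1 (ltW L0).
rewrite -EFinM -EFinD in b1; rewrite -EFinM -EFinD in b2.
apply: le_trans (leeD (lee_wpmul2l _ b1) (lee_wpmul2l _ b2)) _; rewrite ?lee_fin//.
rewrite -/L.
have mg : 0 <= m * g by rewrite mulr_ge0.
have mL : 0 <= m * L by rewrite mulr_ge0// ltW.
have gL : 0 <= (1 - m) * (g + L * g) by rewrite mulr_ge0// addr_ge0// mulr_ge0// ltW.
have -> : m * (g + L * t) = m * g + m * L * t by ring.
by move: (m * g) (m * L) ((1 - m) * _) mg mL gL => a b c; nra.
Qed.

(** The bound A (1 + G) of [Fi_bound] becomes homogeneous once v is scaled to
    have energy G = 1. *)
Lemma sobolev_of_solution : exists2 C : R, 0 < C & forall v, Wsp s p Omega v ->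
  (C%:E * Fi m f v `^ (p / m) <= gagliardo s p v)%E.
Proof.
have [A A0 HA] := Fi_bound.
have pm0 : 0 < p / m by rewrite divr_gt0.
have A2 : 0 < 2 * A by rewrite mulr_gt0.
exists (((2 * A) `^ (p / m))^-1) => [|v Wv]; first by rewrite invr_gt0 powR_gt0.
have [mv vO Gv] := Wv; pose g := fine (gagliardo s p v).
have gE : gagliardo s p v = g%:E by exact: gagliardo_fin.
have g0 : 0 <= g by apply: fine_ge0; exact: gagliardo_ge0.
(* A function of zero energy cannot be scaled; by Poincare's inequality it
   vanishes almost everywhere. *)
have [gz|gz] := eqVneq g 0.
  have [C C0 HC] := poincare s_gt0 p_gt1 Oopen Obnd.
  have := HC v mv vO; rewrite gE gz mule0 => h.
  have vz := rint_eq0 (measurableT_comp (@measurable_pw R p) mv) (fun x => pw_ge0 p _) h.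
  have -> : Fi m f v = 0%E.
    rewrite /Fi (@rint_ae_eq _ _ R mu (fun x => pw m (v x) * f x) (fun=> 0)) ?integral0//.
      exact: measurable_Fi.
    apply: filterS vz => x; rewrite /pw => /powR_eq0_eq0 /eqP.
    by rewrite normr_eq0 => /eqP ->; rewrite normr0 powR0 ?mul0r// gt_eqF.
  by rewrite poweR_EFin powR0 ?gt_eqF// mule0.
have gp : 0 < g by rewrite lt_neqAle eq_sym gz.
pose c := g `^ (- p^-1).
have c0 : 0 < c by exact: powR_gt0.
have Wc := WspZ c Wv.
have Gc : gagliardo s p (fun x => c * v x) = 1%E.
  rewrite gagliardoZ// gE -EFinM; congr (_ %:E).
  rewrite pw_ger0 ?(ltW c0)// /c -powRrM mulNr mulVf ?gt_eqF// powR_inv1 ?(ltW gp)//.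
  by rewrite mulVf.
have := HA _ Wc; rewrite Gc.
have -> : Fi m f (fun x => c * v x) = ((c `^ m)%:E * Fi m f v)%E.
  have cm : 0 <= c `^ m by exact: powR_ge0.
  rewrite /Fi -(rintZ mu (measurable_Fi m mf mv) cm (Fi_integrand_ge0 m f_ge0 v)).
  by apply: eq_integral => x _; rewrite pwM (pw_ger0 _ (ltW c0)) mulrA.
have -> : (A%:E * (1 + 1) = (2 * A)%:E)%E by rewrite -EFinD -EFinM mulrC.
have cm : 0 < c `^ m by exact: powR_gt0.
rewrite -(lee_pdivlMl _ _ cm) -EFinM => hF.
have F0 := Fi_ge0 m f_ge0 v.
have Ffin : Fi m f v \is a fin_num by rewrite ge0_fin_numE//; apply: le_lt_trans hF (ltry _).
move: hF F0; rewrite -(fineK Ffin) gE; move: (fine _) => r; rewrite !lee_fin => hr r0.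
rewrite ler_pdivrMl ?powR_gt0//.
have : r `^ (p / m) <= ((c `^ m)^-1 * (2 * A)) `^ (p / m).
  by rewrite ge0_ler_powR ?nnegrE ?(ltW pm0)// mulr_ge0 ?invr_ge0 ?powR_ge0 ?(ltW A2).
move=> /le_trans; apply.
rewrite [leLHS]powRM ?invr_ge0 ?powR_ge0 ?(ltW A2)//.
have -> : ((c `^ m)^-1) `^ (p / m) = g.
  rewrite -powRN -powRrM /c -powRrM.
  have -> : - p^-1 * (- m * (p / m)) = 1 by field; rewrite !gt_eqF.
  by rewrite powRr1.
by rewrite mulrC.
Qed.

End sobolev_from_solution.

Theorem theorem1p12 (R : realType) (N : nat) (s p delta : R)
    (Omega : set (heis R N)) (f : heis R N -> R)
    (N_ge1 : (1 <= N)%N)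
    (s_gt0 : 0 < s) (s_lt1 : s < 1) (p_gt1 : 1 < p) (p_ltQ : p < (hdim N)%:R)
    (delta_gt0 : 0 < delta) (delta_lt1 : delta < 1)
    (Omega_domain : bounded_smooth_domain Omega)
    (f_L1 : (hmu R N).-integrable Omega (EFin \o f))
    (f_ge0 : {ae hmu R N, forall x, Omega x -> 0 <= f x})
    (f_neq0 : ~ {ae hmu R N, forall x, Omega x -> f x = 0}) :
  (exists2 C : R, 0 < C &
     forall v : heis R N -> R, HW0 s p Omega v ->
       (C%:E * (\int[hmu R N]_(x in Omega)
                  (`|v x| `^ (1 - delta) * f x)%:E) `^ (p / (1 - delta))
          <= gagliardo s p v)%E)
  <->
  (exists u : heis R N -> R, weak_solution s p delta Omega f u).
Proof.
have [Oopen _ _ Obnd Osm] := Omega_domain.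
have mO := measurable_domain Oopen.
have m_gt0 : 0 < 1 - delta by rewrite subr_gt0.
have m_lt1 : 1 - delta < 1 by rewrite gtrBl.
have mE : 1 - delta - 1 = - delta by rewrite addrAC subrr sub0r.
have mEf : measurable_fun Omega f by case/integrableP: f_L1 => /measurable_EFinP.
(* F is f off a null set, but nonnegative and supported in the domain at
   every point; integrals over Omega against f become integrals over the
   whole group against F. *)
pose F x := Num.max 0 (f x) * \1_Omega x.
have FE : F = (fun x => Num.max 0 (f x)) \_ Omega.
  apply/funext => x; rewrite /F patchE indicE; case: (x \in Omega) => /=.
    by rewrite mulr1.
  by rewrite mulr0.
have mF : measurable_fun [set: heis R N] F.
  rewrite FE; apply/(measurable_restrictT _ mO).
  exact: measurable_maxr (measurable_cst _) mEf.
have F0 x : 0 <= F x by rewrite mulr_ge0// le_max lexx.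
have Fout x : ~ Omega x -> F x = 0 by move=> xO; rewrite /F indicE memNset// mulr0.
have Ff : {ae hmu R N, forall x, Omega x -> F x = f x}.
  apply: filterS f_ge0 => x fx xO; rewrite /F indicE mem_set// mulr1 max_r//; exact: fx.
have transfer (h : heis R N -> R) (k : heis R N -> R) : measurable_fun [set: heis R N] h ->
    measurable_fun [set: heis R N] k -> {ae hmu R N, forall x, k x = h x} ->
    (\int[hmu R N]_(x in Omega) (k x * f x)%:E = \int[hmu R N]_x (h x * F x)%:E)%E.
  move=> mh mk kh.
  rewrite [RHS](_ : _ = \int[hmu R N]_(x in Omega) (h x * F x)%:E)%E; last first.
    rewrite [RHS]integral_mkcond; apply: eq_integral => x _; rewrite patchE.
    by case: ifPn => // /negP xO; rewrite Fout ?mulr0// => /mem_set.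
  apply: ae_eq_integral => //.
  - apply/measurable_EFinP; apply: measurable_funM => //; exact: measurable_funTS.
  - apply/measurable_EFinP; apply: measurable_funTS; exact: measurable_funM.
  - by apply: filterS2 kh Ff => x -> Fx xO; rewrite Fx.
have F_neq0 : ~ {ae hmu R N, forall x, F x = 0}.
  move=> h; apply: f_neq0; apply: filterS2 h Ff => x Fx fx xO; by rewrite -fx.
have F_fin : (\int[hmu R N]_x (F x)%:E < +oo)%E.
  have := transfer (fun=> 1) (fun=> 1) (measurable_cst _) (measurable_cst _) (aeW _ (fun=> erefl)).
  under eq_integral do rewrite mul1r; under [X in _ = X -> _]eq_integral do rewrite mul1r.
  by move=> <-; exact: integrable_lty.
have Fi_transfer (v w : heis R N -> R) : measurable_fun [set: heis R N] v -> measurable_fun [set: heis R N] w ->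
    {ae hmu R N, forall x, v x = w x} ->
    (\int[hmu R N]_(x in Omega) (`|v x| `^ (1 - delta) * f x)%:E = Fi (1 - delta) F w)%E.
  move=> mv mw vw; apply: (transfer (fun x => pw (1 - delta) (w x)) (fun x => pw (1 - delta) (v x))).
  - exact: measurableT_comp (@measurable_pw R _) mw.
  - exact: measurableT_comp (@measurable_pw R _) mv.
  - by apply: filterS vw => x ->.
split=> [[C1 C10 HC]|[u [HW0u u_low u_weak]]].
- have HI v : Wsp s p Omega v -> (C1%:E * Fi (1 - delta) F v `^ (p / (1 - delta)) <= gagliardo s p v)%E.
    move=> Wv; have [mv _ _] := Wv.
    rewrite -(Fi_transfer v v mv mv (aeW _ (fun=> erefl))).
    exact: HC (Wsp_HW0 s_gt0 p_gt1 Oopen Obnd Wv).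
  have [u [Wu u0 un0 umin]] := minimizer s_gt0 s_lt1 p_gt1 m_gt0 m_lt1 Oopen Obnd mF F0 Fout F_neq0 C10 HI.
  have [mu_ uO _] := Wu.
  have Ffin v : Wsp s p Omega v -> (Fi (1 - delta) F v < +oo)%E.
    by move=> Wv; rewrite (Fi_fin p_gt1 m_gt0 F0 C10 HI Wv) ltry.
  exists u; split.
  + exact: Wsp_HW0.
  + move=> om [com omO].
    have [C C0 HCl] := minimizer_lower_bound s_gt0 s_lt1 p_gt1 m_gt0 Oopen Obnd mF F0 Ffin Wu u0 un0 umin com omO.
    exists C => //; apply: filterS HCl => x h xom; apply: h; exact: subset_closure.
  + move=> phi Cphi.
    rewrite (minimizer_euler_lagrange s_gt0 s_lt1 p_gt1 m_gt0 m_lt1 Oopen Obnd mF F0 F_fin Ffin Wu u0 un0 umin Cphi).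
    have [mphi _ _] := C1c_Wsp s_gt0 s_lt1 p_gt1 Oopen Obnd Cphi.
    have mh : measurable_fun [set: heis R N] (fun x => u x `^ (- delta) * phi x).
      by apply: measurable_funM => //; exact: (measurableT_comp (@measurable_powR R _)).
    rewrite mE -(transfer _ _ mh mh (aeW _ (fun=> erefl))).
    by apply: eq_integral => x _; congr (_ %:E); ring.
- have [[Wu' uu'] mu_] : (Wsp s p Omega (fun x => u x * \1_Omega x) /\ {ae hmu R N, forall x, u x = u x * \1_Omega x}) /\ measurable_fun [set: heis R N] u.
    split; first exact: HW0_rep.
    by have [[uL _] _] := HW0u; have := sub_Lfun_mfun uL; rewrite inE.
  have cO := compl_nonempty Obnd.
  have u_pos : {ae hmu R N, forall x, Omega x -> 0 < u x}.
    (* The compact sets {cutd >= 1/(k+1)} exhaust the domain, so the local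
       lower bounds give positivity almost everywhere. *)
    have hn k : {ae hmu R N, forall x, k.+1%:R^-1 <= cutd Omega x -> 0 < u x}.
      have cl : closed [set x | k.+1%:R^-1 <= cutd Omega x].
        apply: (closed_comp (f := cutd Omega) (D := [set z : R | k.+1%:R^-1 <= z])); last exact: closed_ge.
        by move=> x _; exact: continuous_cutd.
      have sub : [set x | k.+1%:R^-1 <= cutd Omega x] `<=` Omega.
        move=> x /= h; apply: contrapT => xO; move: h; rewrite cutd_out// leNgt invr_gt0 ltr0Sn//.
      have cc : compactly_contained [set x | k.+1%:R^-1 <= cutd Omega x] Omega.
        rewrite /compactly_contained -((closure_id _).1 cl); split=> //.
        apply: (subclosed_compact cl (compact_domain_closure Obnd)).
        by move=> x /sub; exact: subset_closure.
      have [C C0 HC] := u_low _ cc.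
      by apply: filterS HC => x h /h; exact: lt_le_trans.
    apply: filterS (ae_foralln hn) => x hx xO.
    have [k hk] := ltr_add_invr (cutd_gt0 cO Oopen xO).
    by apply: (hx k); apply: ltW; rewrite add0r in hk.
  pose w x := Num.max 0 (u x * \1_Omega x).
  have uw : {ae hmu R N, forall x, u x = w x}.
    apply: filterS2 u_pos uu' => x ux ->; rewrite /w indicE.
    have [|xO] := boolP (x \in Omega); last by rewrite mulr0 maxxx.
    by rewrite inE => /ux up; rewrite !mulr1 max_r// ltW.
  have Ww : Wsp s p Omega w.
    have mn : measurable_fun [set: R] (fun t : R => Num.max 0 t).
      exact: measurable_maxr (measurable_cst _) (@measurable_id _ _ _).
    have lip (a b : R) : `|Num.max 0 a - Num.max 0 b| <= `|a - b|.
      by have := max0_contraction 0 a b; rewrite !subr0.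
    exact: (@Wsp_contraction R N s p Omega p_gt1 (fun t : R => Num.max 0 t) _ mn (maxxx _) lip Wu').
  have [mw _ _] := Ww.
  have w0 x : 0 <= w x by rewrite /w le_max lexx.
  have w_pos : {ae hmu R N, forall x, Omega x -> 0 < w x}.
    by apply: filterS2 u_pos uw => x ux <-.
  have w_weak phi : C1c Omega phi ->
      energy s p w phi = (\int[hmu R N]_x (w x `^ (1 - delta - 1) * phi x * F x)%:E)%E.
    move=> Cphi; have [mphi _ _] := C1c_Wsp s_gt0 s_lt1 p_gt1 Oopen Obnd Cphi.
    rewrite -(energy_ae_eq s p mu_ mw mphi uw) u_weak// mE.
    rewrite -(transfer (fun x => w x `^ (- delta) * phi x) (fun x => u x `^ (- delta) * phi x)).
    + by apply: eq_integral => x _; congr (_ %:E); ring.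
    + by apply: measurable_funM => //; exact: (measurableT_comp (@measurable_powR R _)).
    + by apply: measurable_funM => //; exact: (measurableT_comp (@measurable_powR R _)).
    + by apply: filterS uw => x ->.
  have [C C0 HC] := sobolev_of_solution s_gt0 s_lt1 p_gt1 m_gt0 m_lt1 Oopen Obnd Osm mF F0 Fout Ww w0 w_pos w_weak.
  exists C => // v Hv; have [Wv' vv'] := HW0_rep Oopen Hv.
  have mv : measurable_fun [set: heis R N] v.
    by have [[vL _] _] := Hv; have := sub_Lfun_mfun vL; rewrite inE.
  have [mv' _ _] := Wv'.
  rewrite (Fi_transfer _ _ mv mv' vv') (gagliardo_ae_eq s p mv mv' vv').
  exact: HC.
Qed.
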